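(* Let $\{x_{ij};\, i,j\ge 1\}$ be i.i.d. real random variables with mean $\mu$ and variance $\sigma^2>0$, and suppose $E e^{t_0|x_{11}|^{\alpha}}<\infty$ for some $0<\alpha\le 2$ and $t_0>0$. Set $\beta=\alpha/(4+\alpha)$. Let $p=p(n)$ be positive integers with $p\to\infty$ and $\log p=o(n^{\beta})$ as $n\to\infty$. Let $X_n=(x_{ij})_{1\le i\le n,\,1\le j\le p}$ and let $L_n$ be the coherence of $X_n$, i.e. the largest absolute value of the off-diagonal entries of its sample correlation matrix. Then, as $n\to\infty$, $nL_n^2-4\log p+\log\log p$ converges weakly to the extreme distribution of type I with distribution function $$F(y)=e^{-\frac{1}{\sqrt{8\pi}}e^{-y/2}},\quad y\in\mathbb{R}.$$
   Context: Let $x_1,\dots,x_p\in\mathbb{R}^n$ be the columns of $X_n$, $\bar x_k=\frac1n\sum_{i=1}^n x_{ik}$, and $e=(1,\dots,1)^T\in\mathbb{R}^n$; write $x_i-\bar x_i$ for $x_i-\bar x_i e$. With $\|\cdot\|$ the Euclidean norm, the sample correlation coefficients are $$\rho_{ij}=\frac{(x_i-\bar x_i)^T(x_j-\bar x_j)}{\|x_i-\bar x_i\|\cdot\|x_j-\bar x_j\|},\quad 1\le i,j\le p,$$ and $L_n=\max_{1\le i<j\le p}|\rho_{ij}|$. $\log$ is the natural logarithm. *)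

(* Defs.v *)
From HB Require Import structures.
From mathcomp Require Import all_boot all_order all_algebra finmap.
From mathcomp Require Import all_classical all_reals all_analysis.
From mathcomp Require Import measurable_realfun.

Set Implicit Arguments.
Unset Strict Implicit.
Unset Printing Implicit Defensive.

Import Order.TTheory GRing.Theory Num.Theory.
Import numFieldNormedType.Exports.

Local Open Scope classical_set_scope.
Local Open Scope ring_scope.

Section iid.
Context {d : measure_display} {T : measurableType d} {R : realType}.
Context (P : probability T R) {I : choiceType}.

Definition mutually_independent (X : I -> {RV P >-> R}) : Prop :=
  forall (S : {fset I}) (A : I -> set R), (forall i, measurable (A i)) ->
    P (\bigcap_(i in [set` S]) (X i @^-1` A i)) =
    (\prod_(i <- S) P (X i @^-1` A i))%E.

Definition identically_distributed (X : I -> {RV P >-> R}) : Prop :=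
  forall (i j : I) (A : set R), measurable A ->
    distribution P (X i) A = distribution P (X j) A.

Definition iid (X : I -> {RV P >-> R}) : Prop :=
  mutually_independent X /\ identically_distributed X.

End iid.

(* Weak convergence to the law with distribution function F: the distribution
   functions converge at every continuity point of F. *)
Definition weak_cvg {d : measure_display} {T : measurableType d} {R : realType}
    (P : probability T R) (Y : nat -> {RV P >-> R})
    (F : cumulativeBounded (0 : R) (1 : R)) : Prop :=
  forall y : R, {for y, continuous F} ->
    cdf (Y n) y @[n --> \oo] --> (F y)%:E.

Section coherence.
Context {R : realType} {n p : nat}.
Implicit Type A : 'M[R]_(n, p).

(* The library norm on matrices is the sup norm, not the Euclidean one. *)
Definition norm2 (v : 'cV[R]_n) : R := Num.sqrt (\sum_(i < n) v i 0 ^+ 2).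

Definition col_mean A (k : 'I_p) : R := n%:R^-1 * \sum_(i < n) A i k.

Definition centered_col A (k : 'I_p) : 'cV[R]_n :=
  col k A - const_mx (col_mean A k).

(* Since 0^-1 = 0, a constant column has correlation 0 with every column. *)
Definition sample_corr A : 'M[R]_p :=
  \matrix_(i, j)
    (((centered_col A i)^T *m centered_col A j) 0 0 /
     (norm2 (centered_col A i) * norm2 (centered_col A j))).

(* The absolute values being nonnegative, the initial value 0 only matters
   when there is no pair i < j. *)
Definition coherence A : R :=
  \big[Num.max/0]_(ij : 'I_p * 'I_p | (ij.1 < ij.2)%N)
    `|sample_corr A ij.1 ij.2|.

End coherence.

Section coherence_statistic.
Context {d : measure_display} {T : measurableType d} {R : realType}.
Context (X : nat -> nat -> {mfun T >-> R}).

(* Rows and columns are numbered from 0. *)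
Definition data_matrix (n p : nat) (w : T) : 'M[R]_(n, p) :=
  \matrix_(i < n, k < p) X i k w.

Definition coherence_stat (n p : nat) (w : T) : R :=
  n%:R * coherence (data_matrix n p w) ^+ 2 - 4 * ln p%:R + ln (ln p%:R).

Lemma measurable_centered_col n p (k : 'I_p) (i : 'I_n) :
  measurable_fun [set: T]
    (fun w => centered_col (data_matrix n p w) k i 0).
Proof.
under eq_fun do rewrite !mxE /col_mean.
apply: measurable_funB => //.
apply: measurable_funM => //; apply: measurable_sum => l.
by rewrite [X in measurable_fun _ X](_ : _ = X l k :> (T -> R)) //; apply/funext => w; rewrite mxE.
Qed.

Lemma measurable_norm2_centered n p (k : 'I_p) :
  measurable_fun [set: T] (fun w => norm2 (centered_col (data_matrix n p w) k)).
Proof.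
apply: (@measurableT_comp _ _ _ _ _ _ (@Num.sqrt R)).
  by apply: continuous_measurable_fun; exact: sqrt_continuous.
apply: measurable_sum => i; apply: measurable_funX.
exact: measurable_centered_col.
Qed.

Lemma measurable_sample_corr n p (i j : 'I_p) :
  measurable_fun [set: T] (fun w => sample_corr (data_matrix n p w) i j).
Proof.
under eq_fun do rewrite mxE mxE.
apply: measurable_funM.
  apply: measurable_sum => l; apply: measurable_funM.
    by under eq_fun do rewrite mxE; exact: measurable_centered_col.
  exact: measurable_centered_col.
under eq_fun do rewrite -powR_inv1 ?mulr_ge0 ?sqrtr_ge0//.
apply: (@measurableT_comp _ _ _ _ _ _ (fun x : R => x `^ (-1))).
  exact: measurable_powR.
by apply: measurable_funM; exact: measurable_norm2_centered.
Qed.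

Lemma measurable_coherence n p :
  measurable_fun [set: T] (fun w => coherence (data_matrix n p w)).
Proof.
rewrite /coherence; elim: (index_enum _) => [|ij s IH].
  by under eq_fun do rewrite big_nil; exact: measurable_cst.
under eq_fun do rewrite big_cons.
case: (ij.1 < ij.2)%N => //.
apply: (@measurable_maxr _ _ _ _
  (fun w => `|sample_corr (data_matrix n p w) ij.1 ij.2|)) => //.
by apply: measurableT_comp => //; exact: measurable_sample_corr.
Qed.

Lemma measurable_coherence_stat n p :
  measurable_fun [set: T] (coherence_stat n p).
Proof.
apply: measurable_funD => //; apply: measurable_funB => //.
apply: measurable_funM => //; apply: measurable_funX.
exact: measurable_coherence.
Qed.

HB.instance Definition _ n p :=
  isMeasurableFun.Build _ _ _ _ (coherence_stat n p)
    (measurable_coherence_stat n p).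

End coherence_statistic.

Section extreme_type1.
Context {R : realType}.

Definition extreme1_cdf (y : R) : R :=
  expR (- (1 / Num.sqrt (8 * pi) * expR (- y / 2))).

Let c_gt0 : 0 < 1 / Num.sqrt (8 * pi) :> R.
Proof. by rewrite divr_gt0// sqrtr_gt0 mulr_gt0// pi_gt0. Qed.

Let extreme1_nd : nondecreasing extreme1_cdf.
Proof.
move=> x y xy; rewrite ler_expR lerN2 ler_pM2l// ler_expR.
by rewrite ler_pM2r ?invr_gt0// lerN2.
Qed.

Let extreme1_rc : right_continuous extreme1_cdf.
Proof.
apply: right_continuousW => y.
apply: (@cvg_comp _ _ _ (fun y : R => - (1 / Num.sqrt (8 * pi) * expR (- y / 2)))
  expR); last exact: continuous_expR.
apply: cvgN; apply: cvgM; first exact: cvg_cst.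
apply: (@cvg_comp _ _ _ (fun y : R => - y / 2) expR); last exact: continuous_expR.
by apply: cvgM; [apply: cvgN; exact: cvg_id|exact: cvg_cst].
Qed.

HB.instance Definition _ :=
  isCumulative.Build R _ R extreme1_cdf extreme1_nd extreme1_rc.

Let expR_cvgy : expR x @[x --> +oo] --> (+oo : set_system R).
Proof.
apply/cvgryPge => A; near=> x.
rewrite (le_trans _ (expR_ge1Dx x))// -lerBlDl.
near: x; apply: nbhs_pinfty_ge; exact: num_real.
Unshelve. all: by end_near. Qed.

Let half_cvgy : y / 2 @[y --> +oo] --> (+oo : set_system R).
Proof. by apply: gt0_cvgMly => //; rewrite invr_gt0. Qed.

Let extreme1_Ny : extreme1_cdf @ -oo --> (0 : R).
Proof.
apply/cvgNy_compNP; rewrite /extreme1_cdf.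
apply: (@cvg_comp _ _ _ (fun y : R => 1 / Num.sqrt (8 * pi) * expR (- - y / 2))
  (fun z => expR (- z))); last exact: cvgr_expR.
apply: gt0_cvgMry => //; under eq_fun do rewrite opprK.
exact: cvg_comp half_cvgy expR_cvgy.
Qed.

Let extreme1_y : extreme1_cdf @ +oo --> (1 : R).
Proof.
rewrite -expR0 -oppr0 -(mulr0 (1 / Num.sqrt (8 * pi))).
apply: (@cvg_comp _ _ _ _ expR); last exact: continuous_expR.
apply: cvgN; apply: cvgM; first exact: cvg_cst.
under eq_fun do rewrite mulNr.
exact: (@cvg_comp _ _ _ (fun y : R => y / 2) (fun z => expR (- z)) _ _ _
  half_cvgy (@cvgr_expR R)).
Qed.

HB.instance Definition _ :=
  isCumulativeBounded.Build R 0 1 extreme1_cdf extreme1_Ny extreme1_y.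

End extreme_type1.

(* Main.v *)
Require Import Defs.
From HB Require Import structures.
From mathcomp Require Import all_boot all_order all_algebra finmap.
From mathcomp Require Import all_classical all_reals all_analysis.
From mathcomp Require Import measurable_realfun ring lra.

Set Implicit Arguments.
Unset Strict Implicit.
Unset Printing Implicit Defensive.

Import Order.TTheory GRing.Theory Num.Theory.
Import numFieldNormedType.Exports.

Local Open Scope classical_set_scope.
Local Open Scope ring_scope.

(* For x^2 = 4 log p - log log p + y the coherence statistic is at most y iff
   none of the events A_ij = {n rho_ij^2 > x^2}, i < j < p, occurs. A_ij is
   independent of all the A_kl with {k, l} disjoint from {i, j}, so revealing
   the pairs one after the other compares P(none) with the exponential of
   - sum P(A_ij), provided that P(A_ij) ~ 2 phi(x) / x, phi being the standard
   normal density, and that P(A_ij /\ A_ik) = o(p^-3).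

   The moderate deviation estimate is proved for entries truncated at
   n^(1/(4+alpha)) by Lindeberg replacement, with logistic test functions: their
   Taylor remainder is bounded relatively to the function itself, so n
   replacements cost only a factor (1 + o(1/n))^n although the probability is of
   order p^-2. The bound for A_ij /\ A_ik and the replacement of the empirical
   means and variances by 0 and 1 are Chernoff bounds for truncated sums. *)

Section independence.
Context {d : measure_display} {T : measurableType d} {R : realType}.
Context (P : probability T R).
Local Open Scope ereal_scope.

Lemma pi_lambda_indep (G : set (set T)) (B : set T) :
  G `<=` measurable -> setI_closed G -> measurable B ->
  (forall A, G A -> P (A `&` B) = P A * P B) ->
  forall A, <<s G >> A -> P (A `&` B) = P A * P B.
Proof.
move=> Gm GI mB GB A.
rewrite -(setI_closed_g_dynkin_g_sigma_algebra GI) => sA.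
suff [] : measurable A /\ P (A `&` B) = P A * P B by [].
have fB : P B \is a fin_num by exact: fin_num_measure.
move: A sA; apply: smallest_sub; last by move=> A GA; split; [exact: Gm|exact: GB].
split => [|A [mA iA]|F tF mF].
- by split => //; rewrite setTI probability_setT mul1e.
- split; first exact: measurableC.
  have -> : ~` A `&` B = B `\` (A `&` B).
    by rewrite setIC -setDE setDIr setDv setU0.
  rewrite measureD//; [|exact: measurableI|by rewrite -ge0_fin_numE].
  have -> : B `&` (A `&` B) = A `&` B by rewrite setICA setIid.
  transitivity (P B - P A * P B); first by rewrite -iA.
  by rewrite probability_setC// muleBl ?mul1e// fin_num_adde_defl// fin_num_measure.
- have mFk k : measurable (F k) by have [] := mF k.
  split; first exact: bigcupT_measurable.
  rewrite setI_bigcupl !measure_bigcup//=; last first.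
  + exact: trivIset_setIr.
  + by move=> k _; exact: measurableI.
  rewrite [RHS]muleC -(fineK fB) -nneseriesZl//.
  by apply: eq_eseriesr => k _; have [_ ->] := mF k; rewrite fineK// muleC.
Qed.

Context {I : choiceType} (X : I -> {RV P >-> R}).

Definition fcyl (J : set I) : set (set T) :=
  [set A | exists (S : {fset I}) (B : I -> set R),
    [/\ [set` S] `<=` J, forall i, measurable (B i) &
        A = \bigcap_(i in [set` S]) (X i @^-1` B i)]].

Lemma fcyl_measurable J : fcyl J `<=` measurable.
Proof.
move=> _ [S [B [_ mB ->]]]; apply: fin_bigcap_measurable.
  exact: finite_fset.
by move=> i _; rewrite -[X in measurable X]setTI; exact: measurable_funP.
Qed.

Lemma fcylI J : setI_closed (fcyl J).
Proof.
move=> _ _ [S [B [SJ mB ->]]] [S' [B' [SJ' mB' ->]]].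
exists (S `|` S')%fset.
exists (fun i => (if i \in S then B i else setT) `&` (if i \in S' then B' i else setT)).
split.
- move=> i /=; rewrite inE => /orP[/SJ|/SJ']//.
- by move=> i; apply: measurableI; case: ifP.
- apply/seteqP; split => [w [h h'] i /=|w h].
    rewrite inE => _; split; case: ifP => // iS; [exact: h|exact: h'].
  split=> i /= iS; have := h i; rewrite /= inE iS ?orbT => /(_ isT) [];
  by rewrite ?iS.
Qed.

Hypothesis Xind : mutually_independent X.

Lemma fcyl_indep J J' A B : J `&` J' = set0 -> fcyl J A -> fcyl J' B ->
  P (A `&` B) = P A * P B.
Proof.
move=> JJ [S [C [SJ mC ->]]] [S' [C' [SJ' mC' ->]]].
pose D i := if i \in S then C i else C' i.
have dS i : i \in S' -> i \in S = false.
  move=> iS'; apply/negP => iS; suff : (J `&` J') i by rewrite JJ.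
  by split; [exact: SJ|exact: SJ'].
have mD i : measurable (D i) by rewrite /D; case: ifP.
have EC : \bigcap_(i in [set` S]) (X i @^-1` C i) = \bigcap_(i in [set` S]) (X i @^-1` D i).
  by apply: eq_bigcapr => i /= iS; rewrite /D iS.
have EC' : \bigcap_(i in [set` S']) (X i @^-1` C' i) = \bigcap_(i in [set` S']) (X i @^-1` D i).
  by apply: eq_bigcapr => i /= iS; rewrite /D dS.
rewrite EC EC' -bigcap_setU.
have -> : [set` S] `|` [set` S'] = [set` (S `|` S')%fset].
  by apply/seteqP; split=> i /=; rewrite inE => /orP.
rewrite !Xind//.
have fdS : [disjoint S & S']%fset.
  by apply/fdisjointP => i iS; apply/negP => /dS; rewrite iS.
rewrite -big_cat/=; apply: perm_big.
apply: uniq_perm; first exact: fset_uniq.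
  rewrite cat_uniq !fset_uniq/= andbT; apply/hasPn => i /dS ->//.
by move=> i; rewrite mem_cat inE.
Qed.

Definition meas_on d' (T' : measurableType d') (J : set I) (f : T -> T') : Prop :=
  @measurable_fun _ _ (g_sigma_algebraType (fcyl J)) T' setT f.

Definition event_on (J : set I) (A : set T) : Prop := <<s fcyl J >> A.

Lemma event_on_measurable J A : event_on J A -> measurable A.
Proof.
move=> JA; have : <<s @measurable _ T >> A by apply: sub_smallest2r JA; [exact: smallest_sigma_algebra|exact: fcyl_measurable].
by rewrite sigma_algebra_id//; exact: sigma_algebra_measurable.
Qed.

Lemma event_on_indep J J' A B : J `&` J' = set0 -> event_on J A -> event_on J' B ->
  P (A `&` B) = P A * P B.
Proof.
move=> JJ JA JB; have mA := event_on_measurable JA.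
rewrite setIC muleC; move: B JB; apply: pi_lambda_indep => //.
- exact: fcyl_measurable.
- exact: fcylI.
move=> B JB; rewrite setIC muleC; move: A JA {mA}; apply: pi_lambda_indep => //.
- exact: fcyl_measurable.
- exact: fcylI.
- exact: fcyl_measurable JB.
- by move=> A JA; exact: fcyl_indep JJ JA JB.
Qed.

Lemma meas_on_event d' (T' : measurableType d') J (f : T -> T') B :
  meas_on J f -> measurable B -> event_on J (f @^-1` B).
Proof. by move=> mf mB; have := mf measurableT B mB; rewrite setTI. Qed.

Lemma meas_onW d' (T' : measurableType d') J (f : T -> T') :
  meas_on J f -> measurable_fun setT f.
Proof.
by move=> mf _ B mB; rewrite setTI; exact: event_on_measurable (meas_on_event mf mB).
Qed.

Lemma meas_onX (J : set I) i : J i -> meas_on J (X i).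
Proof.
move=> Ji _ B mB; rewrite setTI; apply: sub_gen_smallest.
exists [fset i]%fset, (fun=> B); split => //.
- by move=> j /=; rewrite inE => /eqP ->.
- apply/seteqP; split => [w /= h j /=|w /(_ i)]; first by rewrite inE => /eqP ->.
  by rewrite /= inE eqxx => /(_ isT).
Qed.

Lemma event_onS J J' A : J `<=` J' -> event_on J A -> event_on J' A.
Proof.
move=> JJ'; apply: sub_smallest2r; first exact: smallest_sigma_algebra.
by move=> _ [S [B [SJ mB ->]]]; exists S, B; split => //; exact: subset_trans JJ'.
Qed.

Lemma meas_onS d' (T' : measurableType d') J J' (f : T -> T') : J `<=` J' ->
  meas_on J f -> meas_on J' f.
Proof.
by move=> JJ' mf _ B mB; apply: event_onS JJ' _; exact: mf.
Qed.

Section fubini_indep.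
Context {d1 d2} {T1 : measurableType d1} {T2 : measurableType d2}.
Variables (U : T -> T1) (V : T -> T2) (J J' : set I).
Hypotheses (JJ' : J `&` J' = set0) (mU : meas_on J U) (mV : meas_on J' V).

Lemma fubini_indep (h : T1 * T2 -> \bar R) : measurable_fun setT h ->
  (forall z, 0 <= h z) ->
  \int[P]_w h (U w, V w) = \int[P]_w \int[P]_w' h (U w, V w').
Proof.
move=> mh h0.
have mU' := meas_onW mU; have mV' := meas_onW mV.
pose U' : {RV P >-> T1} := HB.pack U (isMeasurableFun.Build _ _ _ _ U mU').
pose V' : {RV P >-> T2} := HB.pack V (isMeasurableFun.Build _ _ _ _ V mV').
have mUV : measurable_fun setT (fun w => (U w, V w)) by exact: measurable_fun_pair.
pose W' : {RV P >-> (T1 * T2)%type} := HB.pack (fun w => (U w, V w)) (isMeasurableFun.Build _ _ _ _ _ mUV).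
transitivity (\int[distribution P W']_z h z).
  by rewrite ge0_integral_distribution.
transitivity (\int[(distribution P U' \x distribution P V')]_z h z).
  apply: eq_measure_integral => A mA _; apply/esym.
  apply: product_measure_unique => // A1 A2 mA1 mA2.
  change (P (U @^-1` A1 `&` V @^-1` A2) = P (U @^-1` A1) * P (V @^-1` A2)).
  apply: (event_on_indep JJ').
    exact: meas_on_event mU mA1.
  exact: meas_on_event mV mA2.
rewrite fubini_tonelli1// /fubini_F ge0_integral_distribution//; last first.
- by move=> x; exact: integral_ge0.
- exact: measurable_fun_fubini_tonelli_F.
apply: eq_integral => w _ /=.
rewrite ge0_integral_distribution//.
exact: (@measurableT_comp _ _ _ _ _ _ h).
Qed.

End fubini_indep.

End independence.

Section expectation.
Context {d : measure_display} {T : measurableType d} {R : realType}.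
Context (P : probability T R).
Implicit Types f g : T -> R.

Definition bmeas f : Prop :=
  measurable_fun setT f /\ exists M, forall w, `|f w| <= M.

Local Notation Ex f := (\int[P]_w (f w)).

Lemma bmeas_integrable f : bmeas f -> P.-integrable setT (EFin \o f).
Proof.
move=> [mf [M fM]]; apply: measurable_bounded_integrable => //.
- by rewrite (le_lt_trans (probability_le1 P _))// ltry.
- exists M; split; first exact: num_real.
  by move=> x Mx w _ /=; apply: (le_trans (fM w)); exact: ltW.
Qed.

Lemma bmeas_cst (c : R) : bmeas (fun=> c).
Proof. by split => //; exists `|c|. Qed.

Lemma bmeasD f g : bmeas f -> bmeas g -> bmeas (fun w => f w + g w).
Proof.
move=> [mf [M fM]] [mg [N gN]]; split; first exact: measurable_funD.
by exists (M + N) => w; rewrite (le_trans (ler_normD _ _))// lerD.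
Qed.

Lemma bmeasN f : bmeas f -> bmeas (fun w => - f w).
Proof.
move=> [mf [M fM]]; split; first exact: measurableT_comp.
by exists M => w; rewrite normrN.
Qed.

Lemma bmeasB f g : bmeas f -> bmeas g -> bmeas (fun w => f w - g w).
Proof. by move=> ? ?; apply: bmeasD => //; exact: bmeasN. Qed.

Lemma bmeasM f g : bmeas f -> bmeas g -> bmeas (fun w => f w * g w).
Proof.
move=> [mf [M fM]] [mg [N gN]]; split; first exact: measurable_funM.
by exists (M * N) => w; rewrite normrM ler_pM.
Qed.

Lemma bmeas_abs f : bmeas f -> bmeas (fun w => `|f w|).
Proof.
move=> [mf [M fM]]; split; first exact: measurableT_comp.
by exists M => w; rewrite normr_id.
Qed.

Lemma bmeas_indic (A : set T) : measurable A -> bmeas \1_A.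
Proof.
move=> mA; split; first exact: measurable_indic.
by exists 1 => w; rewrite indicE; case: (_ \in _); rewrite ?normr1 ?normr0.
Qed.

Lemma Ex_cst (c : R) : Ex (fun=> c) = c.
Proof. by rewrite Rintegral_cst//= probability_setT mulr1. Qed.

Lemma ExD f g : bmeas f -> bmeas g -> Ex (fun w => f w + g w) = Ex f + Ex g.
Proof. by move=> /bmeas_integrable ? /bmeas_integrable ?; exact: RintegralD. Qed.

Lemma ExB f g : bmeas f -> bmeas g -> Ex (fun w => f w - g w) = Ex f - Ex g.
Proof. by move=> /bmeas_integrable ? /bmeas_integrable ?; exact: RintegralB. Qed.

Lemma ExZ (c : R) f : bmeas f -> Ex (fun w => c * f w) = c * Ex f.
Proof. by move=> /bmeas_integrable ?; exact: RintegralZl. Qed.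

Lemma Ex_le f g : bmeas f -> bmeas g -> (forall w, f w <= g w) -> Ex f <= Ex g.
Proof. by move=> /bmeas_integrable ? /bmeas_integrable ? fg; exact: le_Rintegral. Qed.

Lemma Ex_ge0 f : (forall w, 0 <= f w) -> 0 <= Ex f.
Proof. by move=> f0; exact: Rintegral_ge0. Qed.

Lemma Ex_abs f : bmeas f -> `|Ex f| <= Ex (fun w => `|f w|).
Proof. by move=> /bmeas_integrable ?; exact: le_normr_Rintegral. Qed.

Lemma Ex_indic (A : set T) : measurable A -> Ex \1_A = fine (P A).
Proof. by move=> mA; rewrite /Rintegral integral_indic// setIT. Qed.

Lemma EFin_Ex f : bmeas f -> (Ex f)%:E = (\int[P]_w (f w)%:E)%E.
Proof. by move=> /bmeas_integrable h; rewrite fineK// integrable_fin_num. Qed.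

Context {I : choiceType} (X : I -> {RV P >-> R}).
Hypothesis Xind : mutually_independent X.

Lemma Ex_fubini {d1 d2} {T1 : measurableType d1} {T2 : measurableType d2}
    (U : T -> T1) (V : T -> T2) (J J' : set I) (h : T1 * T2 -> R) (M : R) :
  J `&` J' = set0 -> meas_on X J U -> meas_on X J' V ->
  measurable_fun setT h -> (forall z, 0 <= h z <= M) ->
  Ex (fun w => h (U w, V w)) = Ex (fun w => Ex (fun w' => h (U w, V w'))) /\
  measurable_fun setT (fun z => Ex (fun w' => h (z, V w'))).
Proof.
move=> JJ mU mV mh h0M.
have h0 z : 0 <= h z by have /andP[] := h0M z.
have mU' := meas_onW mU; have mV' := meas_onW mV.
have b z : bmeas (fun w' => h (z, V w')).
  split; last by exists M => w; rewrite ger0_norm//; have /andP[] := h0M (z, V w).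
  apply: (@measurableT_comp _ _ _ _ _ _ h) => //.
  exact: measurable_fun_pair.
split.
  rewrite /Rintegral; congr fine.
  rewrite (fubini_indep Xind JJ mU mV (h := EFin \o h))//=.
  - by apply: eq_integral => w _; rewrite -(EFin_Ex (b (U w))).
  - exact/measurable_EFinP.
pose V' : {RV P >-> T2} := HB.pack V (isMeasurableFun.Build _ _ _ _ V mV').
have : measurable_fun setT (fubini_F (distribution P V') (EFin \o h)).
  apply: measurable_fun_fubini_tonelli_F => //.
    exact/measurable_EFinP.
move=> mF; apply/measurable_EFinP; apply: eq_measurable_fun mF => z _ /=.
rewrite /fubini_F ge0_integral_distribution//=.
- by rewrite EFin_Ex.
- apply/measurable_EFinP; apply: (@measurableT_comp _ _ _ _ _ _ h) => //.
- by move=> y /=; rewrite lee_fin.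
Qed.

Lemma Ex_mul f g (J J' : set I) : J `&` J' = set0 ->
  meas_on X J f -> meas_on X J' g -> bmeas f -> bmeas g ->
  Ex (fun w => f w * g w) = Ex f * Ex g.
Proof.
move=> JJ.
have nneg f' g' : meas_on X J f' -> meas_on X J' g' -> bmeas f' -> bmeas g' ->
    (forall w, 0 <= f' w) -> (forall w, 0 <= g' w) ->
    Ex (fun w => f' w * g' w) = Ex f' * Ex g'.
  move=> mf mg bf bg f0 g0; apply: EFin_inj.
  rewrite EFin_Ex; last exact: bmeasM.
  pose h (z : R * R) := (`|z.1| * `|z.2|)%:E.
  have hE w w' : h (f' w, g' w') = (f' w * g' w')%:E by rewrite /h/= !ger0_norm.
  under eq_integral do rewrite -hE.
  rewrite (fubini_indep Xind JJ mf mg (h := h)).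
  - under eq_integral => w _ do (under eq_integral => w' _ do rewrite hE EFinM).
    under eq_integral => w _ do rewrite integralZl ?bmeas_integrable// -EFin_Ex// -EFinM.
    by rewrite -EFin_Ex ?RintegralZr//; [exact: bmeas_integrable|apply: bmeasM => //; exact: bmeas_cst].
  - apply/measurable_EFinP; apply: measurable_funM; apply: measurableT_comp => //.
  - by move=> z; rewrite lee_fin mulr_ge0.
move=> mf mg bf bg; have [_ [M fM]] := bf; have [_ [N gN]] := bg.
have cM := bmeas_cst M; have cN := bmeas_cst N.
have bfM := bmeasD bf cM; have bgN := bmeasD bg cN.
have := nneg (fun w => f w + M) (fun w => g w + N).
rewrite (ExD bf cM) (ExD bg cN) !Ex_cst => /(_ _ _ bfM bgN).
have -> : (fun w => (f w + M) * (g w + N)) = (fun w => f w * g w + (N * f w + (M * g w + M * N))).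
  by apply/funext => w; ring.
rewrite !ExD ?ExZ ?Ex_cst//; try by repeat (apply: bmeasD || apply: bmeasM || apply: bmeas_cst || assumption).
move=> h; suff : Ex (fun w => f w * g w) + (N * Ex f + (M * Ex g + M * N)) = (Ex f + M) * (Ex g + N).
  by move=> e; apply: (addIr (N * Ex f + (M * Ex g + M * N))); rewrite e; ring.
apply: h.
- exact: measurable_funD.
- exact: measurable_funD.
- by move=> w; rewrite -lerBlDr sub0r; have := fM w; rewrite ler_norml => /andP[].
- by move=> w; rewrite -lerBlDr sub0r; have := gN w; rewrite ler_norml => /andP[].
Qed.

End expectation.

Section logistic.
Context {R : realType}.
Implicit Types (u v s : R) (g : R -> R).

Definition logistic u : R := (1 + expR (- u))^-1.

Lemma logistic_den_gt0 u : 0 < 1 + expR (- u).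
Proof. by rewrite addr_gt0 ?expR_gt0. Qed.

Lemma logistic_gt0 u : 0 < logistic u.
Proof. by rewrite invr_gt0 logistic_den_gt0. Qed.

Lemma logistic_le1 u : logistic u <= 1.
Proof. by rewrite invf_le1 ?logistic_den_gt0// lerDl expR_ge0. Qed.

Lemma continuous_logistic : continuous logistic.
Proof.
move=> u; apply: cvgV; first by rewrite gt_eqF// logistic_den_gt0.
apply: cvgD; first exact: cvg_cst.
by apply: continuous_comp; [exact: opp_continuous|exact: continuous_expR].
Qed.

Lemma measurable_logistic : measurable_fun setT logistic.
Proof. by apply: continuous_measurable_fun; exact: continuous_logistic. Qed.

Lemma logistic_le_exp u : logistic u <= expR u.
Proof.
rewrite /logistic -[leRHS]invrK -expRN lef_pV2 ?posrE ?expR_gt0 ?logistic_den_gt0//.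
by rewrite lerDr.
Qed.

Lemma logisticD u v : logistic (u + v) =
  logistic u * expR v / (1 + logistic u * (expR v - 1)).
Proof.
rewrite /logistic opprD expRD (expRN v).
have := expR_gt0 v; have := expR_gt0 (- u).
set E := expR v; set F := expR (- u) => F0 E0.
by field; apply/and3P; split; apply: lt0r_neq0; nra.
Qed.

Definition rem3 v : R := `|expR v - 1| ^+ 3 * expR (2 * `|v|).

Lemma rem3_ge0 v : 0 <= rem3 v.
Proof. by rewrite mulr_ge0 ?exprn_ge0 ?expR_ge0. Qed.

Lemma measurable_rem3 : measurable_fun setT rem3.
Proof.
apply: measurable_funM.
  apply: measurable_funX; apply: measurableT_comp => //.
  by apply: measurable_funB => //; exact: measurable_expR.
apply: measurableT_comp; first exact: measurable_expR.
by apply: measurable_funM.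
Qed.

(* Taylor expansion of order two, with the exponentials e^v - 1 and e^-v - 1
   in place of v and v^2, and an error relative to g u. *)
Definition taylor2 g u (a b : R) : Prop :=
  [/\ `|a| <= g u, `|b| <= g u &
   forall v, `|g (u + v) - g u - a * (expR v - 1) - b * (expR (- v) - 1)|
     <= g u * rem3 v].

Lemma logistic_taylor2 u : let s := logistic u in
  taylor2 logistic u (s * (1 - s) ^+ 2) (- (s ^+ 2 * (1 - s))).
Proof.
move=> s; have s0 : 0 < s by exact: logistic_gt0.
have s1 : s <= 1 by exact: logistic_le1.
split.
- rewrite ger0_norm -/s; last by rewrite mulr_ge0 ?sqr_ge0 ?ltW.
  by rewrite ler_piMr ?(ltW s0)// exprn_ile1 ?subr_ge0// gerBl ltW.
- rewrite normrN ger0_norm; last by rewrite mulr_ge0 ?subr_ge0 ?sqr_ge0.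
  by rewrite -/s expr2; nra.
move=> v; rewrite logisticD -/s /rem3.
have E0 := expR_gt0 v.
have EN : 1 <= expR `|v| * expR v.
  by rewrite -expRD -expR0 ler_expR -lerBlDr sub0r ler_normr lexx orbT.
have N1 : 1 <= expR `|v| by rewrite -expR0 ler_expR.
rewrite expRN (mulrC 2) expRM_natr.
set E := expR v in E0 EN *; set N := expR `|v| in EN N1 *.
have D0 : 0 < 1 + s * (E - 1) by nra.
have ND : 1 <= N * (1 + s * (E - 1)).
  have -> : N * (1 + s * (E - 1)) = (1 - s) * N + s * (N * E) by ring.
  by nra.
rewrite [X in `|X|](_ : _ = - (s ^+ 2 * (1 - s) ^+ 2 * (E - 1) ^+ 3) / (E * (1 + s * (E - 1)))); last first.
  by field; apply/andP; split; exact: lt0r_neq0.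
rewrite normrM normrN normfV (ger0_norm (ltW (mulr_gt0 E0 D0))).
rewrite (normrM (_ * _)) normrX (@ger0_norm _ (_ * _)); last by rewrite mulr_ge0 ?sqr_ge0.
rewrite ler_pdivrMr ?mulr_gt0//.
set Q := `|E - 1| ^+ 3; have Q0 : 0 <= Q by exact: exprn_ge0.
have H1 : s ^+ 2 * (1 - s) ^+ 2 <= s.
  have : (1 - s) ^+ 2 <= 1 by rewrite exprn_ile1// ?subr_ge0// gerBl ltW.
  have : 0 <= (1 - s) ^+ 2 by exact: sqr_ge0.
  by set y := (1 - s) ^+ 2; nra.
have H2 : 1 <= N ^+ 2 * (E * (1 + s * (E - 1))).
  have -> : N ^+ 2 * (E * (1 + s * (E - 1))) = (N * E) * (N * (1 + s * (E - 1))) by ring.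
  by rewrite -[leLHS]mulr1 ler_pM.
rewrite (_ : s * (Q * N ^+ 2) * (E * (1 + s * (E - 1))) =
  (s * Q) * (N ^+ 2 * (E * (1 + s * (E - 1))))); last by ring.
apply: (@le_trans _ _ (s * Q)); first by rewrite ler_wpM2r.
by rewrite -[leLHS]mulr1 ler_wpM2l// mulr_ge0// ltW.
Qed.

End logistic.

Section one_step.
Context {d : measure_display} {T : measurableType d} {R : realType}.
Context (Q : {measure set T -> \bar R}).
Variables (w v : T -> R).
Hypotheses (w0 : forall t, 0 <= w t) (mv : measurable_fun setT v).
Hypothesis iw : Q.-integrable setT (EFin \o w).
Hypothesis ie : Q.-integrable setT (EFin \o (fun t => w t * expR (v t))).
Hypothesis ieN : Q.-integrable setT (EFin \o (fun t => w t * expR (- v t))).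
Hypothesis ir : Q.-integrable setT (EFin \o (fun t => w t * rem3 (v t))).

Lemma integrable_weighted (g : R -> R) u : measurable_fun setT g ->
  (forall x, 0 <= g x <= 1) ->
  Q.-integrable setT (EFin \o (fun t => w t * g (u + v t))).
Proof.
move=> mg g01; have mw : measurable_fun setT w.
  by apply/measurable_EFinP; exact: measurable_int iw.
apply: (le_integrable _ _ _ iw) => //.
  apply/measurable_EFinP; apply: measurable_funM => //.
  by apply: measurableT_comp => //; exact: measurable_funD.
move=> t _ /=; have /andP[g0 g1] := g01 (u + v t).
by rewrite lee_fin !ger0_norm ?mulr_ge0// ler_piMr.
Qed.

Lemma one_step (g : R -> R) u a b : measurable_fun setT g ->
  (forall x, 0 <= g x <= 1) -> taylor2 g u a b ->
  `|\int[Q]_t (w t * g (u + v t)) - (g u * \int[Q]_t w t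
     + a * (\int[Q]_t (w t * expR (v t)) - \int[Q]_t w t)
     + b * (\int[Q]_t (w t * expR (- v t)) - \int[Q]_t w t))|
  <= g u * \int[Q]_t (w t * rem3 (v t)).
Proof.
move=> mg g01 [ag bg gv].
have ig := @integrable_weighted g u mg g01.
have iZ c f : Q.-integrable setT (EFin \o f) -> Q.-integrable setT (EFin \o (fun t => c * f t)).
  by move=> h; exact: (integrableZl measurableT c h).
have iB f f' : Q.-integrable setT (EFin \o f) -> Q.-integrable setT (EFin \o f') ->
    Q.-integrable setT (EFin \o (fun t => f t - f' t)).
  by move=> h h'; exact: (integrableB measurableT h h').
rewrite [X in `|X|](_ : _ = \int[Q]_t (w t * g (u + v t) - (g u - a - b) * w t - a * (w t * expR (v t)) - b * (w t * expR (- v t)))); last first.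
  rewrite !RintegralB//; try by repeat (assumption || apply: (iB (fun t => _) (fun t => _)) || apply: (iZ _ (fun t => _))).
  rewrite !RintegralZl//; ring.
pose F t := w t * g (u + v t) - (g u - a - b) * w t - a * (w t * expR (v t)) - b * (w t * expR (- v t)).
have iF : Q.-integrable setT (EFin \o F) by repeat (assumption || apply: (iB (fun t => _) (fun t => _)) || apply: (iZ _ (fun t => _))).
apply: (le_trans (le_normr_Rintegral measurableT iF)).
rewrite -RintegralZl//; apply: le_Rintegral => //.
- exact: (integrable_norm iF).
- exact: iZ.
move=> t _; rewrite mulrCA /F.
rewrite [X in `|X|](_ : _ = w t * (g (u + v t) - g u - a * (expR (v t) - 1) - b * (expR (- v t) - 1))); last by ring.
by rewrite normrM (ger0_norm (w0 t)) ler_wpM2l.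
Qed.

End one_step.

Section gauss.
Context {R : realType}.
Implicit Types (u v t y z : R).
Local Notation mu := (@lebesgue_measure R).

Definition phi : R -> R := normal_pdf 0 1.

Lemma normal_pdf_gt0E (m s x : R) : 0 < s -> normal_pdf m s x =
  s^-1 * ((Num.sqrt (2 * pi))^-1 * expR (- ((x - m) / s) ^+ 2 / 2)).
Proof.
move=> s0; rewrite normal_pdfE ?gt_eqF// /normal_peak /normal_fun.
rewrite mulrA -invfM; congr (_^-1 * expR _).
  by rewrite -mulr_natl mulrCA sqrtrM ?sqr_ge0// sqrtr_sqr gtr0_norm.
by rewrite -mulr_natl; field; rewrite gt_eqF.
Qed.

Lemma phiE y : phi y = (Num.sqrt (2 * pi))^-1 * expR (- y ^+ 2 / 2).
Proof. by rewrite /phi normal_pdf_gt0E// subr0 divr1 invr1 mul1r. Qed.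

Lemma phi_ge0 y : 0 <= phi y. Proof. exact: normal_pdf_ge0. Qed.

Lemma continuous_phi : continuous phi.
Proof. by apply: continuous_normal_pdf; rewrite oner_neq0. Qed.

Lemma measurable_phi : measurable_fun setT phi.
Proof. exact: measurable_normal_pdf. Qed.

Lemma integrable_phi : mu.-integrable setT (EFin \o phi).
Proof. exact: integrable_normal_pdf. Qed.

Lemma Rintegral_phi : \int[mu]_y phi y = 1.
Proof. by rewrite /Rintegral integral_normal_pdf. Qed.

Lemma phi_expR s y : phi y * expR (s * y) = expR (s ^+ 2 / 2) * normal_pdf s 1 y.
Proof.
rewrite phiE normal_pdf_gt0E// invr1 mul1r mulr1 [RHS]mulrCA -mulrA -!expRD.
by congr (_ * expR _); field.
Qed.

Lemma integrable_phi_expR s : mu.-integrable setT (EFin \o (fun y => phi y * expR (s * y))).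
Proof.
rewrite (_ : _ \o _ = fun y => ((expR (s ^+ 2 / 2))%:E * (normal_pdf s 1 y)%:E)%E); last first.
  by apply/funext => y; rewrite /= phi_expR EFinM.
by apply: integrableZl => //; exact: integrable_normal_pdf.
Qed.

Lemma Rintegral_phi_expR s : \int[mu]_y (phi y * expR (s * y)) = expR (s ^+ 2 / 2).
Proof.
under eq_Rintegral do rewrite phi_expR.
rewrite RintegralZl//; last exact: integrable_normal_pdf.
by rewrite /Rintegral integral_normal_pdf mulr1.
Qed.

Lemma integrable_phiM (f : R -> R) M : measurable_fun setT f ->
  (forall y, `|f y| <= M) -> mu.-integrable setT (EFin \o (fun y => phi y * f y)).
Proof.
move=> mf fM.
apply: (le_integrable _ _ _ (integrableZl measurableT M integrable_phi)) => //.
  by apply/measurable_EFinP; apply: measurable_funM => //; exact: measurable_phi.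
move=> y _ /=; rewrite lee_fin normrM mulrC normrM.
by rewrite (ger0_norm (phi_ge0 y)) ler_wpM2r ?phi_ge0// (le_trans (fM y))// ler_norm.
Qed.

Definition gsmooth t u : R := \int[mu]_y (phi y * logistic (u + t * y)).

Lemma measurable_logistic_affine u t : measurable_fun setT (fun y : R => logistic (u + t * y)).
Proof.
apply: measurableT_comp; first exact: measurable_logistic.
by apply: measurable_funD => //; exact: measurable_funM.
Qed.

Lemma logistic_norm u : `|logistic u| <= 1.
Proof. by rewrite ger0_norm ?logistic_le1// ltW// logistic_gt0. Qed.

Lemma integrable_gsmooth t u :
  mu.-integrable setT (EFin \o (fun y => phi y * logistic (u + t * y))).
Proof.
apply: (@integrable_phiM _ 1); first exact: measurable_logistic_affine.
by move=> y; exact: logistic_norm.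
Qed.

Lemma gsmooth_ge0 t u : 0 <= gsmooth t u.
Proof. by apply: Rintegral_ge0 => y _; rewrite mulr_ge0 ?phi_ge0// ltW// logistic_gt0. Qed.

Lemma gsmooth_le1 t u : gsmooth t u <= 1.
Proof.
rewrite -Rintegral_phi; apply: le_Rintegral => //.
- exact: integrable_gsmooth.
- exact: integrable_phi.
- by move=> y _; rewrite ler_piMr ?phi_ge0// logistic_le1.
Qed.

Lemma gsmooth0 u : gsmooth 0 u = logistic u.
Proof.
rewrite /gsmooth; under eq_Rintegral do rewrite mul0r addr0.
by rewrite RintegralZr ?Rintegral_phi ?mul1r//; exact: integrable_phi.
Qed.

Lemma EFin_gsmooth t u :
  (gsmooth t u)%:E = (\int[mu]_y (phi y * logistic (u + t * y))%:E)%E.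
Proof. by rewrite fineK// integrable_fin_num//; exact: integrable_gsmooth. Qed.

Lemma measurable_gsmooth t : measurable_fun setT (gsmooth t).
Proof.
have := @measurable_fun_fubini_tonelli_F _ _ _ _ R mu
  (fun z : R * R => (phi z.2 * logistic (z.1 + t * z.2))%:E).
move=> H; apply/measurable_EFinP.
apply: (eq_measurable_fun _ _ (H _ _)) => [u _| |z].
- by rewrite /= EFin_gsmooth.
- apply/measurable_EFinP; apply: measurable_funM.
    by apply: measurableT_comp => //; exact: measurable_phi.
  apply: measurableT_comp; first exact: measurable_logistic.
  by apply: measurable_funD => //; exact: measurable_funM.
- by rewrite lee_fin mulr_ge0 ?phi_ge0// ltW// logistic_gt0.
Qed.

Lemma gsmooth_taylor2 t u : exists a b, taylor2 (gsmooth t) u a b.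
Proof.
pose s y := logistic (u + t * y).
have ms : measurable_fun setT s by exact: measurable_logistic_affine.
have s01 y : 0 <= s y <= 1 by rewrite logistic_le1 ltW ?logistic_gt0.
pose al y := s y * (1 - s y) ^+ 2; pose be y := - (s y ^+ 2 * (1 - s y)).
have mal : measurable_fun setT al.
  by apply: measurable_funM => //; apply: measurable_funX; exact: measurable_funB.
have mbe : measurable_fun setT be.
  apply: measurableT_comp => //; apply: measurable_funM => //; first exact: measurable_funX.
  exact: measurable_funB.
have als y : `|al y| <= s y by have [] := logistic_taylor2 (u + t * y).
have bes y : `|be y| <= s y by have [] := logistic_taylor2 (u + t * y).
have s1 y : s y <= 1 by have /andP[] := s01 y.
have ial := integrable_phiM mal (fun y => le_trans (als y) (s1 y)).
have ibe := integrable_phiM mbe (fun y => le_trans (bes y) (s1 y)).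
have is_ := integrable_gsmooth t u.
have norm_le (f : R -> R) : measurable_fun setT f -> (forall y, `|f y| <= s y) ->
    `|\int[mu]_y (phi y * f y)| <= gsmooth t u.
  move=> mf fs.
  have jf := integrable_phiM mf (fun y => le_trans (fs y) (s1 y)).
  apply: (le_trans (le_normr_Rintegral measurableT jf)).
  apply: le_Rintegral => //; first exact: (integrable_norm jf).
  by move=> y _; rewrite normrM (ger0_norm (phi_ge0 y)) ler_wpM2l ?phi_ge0.
exists (\int[mu]_y (phi y * al y)), (\int[mu]_y (phi y * be y)).
split; [exact: norm_le|exact: norm_le|move=> v].
have iZ c (f : R -> R) : mu.-integrable setT (EFin \o f) -> mu.-integrable setT (EFin \o (fun t => f t * c)).
  by move=> h; exact: (integrableZr measurableT c h).
have iB (f f' : R -> R) : mu.-integrable setT (EFin \o f) -> mu.-integrable setT (EFin \o f') ->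
    mu.-integrable setT (EFin \o (fun t => f t - f' t)).
  by move=> h h'; exact: (integrableB measurableT h h').
have iv := integrable_gsmooth t (u + v).
pose F y := phi y * logistic (u + v + t * y) - phi y * s y
  - (phi y * al y) * (expR v - 1) - (phi y * be y) * (expR (- v) - 1).
have iF1 := iB _ _ iv is_.
have iF2 := iB _ _ iF1 (iZ (expR v - 1) _ ial).
have iF := iB _ _ iF2 (iZ (expR (- v) - 1) _ ibe).
rewrite [X in `|X|](_ : _ = \int[mu]_y F y); last first.
  rewrite /F (RintegralB _ iF2)//; last exact: iZ.
  rewrite (RintegralB _ iF1)//; last exact: iZ.
  by rewrite (RintegralB _ iv)// (RintegralZr _ _ ial)// (RintegralZr _ _ ibe).
apply: (le_trans (le_normr_Rintegral measurableT iF)).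
rewrite /gsmooth -(RintegralZr _ _ is_)//; apply: le_Rintegral => //.
- exact: (integrable_norm iF).
- exact: iZ.
move=> y _.
rewrite [X in `|X|](_ : _ = phi y * (logistic (u + t * y + v) - logistic (u + t * y)
   - al y * (expR v - 1) - be y * (expR (- v) - 1))); last first.
  by rewrite /F /s (addrAC u v); ring.
rewrite normrM (ger0_norm (phi_ge0 y)) -mulrA ler_wpM2l ?phi_ge0//.
by have [_ _] := logistic_taylor2 (u + t * y); exact.
Qed.

Lemma normal_pdf_rotation (t th r z w : R) : 0 < t -> 0 < r -> r ^+ 2 = t ^+ 2 + th ^+ 2 ->
  phi z * (phi ((r * w - th * z) / t) * (r / t)) = phi w * normal_pdf (th * w / r) (t / r) z.
Proof.
move=> t0 r0 rE.
rewrite !phiE normal_pdf_gt0E ?divr_gt0// invf_div.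
set c := (Num.sqrt (2 * pi))^-1.
rewrite [LHS](_ : _ = c * c * (r / t) * (expR (- z ^+ 2 / 2) * expR (- ((r * w - th * z) / t) ^+ 2 / 2))); last by ring.
rewrite [RHS](_ : _ = c * c * (r / t) * (expR (- w ^+ 2 / 2) * expR (- ((z - th * w / r) * (r / t)) ^+ 2 / 2))); last by ring.
congr (_ * _); rewrite -!expRD; congr expR.
have tE : t != 0 by rewrite gt_eqF. have rE0 : r != 0 by rewrite gt_eqF.
have -> : (z - th * w / r) * (r / t) = (r * z - th * w) / t by field; rewrite tE rE0.
suff : z ^+ 2 + ((r * w - th * z) / t) ^+ 2 = w ^+ 2 + ((r * z - th * w) / t) ^+ 2.
  by move=> h; rewrite -!mulrDl -!opprD h.
rewrite !expr_div_n; apply: (mulIf (expf_neq0 2 tE)); rewrite !mulrDl !divfK ?expf_neq0//.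
by have -> : t ^+ 2 = r ^+ 2 - th ^+ 2 by [rewrite rE addrK]; ring.
Qed.

(* Rotating the pair (y, z) of independent normal variables, done as the
   substitution t y + th z = r w in y followed by completing the square in z. *)
Lemma gsmooth_semigroup (t th r u : R) : 0 < t -> 0 < r -> r ^+ 2 = t ^+ 2 + th ^+ 2 ->
  \int[mu]_z (phi z * gsmooth t (u + th * z)) = gsmooth r u.
Proof.
move=> t0 r0 rE; rewrite /Rintegral; congr fine.
pose H (zw : R * R) : \bar R := (phi zw.1 * (phi ((r * zw.2 - th * zw.1) / t) * (r / t)) * logistic (u + r * zw.2))%:E.
have mH : measurable_fun setT H.
  apply/measurable_EFinP; apply: measurable_funM; last first.
    apply: measurableT_comp; first exact: measurable_logistic.
    by apply: measurable_funD => //; exact: measurable_funM.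
  apply: measurable_funM; first by apply: measurableT_comp => //; exact: measurable_phi.
  apply: measurable_funM => //; apply: measurableT_comp; first exact: measurable_phi.
  by apply: measurable_funM => //; apply: measurable_funB; exact: measurable_funM.
have H0 x : (0 <= H x)%E.
  rewrite lee_fin mulr_ge0 ?(ltW (logistic_gt0 _))// mulr_ge0 ?phi_ge0//.
  by rewrite mulr_ge0 ?phi_ge0// divr_ge0 ?ltW.
transitivity (\int[mu]_z (\int[mu]_w H (z, w)))%E.
  apply: eq_integral => z _.
  have c0 : 0 < t / r by exact: divr_gt0.
  pose F (w : R^o) : R^o := (w - th * z / r) / (t / r).
  have FE w : F w = (r * w - th * z) / t by rewrite /F; field; rewrite !gt_eqF.
  have dF w : is_derive (w : R^o) (1 : R^o) F (t / r)^-1.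
    have h : is_derive (w : R^o) (1 : R^o) ((t / r)^-1 \*: ((@id R^o) - cst (th * z / r)) : R^o -> R^o) ((t / r)^-1 *: (1 - 0)).
      by apply: is_deriveZ; apply: is_deriveB.
    rewrite subr0 [_ *: _]mulr1 in h; rewrite (_ : F = (t / r)^-1 \*: ((@id R^o) - cst (th * z / r)))//.
    by apply/funext => w'; rewrite /F mulrC.
  have F'E : F^`()%classic = cst (t / r)^-1.
    by apply/funext => w; rewrite derive1E derive_val.
  rewrite EFinM EFin_gsmooth.
  transitivity ((phi z)%:E * \int[mu]_w ((((fun y => phi y * logistic (u + th * z + t * y)) \o F) * F^`()%classic) w)%:E)%E.
    congr (_ * _)%E; apply: increasing_ge0_integration_by_substitutionT.
    - by move=> x y xy; rewrite /F ltr_pM2r ?invr_gt0// ltrD2r.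
    - by rewrite F'E => ?; exact: cvg_cst.
    - by rewrite F'E; exact: is_cvg_cst.
    - by rewrite F'E; exact: is_cvg_cst.
    - by move=> w; have [] := dF w.
    - by apply/gt0_cvgMlNy; [rewrite invr_gt0|exact: cvg_addrr_Ny].
    - by apply/gt0_cvgMly; [rewrite invr_gt0|exact: cvg_addrr].
    - move=> y; apply: continuousM; first exact: continuous_phi.
      apply: continuous_comp; last exact: continuous_logistic.
      apply: cvgD; first exact: cvg_cst.
      exact: mulrl_continuous.
    - by move=> x; rewrite mulr_ge0 ?phi_ge0// ltW// logistic_gt0.
  rewrite -ge0_integralZl//.
  - apply: eq_integral => w _; rewrite -EFinM F'E !fctE/= FE /H/=; congr EFin.
    rewrite [u + th * z + _](_ : _ = u + r * w); first by rewrite invf_div; ring.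
    by field; rewrite gt_eqF.
  - apply/measurable_EFinP; rewrite F'E; apply: measurable_funM => //.
    have mF : measurable_fun setT F by apply: measurable_funM => //; exact: measurable_funB.
    apply: measurable_funM; first by apply: measurableT_comp mF; exact: measurable_phi.
    apply: measurableT_comp; first exact: measurable_logistic.
    by apply: measurable_funD => //; exact: measurable_funM.
  - move=> w _; rewrite lee_fin F'E !fctE/= mulr_ge0 ?invr_ge0 ?(ltW c0)//.
    by rewrite mulr_ge0 ?phi_ge0// ltW// logistic_gt0.
  - by rewrite lee_fin phi_ge0.
transitivity (\int[mu]_w (\int[mu]_z H (z, w)))%E; first by have := @fubini_tonelli _ _ _ _ R lebesgue_measure lebesgue_measure H mH H0.
apply: eq_integral => w _; under eq_integral => z _ do rewrite /H/= (normal_pdf_rotation z w t0 r0 rE) mulrAC EFinM.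
rewrite ge0_integralZl//=; last 3 first.
- by apply/measurable_EFinP; exact: measurable_normal_pdf.
- by move=> z _; rewrite lee_fin normal_pdf_ge0.
- by rewrite lee_fin mulr_ge0 ?phi_ge0// ltW ?logistic_gt0.
by rewrite integral_normal_pdf mule1.
Qed.

End gauss.

Section remainder.
Context {R : realType}.
Implicit Types (v y : R).

Lemma expR_sub1_le v : `|expR v - 1| <= `|v| * expR `|v|.
Proof.
have [v0|v0] := leP 0 v.
  rewrite !ger0_norm//; last by rewrite subr_ge0 -expR0 ler_expR.
  have := expR_ge1Dx (- v); rewrite expRN.
  have E0 := expR_gt0 v; rewrite -(ler_pM2r E0) mulVf ?gt_eqF// => h; nra.
rewrite ltr0_norm; last by rewrite subr_lt0 expR_lt1.
rewrite (ltr0_norm v0); have := expR_ge1Dx v.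
have : 1 <= expR (- v) by rewrite -expR0 ler_expR oppr_ge0 ltW.
by move=> *; nra.
Qed.

Lemma rem3_le v : rem3 v <= `|v| ^+ 3 * expR (5 * `|v|).
Proof.
rewrite /rem3 (_ : 5 = 3 + 2 :> R); last by ring.
rewrite (mulrDl 3) expRD mulrA ler_wpM2r ?expR_ge0//.
rewrite (mulrC 3) expRM_natr -exprMn lerXn2r ?nnegrE ?mulr_ge0 ?expR_ge0//.
exact: expR_sub1_le.
Qed.

Lemma norm3_le_expR y : `|y| ^+ 3 <= 27 * expR `|y|.
Proof.
have h : `|y| / 3 <= expR (`|y| / 3).
  by rewrite (le_trans _ (expR_ge1Dx _))// lerDr.
have : (`|y| / 3) ^+ 3 <= expR (`|y| / 3) ^+ 3.
  by rewrite lerXn2r ?nnegrE ?expR_ge0// divr_ge0.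
rewrite -expRM_natr divfK ?pnatr_eq0//.
rewrite expr_div_n ler_pdivrMr ?exprn_gt0// mulrC => /le_trans; apply.
by rewrite ler_wpM2r ?expR_ge0// -natrX ler_nat.
Qed.

Lemma expR_norm_leD y : expR `|y| <= expR y + expR (- y).
Proof.
by have [_|_] := ger0P y; rewrite ?lerDl ?lerDr expR_ge0.
Qed.

End remainder.

Section gauss_step.
Context {R : realType}.
Local Notation mu := (@lebesgue_measure R).
Implicit Types (u t th r : R).

Definition gauss_cst : R := 54 * expR 18.

Lemma gauss_cst_ge54 : 54 <= gauss_cst.
Proof. by rewrite ler_peMr// -expR0 ler_expR. Qed.

Lemma gauss_rem3_le th y : `|th| <= 1 ->
  rem3 (th * y) <= 27 * `|th| ^+ 3 * (expR (6 * y) + expR (- 6 * y)).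
Proof.
move=> th1; apply: (le_trans (rem3_le _)).
rewrite normrM exprMn; have : 0 <= `|th| ^+ 3 by exact: exprn_ge0.
set c := `|th| ^+ 3 => c0; set c' := `|y| ^+ 3.
set E := expR (6 * y) + _; rewrite [leLHS](_ : _ = c * (expR (5 * (`|th| * `|y|)) * c')); last by ring.
rewrite [leRHS](_ : _ = c * (27 * E)); last by ring.
rewrite ler_wpM2l//. rewrite /E {E}.
have h : expR (5 * (`|th| * `|y|)) <= expR (5 * `|y|).
  by rewrite ler_expR ler_wpM2l// ler_piMl.
apply: (@le_trans _ _ (expR (5 * `|y|) * (27 * expR `|y|))).
  apply: ler_pM; rewrite ?expR_ge0 ?exprn_ge0//; exact: norm3_le_expR.
rewrite mulrCA -expRD ler_wpM2l//.
rewrite (_ : 5 * `|y| + `|y| = `|6 * y|); first by rewrite mulNr; exact: expR_norm_leD.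
by rewrite normrM ger0_norm//; ring.
Qed.

Lemma measurable_phi_rem3 th : measurable_fun setT (fun y : R => phi y * rem3 (th * y)).
Proof.
apply: measurable_funM; first exact: measurable_phi.
by apply: measurableT_comp; [exact: measurable_rem3|exact: measurable_funM].
Qed.

Let dom th y : R := 27 * `|th| ^+ 3 * (phi y * expR (6 * y) + phi y * expR (- 6 * y)).

Let integrable_dom th : mu.-integrable setT (EFin \o dom th).
Proof.
have h : mu.-integrable setT (EFin \o (fun y => phi y * expR (6 * y) + phi y * expR (- 6 * y))).
  exact: (integrableD measurableT (integrable_phi_expR 6) (integrable_phi_expR (- 6))).
exact: (integrableZl measurableT _ h).
Qed.

Let le_dom th y : `|th| <= 1 -> phi y * rem3 (th * y) <= dom th y.
Proof.
move=> th1; rewrite /dom -mulrDr [leRHS]mulrCA ler_wpM2l ?phi_ge0//.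
exact: gauss_rem3_le.
Qed.

Lemma integrable_phi_rem3 th : `|th| <= 1 ->
  mu.-integrable setT (EFin \o (fun y => phi y * rem3 (th * y))).
Proof.
move=> th1; apply: (le_integrable _ _ _ (integrable_dom th)) => //.
  by apply/measurable_EFinP; exact: measurable_phi_rem3.
move=> y _ /=; rewrite lee_fin ger0_norm ?mulr_ge0 ?phi_ge0 ?rem3_ge0//.
by rewrite (le_trans (le_dom y th1))// ler_norm.
Qed.

Lemma Rintegral_phi_rem3 th : `|th| <= 1 ->
  \int[mu]_y (phi y * rem3 (th * y)) <= gauss_cst * `|th| ^+ 3.
Proof.
move=> th1; apply: (@le_trans _ _ (\int[mu]_y dom th y)).
  apply: le_Rintegral => //; [exact: integrable_phi_rem3|by move=> y _; exact: le_dom].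
rewrite /dom RintegralZl//; last first.
  exact: (integrableD measurableT (integrable_phi_expR 6) (integrable_phi_expR (- 6))).
rewrite RintegralD//; [|exact: integrable_phi_expR|exact: integrable_phi_expR].
rewrite !Rintegral_phi_expR sqrrN.
rewrite (_ : 6 ^+ 2 / 2 = 18); last by field.
by rewrite /gauss_cst (_ : 27 * _ * _ = 54 * expR 18 * `|th| ^+ 3)//; ring.
Qed.

Lemma gauss_one_step t th u a b : `|th| <= 1 -> taylor2 (gsmooth t) u a b ->
  `|\int[mu]_y (phi y * gsmooth t (u + th * y))
     - (gsmooth t u + (a + b) * (expR (th ^+ 2 / 2) - 1))|
  <= gsmooth t u * (gauss_cst * `|th| ^+ 3).
Proof.
move=> th1 tab.
have g01 x : 0 <= gsmooth t x <= 1 by rewrite gsmooth_ge0 gsmooth_le1.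
have mth : measurable_fun setT (fun y : R => th * y) by exact: measurable_funM.
have ieN : mu.-integrable setT (EFin \o (fun y => phi y * expR (- (th * y)))).
  under eq_fun do rewrite -mulNr; exact: integrable_phi_expR.
have := one_step (Q := mu) (fun y => phi_ge0 y) mth (@integrable_phi R) (integrable_phi_expR th) ieN (integrable_phi_rem3 th1) (@measurable_gsmooth R t) g01 tab.
rewrite Rintegral_phi Rintegral_phi_expR.
under [X in b * (X - 1)]eq_Rintegral do rewrite -mulNr.
rewrite Rintegral_phi_expR sqrrN mulr1 -addrA -mulrDl => /le_trans; apply.
by rewrite ler_wpM2l ?gsmooth_ge0// Rintegral_phi_rem3.
Qed.

Lemma gsmooth_step t th r u : 0 <= t -> 0 <= th -> 0 <= r -> r ^+ 2 = t ^+ 2 + th ^+ 2 ->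
  \int[mu]_z (phi z * gsmooth t (u + th * z)) = gsmooth r u.
Proof.
rewrite le_eqVlt => /predU1P[<-|t0] th0 r0 rE.
  under eq_Rintegral do rewrite gsmooth0.
  congr (gsmooth _ u); apply/eqP; rewrite -(@eqrXn2 _ 2)// rE expr0n add0r//.
apply: gsmooth_semigroup => //; rewrite lt_neqAle r0 andbT eq_sym.
apply/eqP => r00; move: rE; rewrite r00 expr0n /= => /esym/eqP.
by rewrite gt_eqF// ltr_pwDl ?exprn_gt0 ?sqr_ge0.
Qed.

Lemma expR_le1D2x (h : R) : 0 <= h <= 1 / 2 -> expR h <= 1 + 2 * h.
Proof.
move=> /andP[h0 h1]; have d : 0 < 1 - h by lra.
rewrite -(ler_pM2r d); apply: (@le_trans _ _ 1); last by nra.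
have := ler_wpM2l (expR_ge0 h) (expR_ge1Dx (- h)).
by rewrite -expRD subrr expR0.
Qed.

Lemma relative_error_bound (C th eps K a b g g' I e0 e1 e2 e3 : R) :
  54 <= C -> 0 <= th -> C * th <= 1 / 4 -> 0 <= K - 1 <= th ^+ 2 ->
  0 <= g -> `|a| <= g -> `|b| <= g ->
  `|e0 - 1| <= eps -> `|e1 - K| <= eps -> `|e2 - K| <= eps -> e3 <= eps ->
  `|I - (g * e0 + a * (e1 - e0) + b * (e2 - e0))| <= g * e3 ->
  `|g' - (g + (a + b) * (K - 1))| <= g * (C * th ^+ 3) ->
  (1 - (12 * eps + 2 * (C * th ^+ 3))) * g' <= I <= (1 + (12 * eps + 2 * (C * th ^+ 3))) * g'.
Proof.
move=> C54 th0 thc /andP[k0 k1] g0 ag bg h0 h1 h2 h3 HI HG.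
have Cth : 54 * th <= C * th by rewrite ler_wpM2r.
have th16 : th ^+ 2 <= 1 / 16.
  have h : th <= 1 / 4 by lra.
  by rewrite (_ : 1 / 16 = (1 / 4) ^+ 2 :> R); [rewrite lerXn2r ?nnegrE|field].
have c0 : 0 <= C * th ^+ 3 by rewrite mulr_ge0 ?exprn_ge0//; lra.
have c1 : C * th ^+ 3 <= 1 / 4.
  have -> : C * th ^+ 3 = C * th * th ^+ 2 by ring.
  have : C * th * th ^+ 2 <= 1 / 4 * (1 / 16).
    by apply: ler_pM; rewrite ?sqr_ge0// mulr_ge0//; lra.
  by lra.
move: (C * th ^+ 3) c0 c1 HG => c c0 c1 HG.
have e_0 : 0 <= eps by exact: le_trans h0.
have bnd x y : `|x| <= g -> `|y| <= 2 * eps -> `|x * y| <= g * (2 * eps).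
  by move=> *; rewrite normrM ler_pM.
have bndK x : `|x| <= g -> `|x * (K - 1)| <= g * (1 / 16).
  by move=> xg; rewrite normrM ler_pM// ger0_norm// (le_trans k1).
have A1 : `|a * (e1 - e0 - (K - 1))| <= g * (2 * eps).
  by apply: bnd => //; move: h1 h0; rewrite !ler_norml; lra.
have A2 : `|b * (e2 - e0 - (K - 1))| <= g * (2 * eps).
  by apply: bnd => //; move: h2 h0; rewrite !ler_norml; lra.
have A0 : `|g * (e0 - 1)| <= g * eps by rewrite normrM (ger0_norm g0) ler_wpM2l.
have B1 := bndK _ ag; have B2 := bndK _ bg.
have E3 : g * e3 <= g * eps by rewrite ler_wpM2l.
have gc : g * c <= g * (1 / 4) by rewrite ler_wpM2l.
have gg : g <= 2 * g' by move: HG B1 B2; rewrite !ler_norml => *; lra.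
have ge : g * eps <= 2 * g' * eps by rewrite ler_wpM2r.
have gc' : g * c <= 2 * g' * c by rewrite ler_wpM2r.
clear bnd bndK B1 B2 ag bg h0 h1 h2 gc gg k0 k1 th16 Cth C54 th0 thc.
move: HG HI A0 A1 A2; rewrite !ler_norml => /andP[? ?] /andP[? ?] /andP[? ?] /andP[? ?] /andP[? ?].
by apply/andP; split; lra.
Qed.

(* Both averages come from the same Taylor expansion of gsmooth t at u; the
   Gaussian one is gsmooth r u by gsmooth_step. *)
Lemma lindeberg_step (d : measure_display) (T : measurableType d)
    (Q : {measure set T -> \bar R}) (w v : T -> R) (t th r eps delta u : R) :
  (forall x, 0 <= w x) -> measurable_fun setT v ->
  Q.-integrable setT (EFin \o w) ->
  Q.-integrable setT (EFin \o (fun x => w x * expR (v x))) ->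
  Q.-integrable setT (EFin \o (fun x => w x * expR (- v x))) ->
  Q.-integrable setT (EFin \o (fun x => w x * rem3 (v x))) ->
  `|\int[Q]_x w x - 1| <= eps ->
  `|\int[Q]_x (w x * expR (v x)) - expR (th ^+ 2 / 2)| <= eps ->
  `|\int[Q]_x (w x * expR (- v x)) - expR (th ^+ 2 / 2)| <= eps ->
  \int[Q]_x (w x * rem3 (v x)) <= eps ->
  0 <= t -> 0 <= th -> 0 <= r -> r ^+ 2 = t ^+ 2 + th ^+ 2 ->
  gauss_cst * th <= 1 / 4 ->
  delta = 12 * eps + 2 * (gauss_cst * th ^+ 3) ->
  (1 - delta) * gsmooth r u <= \int[Q]_x (w x * gsmooth t (u + v x)) <= (1 + delta) * gsmooth r u.
Proof.
move=> w0 mv iw ie ieN ir h0 h1 h2 h3 t0 th0 r0 rE thc deltaE.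
have C54 := gauss_cst_ge54.
have th1 : `|th| <= 1.
  rewrite ger0_norm// -(@ler_pM2l _ 54)//.
  apply: le_trans (ler_wpM2r th0 C54) (le_trans thc _).
  by rewrite mulr1 ler_pdivrMr// -natrM ler1n.
have [a [b tab]] := @gsmooth_taylor2 R t u.
have g01 x : 0 <= gsmooth t x <= 1 by rewrite gsmooth_ge0 gsmooth_le1.
have HI := one_step w0 mv iw ie ieN ir (@measurable_gsmooth R t) g01 tab.
have HG := gauss_one_step th1 tab; move: HG.
rewrite (ger0_norm th0) (gsmooth_step _ t0 th0 r0 rE) => HG.
have [ag bg _] := tab.
have K1 : 0 <= expR (th ^+ 2 / 2) - 1 <= th ^+ 2.
  have x0 : 0 <= th ^+ 2 / 2 by rewrite divr_ge0 ?sqr_ge0.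
  have x1 : th ^+ 2 / 2 <= 1 / 2.
    by rewrite ler_pM2r// -[th ^+ 2]real_normK ?num_real// exprn_ile1.
  rewrite subr_ge0 -{1}expR0 ler_expR x0/= lerBlDl.
  have := @expR_le1D2x (th ^+ 2 / 2); rewrite x0 x1 => /(_ isT) /le_trans; apply.
  by rewrite mulrC divfK.
rewrite deltaE.
exact: (relative_error_bound C54 th0 thc K1 (gsmooth_ge0 t u) ag bg h0 h1 h2 h3 HI HG).
Qed.

End gauss_step.

Section rows.
Context {d : measure_display} {T : measurableType d} {R : realType}.
Context (P : probability T R) (X : nat * nat -> {RV P >-> R}).
Hypothesis Xind : mutually_independent X.
Local Notation Ex f := (\int[P]_w (f w)).

Definition row_set (k : nat) : set (nat * nat) := [set ij | ij.1 = k].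
Definition rows_lt (n : nat) : set (nat * nat) := [set ij | (ij.1 < n)%N].

Lemma rows_lt_row n : rows_lt n `&` row_set n = set0.
Proof. by apply/seteqP; split => // -[i j]; rewrite /rows_lt /row_set => -[/= ij e]; move: ij; rewrite e ltnn. Qed.

Lemma row_set_sub k n : (k < n)%N -> row_set k `<=` rows_lt n.
Proof. by move=> kn -[i j]; rewrite /row_set /rows_lt /= => ->. Qed.

Variables (w v : nat -> T -> R) (B : R).
Hypothesis mw : forall k, meas_on X (row_set k) (w k).
Hypothesis mv : forall k, meas_on X (row_set k) (v k).
Hypothesis w01 : forall k x, 0 <= w k x <= 1.
Hypothesis vB : forall k x, `|v k x| <= B.

Let W n x := \prod_(k < n) w k x.
Let S n x := \sum_(k < n) v k x.

Lemma meas_on_prod n : meas_on X (rows_lt n) (W n).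
Proof.
apply: measurable_prod => k _.
exact: (meas_onS (row_set_sub (ltn_ord k)) (@mw k)).
Qed.

Lemma meas_on_sum n : meas_on X (rows_lt n) (S n).
Proof.
apply: measurable_sum => k.
exact: (meas_onS (row_set_sub (ltn_ord k)) (@mv k)).
Qed.

Lemma prod01 n x : 0 <= W n x <= 1.
Proof.
apply/andP; split.
  by apply: prodr_ge0 => k _; have /andP[] := w01 k x.
by apply: prodr_ile1 => k _; exact: w01.
Qed.

Lemma sum_bound n x : `|S n x| <= n%:R * B.
Proof.
apply: (le_trans (ler_norm_sum _ _ _)).
apply: (@le_trans _ _ (\sum_(k < n) B)); first exact: ler_sum.
by rewrite sumr_const card_ord mulr_natl.
Qed.

Lemma bmeas_w k : bmeas (w k).
Proof.
split; first exact: meas_onW (@mw k).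
by exists 1 => x; have /andP[? ?] := w01 k x; rewrite ger0_norm.
Qed.

Lemma bmeas_prod n : bmeas (W n).
Proof.
split; first exact: meas_onW (@meas_on_prod n).
by exists 1 => x; have /andP[? ?] := prod01 n x; rewrite ger0_norm.
Qed.

Lemma bmeas_expv k : bmeas (fun x => expR (v k x)).
Proof.
split; first by apply: measurableT_comp; [exact: measurable_expR|exact: meas_onW (@mv k)].
exists (expR B) => x; rewrite ger0_norm ?expR_ge0// ler_expR.
by rewrite (le_trans (ler_norm _)).
Qed.

Lemma Ex_chernoff n : Ex (fun x => W n x * expR (S n x)) =
  \prod_(k < n) Ex (fun x => w k x * expR (v k x)).
Proof.
elim: n => [|n IHn].
  rewrite big_ord0 -[RHS](Ex_cst P 1); apply: eq_Rintegral => x _.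
  by rewrite /W /S !big_ord0 expR0 mulr1.
rewrite big_ord_recr/= -IHn -(Ex_mul Xind (rows_lt_row n)).
- by apply: eq_Rintegral => x _; rewrite /W /S !big_ord_recr/= expRD mulrACA.
- apply: measurable_funM; first exact: meas_on_prod.
  by apply: measurableT_comp; [exact: measurable_expR|exact: meas_on_sum].
- apply: measurable_funM; first exact: mw.
  by apply: measurableT_comp; [exact: measurable_expR|exact: mv].
- apply: bmeasM; first exact: bmeas_prod.
  split; first by apply: measurableT_comp; [exact: measurable_expR|exact: meas_onW (@meas_on_sum n)].
  exists (expR (n%:R * B)) => x; rewrite ger0_norm ?expR_ge0// ler_expR.
  by rewrite (le_trans (ler_norm _))// sum_bound.
- by apply: bmeasM; [exact: bmeas_w|exact: bmeas_expv].
Qed.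

Variables (th eps delta : R).
Hypothesis deltaE : delta = 12 * eps + 2 * (gauss_cst * th ^+ 3).
Hypotheses (delta1 : delta <= 1) (th0 : 0 <= th) (thc : gauss_cst * th <= 1 / 4).
Hypothesis h0 : forall k, `|Ex (w k) - 1| <= eps.
Hypothesis h1 : forall k, `|Ex (fun x => w k x * expR (v k x)) - expR (th ^+ 2 / 2)| <= eps.
Hypothesis h2 : forall k, `|Ex (fun x => w k x * expR (- v k x)) - expR (th ^+ 2 / 2)| <= eps.
Hypothesis h3 : forall k, Ex (fun x => w k x * rem3 (v k x)) <= eps.

Lemma bmeas_expNv k : bmeas (fun x => expR (- v k x)).
Proof.
split; first by apply: measurableT_comp; [exact: measurable_expR|apply: measurableT_comp => //; exact: meas_onW (@mv k)].
exists (expR B) => x; rewrite ger0_norm ?expR_ge0// ler_expR.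
by rewrite (le_trans (ler_norm _))// normrN.
Qed.

Lemma bmeas_rem3 k : bmeas (fun x => rem3 (v k x)).
Proof.
split; first by apply: measurableT_comp; [exact: measurable_rem3|exact: meas_onW (@mv k)].
exists (B ^+ 3 * expR (5 * B)) => x; rewrite ger0_norm ?rem3_ge0//.
have B0 : 0 <= B by exact: le_trans (vB k x).
apply: (le_trans (rem3_le _)); apply: ler_pM; rewrite ?exprn_ge0 ?expR_ge0//.
  by rewrite lerXn2r ?nnegrE.
by rewrite ler_expR ler_wpM2l.
Qed.

Lemma bmeas_gsmooth t u (f : T -> R) : measurable_fun setT f ->
  bmeas (fun x => gsmooth t (u + f x)).
Proof.
move=> mf; split.
  apply: measurableT_comp; first exact: measurable_gsmooth.
  exact: measurable_funD.
by exists 1 => x; rewrite ger0_norm ?gsmooth_ge0// gsmooth_le1.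
Qed.

Lemma lindeberg_rows n t u r : 0 <= t -> 0 <= r -> r ^+ 2 = t ^+ 2 + n%:R * th ^+ 2 ->
  (1 - delta) ^+ n * gsmooth r u <= Ex (fun x => W n x * gsmooth t (u + S n x))
  <= (1 + delta) ^+ n * gsmooth r u.
Proof.
have eps0 : 0 <= eps by exact: le_trans (h0 0).
have delta0 : 0 <= delta.
  have C0 : 0 <= gauss_cst :> R by exact: le_trans (@gauss_cst_ge54 R).
  by rewrite deltaE addr_ge0// mulr_ge0// mulr_ge0// exprn_ge0.
elim: n t => [|n IHn] t t0 r0.
  rewrite mul0r addr0 => /eqP; rewrite eqrXn2// => /eqP ->.
  rewrite !expr0 !mul1r.
  have -> : (fun x => W 0 x * gsmooth t (u + S 0 x)) = (fun=> gsmooth t u).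
    by apply/funext => x; rewrite /W /S !big_ord0 mul1r addr0.
  by rewrite Ex_cst lexx.
move=> rE; pose t' := Num.sqrt (t ^+ 2 + th ^+ 2).
have t'E : t' ^+ 2 = t ^+ 2 + th ^+ 2 by rewrite sqr_sqrtr// addr_ge0 ?sqr_ge0.
have t'0 : 0 <= t' by exact: sqrtr_ge0.
have rE' : r ^+ 2 = t' ^+ 2 + n%:R * th ^+ 2 by rewrite t'E rE -natr1; ring.
have /andP[lo hi] := IHn t' t'0 r0 rE'.
pose U x := (W n x, S n x); pose V x := (w n x, v n x).
pose cl (y : R) := Num.min 1 (Num.max 0 y).
pose h (z : (R * R) * (R * R)) := cl z.1.1 * cl z.2.1 * gsmooth t (u + (z.1.2 + z.2.2)).
have cl01 y : 0 <= cl y <= 1.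
  by rewrite /cl ge_min lexx/= le_min ler01 le_max lexx.
have clid y : 0 <= y <= 1 -> cl y = y.
  by move=> /andP[y0 y1]; rewrite /cl (max_idPr y0) (min_idPr y1).
have mU : meas_on X (rows_lt n) U.
  by apply: measurable_fun_pair; [exact: meas_on_prod|exact: meas_on_sum].
have mV : meas_on X (row_set n) V by apply: measurable_fun_pair; [exact: mw|exact: mv].
have mcl : measurable_fun setT cl.
  by apply: measurable_minr => //; exact: measurable_maxr.
have mh : measurable_fun setT h.
  apply: measurable_funM.
    apply: measurable_funM; apply: (measurableT_comp mcl); apply: measurableT_comp => //.
  apply: measurableT_comp; first exact: measurable_gsmooth.
  apply: measurable_funD => //; apply: measurable_funD; apply: measurableT_comp => //.
have h01 z : 0 <= h z <= 1.
  have /andP[a0 a1] := cl01 z.1.1; have /andP[b0 b1] := cl01 z.2.1.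
  rewrite /h; have g0 := @gsmooth_ge0 R t (u + (z.1.2 + z.2.2)).
  have g1 := @gsmooth_le1 R t (u + (z.1.2 + z.2.2)).
  by rewrite !mulr_ge0//= mulr_ile1 ?mulr_ge0// mulr_ile1.
have [fub mfub] := Ex_fubini Xind (rows_lt_row n) mU mV mh h01.
have -> : Ex (fun x => W n.+1 x * gsmooth t (u + S n.+1 x)) = Ex (fun x => h (U x, V x)).
  apply: eq_Rintegral => x _; rewrite /h /= (clid _ (prod01 n x)) (clid _ (w01 n x)).
  by rewrite /W /S !big_ord_recr.
rewrite fub.
have inner x : Ex (fun x' => h (U x, V x')) = W n x * Ex (fun x' => w n x' * gsmooth t (u + S n x + v n x')).
  rewrite -ExZ.
    by apply: eq_Rintegral => x' _; rewrite /h /= !clid ?prod01// mulrA addrA.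
  exact: bmeasM (bmeas_w n) (bmeas_gsmooth _ _ (meas_onW (@mv n))).
have step x : (1 - delta) * gsmooth t' (u + S n x) <= Ex (fun x' => w n x' * gsmooth t (u + S n x + v n x')) <= (1 + delta) * gsmooth t' (u + S n x).
  apply: (lindeberg_step (th := th) (eps := eps)) => //.
  - by move=> x'; have /andP[] := w01 n x'.
  - exact: meas_onW (@mv n).
  - exact: bmeas_integrable (bmeas_w n).
  - exact: bmeas_integrable (bmeasM (bmeas_w n) (bmeas_expv n)).
  - exact: bmeas_integrable (bmeasM (bmeas_w n) (bmeas_expNv n)).
  - exact: bmeas_integrable (bmeasM (bmeas_w n) (bmeas_rem3 n)).
have bWg : bmeas (fun x => W n x * gsmooth t' (u + S n x)).
  exact: bmeasM (bmeas_prod n) (bmeas_gsmooth _ _ (meas_onW (@meas_on_sum n))).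
have bg c : bmeas (fun x => c * (W n x * gsmooth t' (u + S n x))).
  exact: bmeasM (bmeas_cst c) bWg.
have bin : bmeas (fun x => Ex (fun x' => h (U x, V x'))).
  split; first exact: (measurableT_comp mfub (meas_onW mU)).
  exists (1 + delta) => x; rewrite ger0_norm; last first.
    by apply: Ex_ge0 => x'; have /andP[] := h01 (U x, V x').
  have /andP[W0 W1] := prod01 n x; have /andP[_ s1] := step x.
  rewrite inner; apply: (le_trans (ler_wpM2l W0 s1)).
  by rewrite mulrCA ler_piMr ?addr_ge0// mulr_ile1 ?gsmooth_ge0 ?gsmooth_le1.
apply/andP; split.
- apply: (@le_trans _ _ (Ex (fun x => (1 - delta) * (W n x * gsmooth t' (u + S n x))))).
    rewrite exprS -mulrA ExZ; last exact: bWg.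
    by rewrite ler_wpM2l// subr_ge0.
  apply: (Ex_le P (bg (1 - delta)) bin) => x; have /andP[s1 _] := step x.
  by have /andP[W0 _] := prod01 n x; rewrite inner mulrCA (ler_wpM2l W0 s1).
- apply: (@le_trans _ _ (Ex (fun x => (1 + delta) * (W n x * gsmooth t' (u + S n x))))).
    apply: (Ex_le P bin (bg (1 + delta))) => x; have /andP[_ s1] := step x.
    by have /andP[W0 _] := prod01 n x; rewrite inner mulrCA (ler_wpM2l W0 s1).
  rewrite exprS -mulrA ExZ; last exact: bWg.
  by rewrite ler_wpM2l// addr_ge0.
Qed.

End rows.

Section expR_taylor.
Context {R : realType}.
Implicit Types v : R.

Lemma expR_taylor1 v : `|expR v - 1 - v| <= v ^+ 2 * expR `|v|.
Proof.
have h : `|v| * (`|v| * expR `|v|) = v ^+ 2 * expR `|v|.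
  by rewrite mulrA -expr2 real_normK// num_real.
rewrite -h.
have bnd c : `|c| <= `|v| -> `|expR c - 1| <= `|v| * expR `|v|.
  move=> cv; apply: (le_trans (expR_sub1_le c)); apply: ler_pM; rewrite ?expR_ge0//.
  by rewrite ler_expR.
have df (x : R) : is_derive (x : R^o) (1 : R^o) (fun y : R^o => expR y - y : R^o) (expR x - 1).
  exact: is_deriveB.
have cf (a b : R) : {within `[a, b], continuous (fun y : R^o => expR y - y : R^o)}.
  by apply: derivable_within_continuous => x _; have [] := df x.
have [v0|v0] := leP 0 v.
  have [c] := MVT_segment v0 (fun x _ => df x) (cf 0 v).
  rewrite in_itv/= => /andP[c0 cv]; rewrite expR0 !subr0 => e.
  rewrite (_ : expR v - 1 - v = (expR c - 1) * v); last by rewrite -e; ring.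
  by rewrite normrM mulrC ler_wpM2l// bnd// !ger0_norm.
have [c] := MVT_segment (ltW v0) (fun x _ => df x) (cf v 0).
rewrite in_itv/= => /andP[vc c0]; rewrite expR0 subr0 sub0r => e.
rewrite (_ : expR v - 1 - v = (expR c - 1) * v); last by rewrite -[RHS]opprK -mulrN -e; ring.
by rewrite normrM mulrC ler_wpM2l// bnd// !ler0_norm ?lerN2// ltW.
Qed.

Lemma expR_taylor2 v : `|expR v - 1 - v - v ^+ 2 / 2| <= `|v| ^+ 3 * expR `|v|.
Proof.
have h : `|v| * (v ^+ 2 * expR `|v|) = `|v| ^+ 3 * expR `|v|.
  by rewrite mulrA -[v ^+ 2]real_normK ?num_real// -exprS.
rewrite -h.
have bnd c : `|c| <= `|v| -> `|expR c - 1 - c| <= v ^+ 2 * expR `|v|.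
  move=> cv; apply: (le_trans (expR_taylor1 c)); apply: ler_pM; rewrite ?expR_ge0 ?sqr_ge0//.
    by rewrite -[leLHS]real_normK ?num_real// -[leRHS]real_normK ?num_real// lerXn2r ?nnegrE.
  by rewrite ler_expR.
pose F : R^o -> R^o := fun y => expR y - y - 2^-1 * y ^+ 2.
have df (x : R) : is_derive (x : R^o) (1 : R^o) F (expR x - 1 - x).
  have d2 : is_derive (x : R^o) (1 : R^o) (2^-1 \*: ((@id R^o) ^+ 2)) (2^-1 *: (2%:R * x ^+ 1 *: 1)).
    by apply: is_deriveZ; apply: is_deriveX.
  have -> : expR x - 1 - x = expR x - 1 - 2^-1 *: (2%:R * x ^+ 1 *: (1 : R^o)).
    by congr (_ - _); rewrite [_ *: 1]mulr1 expr1 [RHS]mulrA mulVf ?mul1r// pnatr_eq0.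
  by apply: is_deriveB; apply: is_deriveB.
have cf (a b : R) : {within `[a, b], continuous F}.
  by apply: derivable_within_continuous => x _; have [] := df x.
have [v0|v0] := leP 0 v.
  have [c] := MVT_segment v0 (fun x _ => df x) (cf 0 v).
  rewrite in_itv/= /F => /andP[c0 cv]; rewrite expR0 expr0n /= mulr0 !subr0 => e.
  rewrite (_ : expR v - 1 - v - _ = (expR c - 1 - c) * v); last by rewrite -e; field.
  by rewrite normrM mulrC ler_wpM2l// bnd// !ger0_norm.
have [c] := MVT_segment (ltW v0) (fun x _ => df x) (cf v 0).
rewrite in_itv/= /F => /andP[vc c0]; rewrite expR0 expr0n /= mulr0 !subr0 sub0r => e.
rewrite (_ : expR v - 1 - v - _ = (expR c - 1 - c) * v); last first.
  by rewrite -[RHS]opprK -[- (_ * v)]mulrN -e; field.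
by rewrite normrM mulrC ler_wpM2l// bnd// !ler0_norm ?lerN2// ltW.
Qed.

End expR_taylor.

Section truncation.
Context {R : realType}.
Variable tau : R.
Implicit Types z : R.

Definition chi z : R := \1_`[- tau, tau]%classic z.
Definition trunc z : R := z * chi z.

Lemma chiE z : chi z = (`|z| <= tau)%R%:R.
Proof. by rewrite /chi indicE mem_setE in_itv/= ler_norml. Qed.

Lemma chi01 z : 0 <= chi z <= 1.
Proof. by rewrite chiE; case: (`|z| <= tau); rewrite ?lexx ?ler01. Qed.

Lemma chi_ge0 z : 0 <= chi z. Proof. by have /andP[] := chi01 z. Qed.
Lemma chi_le1 z : chi z <= 1. Proof. by have /andP[] := chi01 z. Qed.

Lemma chi_idem z : chi z * chi z = chi z.
Proof. by rewrite chiE; case: (`|z| <= tau); rewrite ?mulr1 ?mulr0. Qed.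

Lemma trunc_id z : `|z| <= tau -> trunc z = z.
Proof. by move=> h; rewrite /trunc chiE h mulr1. Qed.

Lemma chi_trunc z : chi z * trunc z = trunc z.
Proof. by rewrite /trunc mulrCA chi_idem. Qed.

Lemma trunc_sqr z : trunc z ^+ 2 = chi z * z ^+ 2.
Proof. by rewrite /trunc exprMn expr2 [chi z ^+ 2]expr2 chi_idem mulrC. Qed.

Lemma measurable_chi : measurable_fun setT chi.
Proof. exact: measurable_indic. Qed.

Lemma measurable_trunc : measurable_fun setT trunc.
Proof. by apply: measurable_funM => //; exact: measurable_chi. Qed.

Hypothesis tau0 : 0 <= tau.

Lemma trunc_le z : `|trunc z| <= tau.
Proof.
rewrite /trunc chiE; have [h|h] := boolP (`|z| <= tau); first by rewrite mulr1.
by rewrite mulr0 normr0.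
Qed.

Lemma bmeas_chiM (g : R -> R) M : measurable_fun setT g ->
  (forall z, `|z| <= tau -> `|g z| <= M) -> bmeas (fun z => chi z * g z).
Proof.
move=> mg gM; split; first by apply: measurable_funM => //; exact: measurable_chi.
exists M => z; rewrite chiE; have [h|h] := boolP (`|z| <= tau).
  by rewrite mul1r gM.
by rewrite mul0r normr0; apply: le_trans (gM 0 _); rewrite ?normr0.
Qed.

Lemma bmeas_chi : bmeas chi.
Proof.
split; first exact: measurable_chi.
by exists 1 => z; rewrite ger0_norm ?chi_ge0 ?chi_le1.
Qed.

Lemma bmeas_trunc : bmeas trunc.
Proof. by split; [exact: measurable_trunc|exists tau => z; exact: trunc_le]. Qed.

Variable c : R.
Definition majorant z : R := chi z * ((1 + z ^+ 2) ^+ 2 * expR (c * z ^+ 2)).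

Lemma majorant_ge0 z : 0 <= majorant z.
Proof. by rewrite mulr_ge0 ?chi_ge0// mulr_ge0 ?expR_ge0// exprn_ge0// addr_ge0// sqr_ge0. Qed.

Hypothesis c0 : 0 <= c.

Lemma bmeas_majorant : bmeas majorant.
Proof.
apply: (@bmeas_chiM _ ((1 + tau ^+ 2) ^+ 2 * expR (c * tau ^+ 2))).
  apply: measurable_funM.
    by apply: measurable_funX; apply: measurable_funD => //; exact: measurable_funX.
  apply: measurableT_comp; first exact: measurable_expR.
  by apply: measurable_funM => //; exact: measurable_funX.
move=> z zt; rewrite ger0_norm; last by rewrite mulr_ge0 ?expR_ge0// exprn_ge0// addr_ge0// sqr_ge0.
have z2 : z ^+ 2 <= tau ^+ 2.
  by rewrite -[leLHS]real_normK ?num_real// lerXn2r ?nnegrE.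
apply: ler_pM; rewrite ?expR_ge0 ?exprn_ge0 ?addr_ge0 ?sqr_ge0//.
  by rewrite lerXn2r ?nnegrE ?addr_ge0 ?sqr_ge0// lerD2l.
by rewrite ler_expR ler_wpM2l.
Qed.

End truncation.

Section norm3.
Context {R : realType}.
Lemma norm3_le_sqr (z : R) : `|z| ^+ 3 <= (1 + z ^+ 2) ^+ 2.
Proof.
rewrite -[z ^+ 2]real_normK ?num_real//; set y := `|z|.
have y0 : 0 <= y by exact: normr_ge0.
have h : 0 <= (1 - y) ^+ 2 by exact: sqr_ge0.
have h2 : 2 * y <= 1 + y ^+ 2 by nra.
have y2 : 0 <= y ^+ 2 by exact: sqr_ge0.
have : y * y ^+ 2 <= (1 + y ^+ 2) * (1 + y ^+ 2) by apply: ler_pM => //; lra.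
by rewrite -exprS -expr2.
Qed.
End norm3.

Section marginals.
Context {d : measure_display} {T : measurableType d} {R : realType}.
Context (P : probability T R) (X : nat * nat -> {RV P >-> R}).
Hypotheses (Xind : mutually_independent X) (Xid : identically_distributed X).
Local Notation Ex f := (\int[P]_w (f w)).
Variables (zf : R -> R).
Hypothesis mzf : measurable_fun setT zf.

Definition Zv (ij : nat * nat) (w : T) : R := zf (X ij w).
Definition E1 (h : R -> R) : R := Ex (fun w => h (Zv (0, 0)%N w)).

Lemma meas_on_Zv (J : set (nat * nat)) ij (h : R -> R) : J ij ->
  measurable_fun setT h -> meas_on X J (fun w => h (Zv ij w)).
Proof.
move=> Jij mh; apply: (measurableT_comp mh); apply: (measurableT_comp mzf).
exact: (@meas_onX _ _ _ _ _ X J ij Jij).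
Qed.

Lemma bmeas_Zv ij (h : R -> R) : bmeas h -> bmeas (fun w => h (Zv ij w)).
Proof.
move=> [mh [M hM]]; split; last by exists M.
by apply: (measurableT_comp mh); apply: (measurableT_comp mzf).
Qed.

Lemma Ex_Zv1 ij (h : R -> R) : bmeas h -> Ex (fun w => h (Zv ij w)) = E1 h.
Proof.
move=> bh; have mh : measurable_fun setT (h \o zf).
  by apply: (measurableT_comp _ mzf); case: bh.
have tr ij' : (\int[P]_w (h (Zv ij' w))%:E = \int[distribution P (X ij')]_y ((h \o zf) y)%:E)%E.
  rewrite integral_distribution//; first exact/measurable_EFinP.
  exact: bmeas_integrable (bmeas_Zv ij' bh).
rewrite /E1 /Rintegral !tr; congr fine; apply: eq_measure_integral => A mA _.
exact: Xid.
Qed.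

Lemma Ex_Zv2 i j (h1 h2 : R -> R) : i != j -> bmeas h1 -> bmeas h2 ->
  Ex (fun w => h1 (Zv i w) * h2 (Zv j w)) = E1 h1 * E1 h2.
Proof.
move=> ij b1 b2; rewrite -(Ex_Zv1 i b1) -(Ex_Zv1 j b2).
apply: (Ex_mul Xind (J := [set i]) (J' := [set j])).
- by apply/seteqP; split => // x [/= -> e]; rewrite e eqxx in ij.
- by apply: meas_on_Zv => //; case: b1.
- by apply: meas_on_Zv => //; case: b2.
- exact: bmeas_Zv.
- exact: bmeas_Zv.
Qed.

Lemma Ex_Zv3 i j k (h1 h2 h3 : R -> R) : i != j -> i != k -> j != k ->
  bmeas h1 -> bmeas h2 -> bmeas h3 ->
  Ex (fun w => h1 (Zv i w) * (h2 (Zv j w) * h3 (Zv k w))) = E1 h1 * (E1 h2 * E1 h3).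
Proof.
move=> ij ik jk b1 b2 b3; rewrite -(Ex_Zv2 jk b2 b3) -(Ex_Zv1 i b1).
apply: (Ex_mul Xind (J := [set i]) (J' := [set j; k])).
- apply/seteqP; split => // x [/= -> [e|e]]; first by rewrite e eqxx in ij.
  by rewrite e eqxx in ik.
- by apply: meas_on_Zv => //; case: b1.
- apply: measurable_funM.
    by apply: (@meas_on_Zv [set j; k]) => //; [left|case: b2].
  by apply: (@meas_on_Zv [set j; k]) => //; [right|case: b3].
- exact: bmeas_Zv.
- by apply: bmeasM; exact: bmeas_Zv.
Qed.

End marginals.

Section moments.
Context {d : measure_display} {T : measurableType d} {R : realType}.
Context (P : probability T R) (X : nat * nat -> {RV P >-> R}).
Hypotheses (Xind : mutually_independent X) (Xid : identically_distributed X).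
Local Notation Ex f := (\int[P]_w (f w)).
Variables (zf : R -> R).
Hypothesis mzf : measurable_fun setT zf.
Local Notation Z := (Zv X zf).
Local Notation E1 := (E1 X zf).

Lemma Ex_close (f g h : T -> R) : bmeas f -> bmeas g -> bmeas h ->
  (forall w, `|f w - g w| <= h w) -> `|Ex f - Ex g| <= Ex h.
Proof.
move=> bf bg bh fgh; rewrite -(ExB P bf bg).
apply: (le_trans (Ex_abs P (bmeasB bf bg))).
exact: (Ex_le P (bmeas_abs (bmeasB bf bg)) bh fgh).
Qed.

Variables (tau c eps K : R).
Hypotheses (tau0 : 0 <= tau) (c0 : 0 <= c) (eps01 : 0 <= eps <= 1).
Local Notation chi := (chi tau).
Local Notation trunc := (trunc tau).
Local Notation H := (majorant tau c).
Hypothesis m0_close : `|E1 chi - 1| <= eps.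
Hypothesis m1_close : `|E1 trunc| <= eps.
Hypothesis m2_close : `|E1 (fun z => trunc z ^+ 2) - 1| <= eps.
Hypothesis HK : E1 H <= K.

Let bchi := bmeas_chi tau.
Let btr := bmeas_trunc tau0.
Let bH := bmeas_majorant tau0 c0.

Let btr2 : bmeas (fun z => trunc z ^+ 2).
Proof. by under eq_fun do rewrite expr2; exact: bmeasM btr btr. Qed.

Lemma E1_chi_le1 : E1 chi <= 1.
Proof.
rewrite -[leRHS](Ex_cst P 1); apply: Ex_le.
- exact: (bmeas_Zv X mzf _ bchi).
- exact: bmeas_cst.
- by move=> w; exact: chi_le1.
Qed.

Lemma E1_chi_ge0 : 0 <= E1 chi.
Proof. by apply: Ex_ge0 => w; exact: chi_ge0. Qed.

Lemma E1_H_ge0 : 0 <= E1 H.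
Proof. by apply: Ex_ge0 => w; exact: majorant_ge0. Qed.

Lemma bmeas_expR (f : T -> R) : bmeas f -> bmeas (fun x => expR (f x)).
Proof.
move=> [mf [M fM]]; split; first by apply: measurableT_comp mf; exact: measurable_expR.
exists (expR M) => x; rewrite ger0_norm ?expR_ge0// ler_expR.
by rewrite (le_trans (ler_norm _)).
Qed.

Section pair.
Variables (i j : nat * nat) (a : R).
Hypotheses (ij : i != j) (a1 : `|a| <= 1) (ac : 5 * `|a| <= 2 * c).

Definition pair_weight (w : T) : R := chi (Z i w) * chi (Z j w).
Definition pair_value (w : T) : R := a * (trunc (Z i w) * trunc (Z j w)).

Lemma bmeas_pair_weight : bmeas pair_weight.
Proof. by apply: bmeasM; exact: bmeas_Zv. Qed.

Lemma bmeas_pair_value : bmeas pair_value.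
Proof. by apply: bmeasM; [exact: bmeas_cst|apply: bmeasM; exact: bmeas_Zv]. Qed.

Lemma pair_rem_le w :
  pair_weight w * (`|pair_value w| ^+ 3 * expR (5 * `|pair_value w|)) <=
  `|a| ^+ 3 * (H (Z i w) * H (Z j w)).
Proof.
rewrite /pair_weight /pair_value /majorant.
have := chi_ge0 tau (Z i w); have := chi_ge0 tau (Z j w).
set x := Z i w; set y := Z j w => cy cx.
have [xt|xt] := boolP (`|x| <= tau); last first.
  by rewrite !(chiE _ x) (negbTE xt) !mul0r ?mulr0.
have [yt|yt] := boolP (`|y| <= tau); last first.
  by rewrite !(chiE _ y) (negbTE yt) !mul0r !mulr0 ?mul0r ?mulr0.
rewrite !trunc_id// !chiE xt yt !mul1r !normrM !exprMn -[leLHS]mulrA ler_wpM2l ?exprn_ge0//.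
have hx := norm3_le_sqr x; have hy := norm3_le_sqr y.
have hE : expR (5 * (`|a| * (`|x| * `|y|))) <= expR (c * x ^+ 2) * expR (c * y ^+ 2).
  rewrite -expRD ler_expR -mulrDr.
  rewrite -[x ^+ 2]real_normK ?num_real// -[y ^+ 2]real_normK ?num_real//.
  have x0 := normr_ge0 x; have y0 := normr_ge0 y.
  have h : 0 <= (`|x| - `|y|) ^+ 2 by exact: sqr_ge0.
  have h2 : 2 * (`|x| * `|y|) <= `|x| ^+ 2 + `|y| ^+ 2 by nra.
  have p0 : 0 <= `|x| * `|y| by exact: mulr_ge0.
  apply: (@le_trans _ _ (c * (2 * (`|x| * `|y|)))); last by rewrite ler_wpM2l.
  by rewrite mulrA (mulrA c) ler_wpM2r// (mulrC c).
rewrite [leRHS](_ : _ = ((1 + x ^+ 2) ^+ 2 * (1 + y ^+ 2) ^+ 2) * (expR (c * x ^+ 2) * expR (c * y ^+ 2))); last by ring.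
apply: ler_pM => //; rewrite ?mulr_ge0 ?exprn_ge0 ?expR_ge0//.
by apply: ler_pM => //; rewrite ?exprn_ge0.
Qed.

Let HH0 : bmeas (fun w => `|a| ^+ 3 * (H (Z i w) * H (Z j w))).
Proof. by apply: bmeasM; [exact: bmeas_cst|apply: bmeasM; exact: bmeas_Zv]. Qed.

Let ExHH : Ex (fun w => `|a| ^+ 3 * (H (Z i w) * H (Z j w))) <= `|a| ^+ 3 * K ^+ 2.
Proof.
rewrite ExZ; last by apply: bmeasM; exact: bmeas_Zv.
rewrite ler_wpM2l ?exprn_ge0// (Ex_Zv2 Xind Xid mzf ij bH bH) expr2.
by apply: ler_pM => //; exact: E1_H_ge0.
Qed.

Lemma Ex_pair_weight : `|Ex pair_weight - 1| <= 3 * eps.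
Proof.
rewrite (Ex_Zv2 Xind Xid mzf ij bchi bchi).
have h0 := E1_chi_ge0; have h1 := E1_chi_le1.
move: m0_close; rewrite !ler_norml => /andP[? ?].
by apply/andP; split; nra.
Qed.

Lemma Ex_pair_rem3 : Ex (fun w => pair_weight w * rem3 (pair_value w)) <= `|a| ^+ 3 * K ^+ 2.
Proof.
apply: le_trans ExHH; apply: Ex_le => //.
  apply: bmeasM; first exact: bmeas_pair_weight.
  have [mv [M vM]] := bmeas_pair_value.
  split; first by apply: measurableT_comp mv; exact: measurable_rem3.
  exists (M ^+ 3 * expR (5 * M)) => w; rewrite ger0_norm ?rem3_ge0//.
  have M0 : 0 <= M by exact: le_trans (vM w).
  apply: (le_trans (rem3_le _)); apply: ler_pM; rewrite ?exprn_ge0 ?expR_ge0//.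
    by rewrite lerXn2r ?nnegrE.
  by rewrite ler_expR ler_wpM2l.
move=> w; apply: le_trans (pair_rem_le w); rewrite ler_wpM2l ?rem3_le//.
by rewrite mulr_ge0 ?chi_ge0.
Qed.

Lemma Ex_pair_exp : `|Ex (fun w => pair_weight w * expR (pair_value w)) - expR (a ^+ 2 / 2)|
  <= 6 * eps + (K ^+ 2 + 1) * `|a| ^+ 3.
Proof.
pose t w := trunc (Z i w) * trunc (Z j w).
pose q w := trunc (Z i w) ^+ 2 * trunc (Z j w) ^+ 2.
have bt : bmeas t by apply: bmeasM; exact: bmeas_Zv.
have bq : bmeas q.
  by apply: bmeasM; [exact: (bmeas_Zv X mzf i btr2)|exact: (bmeas_Zv X mzf j btr2)].
have bat : bmeas (fun w => a * t w) by apply: bmeasM => //; exact: bmeas_cst.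
have baq : bmeas (fun w => a ^+ 2 / 2 * q w) by apply: bmeasM => //; exact: bmeas_cst.
have bwt := bmeasD bmeas_pair_weight bat.
have h := Ex_close (bmeasM bmeas_pair_weight (bmeas_expR bmeas_pair_value))
  (bmeasD bwt baq) HH0 _.
have {h} h : `|Ex (fun w => pair_weight w * expR (pair_value w)) -
    (E1 chi * E1 chi + a * (E1 trunc * E1 trunc) +
     a ^+ 2 / 2 * (E1 (fun z => trunc z ^+ 2) * E1 (fun z => trunc z ^+ 2)))| <= `|a| ^+ 3 * K ^+ 2.
  apply: le_trans ExHH; rewrite -(Ex_Zv2 Xind Xid mzf ij bchi bchi).
  rewrite -(Ex_Zv2 Xind Xid mzf ij btr btr) -(Ex_Zv2 Xind Xid mzf ij btr2 btr2).
  rewrite -(ExZ P a bt) -(ExZ P (a ^+ 2 / 2) bq) -(ExD P bmeas_pair_weight bat) -(ExD P bwt baq).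
  apply: h => w; apply: le_trans (pair_rem_le w).
  rewrite (_ : _ - _ = pair_weight w * (expR (pair_value w) - 1 - pair_value w - pair_value w ^+ 2 / 2)).
    have p0 : 0 <= pair_weight w by rewrite mulr_ge0 ?chi_ge0.
    rewrite normrM (ger0_norm p0) ler_wpM2l//.
    apply: (le_trans (expR_taylor2 _)); rewrite ler_wpM2l ?exprn_ge0//.
    by rewrite ler_expR ler_peMl// ler1n.
  rewrite /pair_value /t /q /pair_weight.
  have := chi_trunc tau (Z i w); have := chi_trunc tau (Z j w).
  set x := trunc (Z i w); set y := trunc (Z j w).
  move: (chi (Z i w)) (chi (Z j w)) (expR (a * (x * y))) => p r e hy hx.
  have h1 : p * r * (x * y) = x * y by rewrite mulrACA hx hy.
  rewrite [RHS](_ : _ = p * r * e - p * r - a * (p * r * (x * y)) - a ^+ 2 / 2 * ((p * r * (x * y)) * (x * y))).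
    by rewrite h1; field.
  by field.
have e0 : 0 <= eps by case/andP: eps01.
have e1 : eps <= 1 by case/andP: eps01.
have ma0 := E1_chi_ge0; have ma1 := E1_chi_le1.
move: m0_close m1_close m2_close h.
set m0 := E1 chi in ma0 ma1 *; set m1 := E1 trunc; set m2 := E1 _.
set y := \int[P]_w (pair_weight w * expR (pair_value w)) => M0 M1 M2 h.
have a0 : 0 <= `|a| by exact: normr_ge0.
have A1 : `|m0 * m0 - 1| <= 2 * eps.
  by move: M0; rewrite !ler_norml => /andP[? ?]; apply/andP; split; nra.
have A2 : `|a * (m1 * m1)| <= eps.
  rewrite normrM normrM -[leRHS]mul1r; apply: ler_pM => //.
  by rewrite -[leRHS]mulr1; apply: ler_pM => //; exact: le_trans e1.
have aa : 0 <= a ^+ 2 <= 1.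
  by rewrite sqr_ge0/= -real_normK ?num_real// exprn_ile1.
have A3 : `|a ^+ 2 / 2 * (m2 * m2) - a ^+ 2 / 2| <= 2 * eps.
  rewrite (_ : _ - _ = a ^+ 2 * ((m2 * m2 - 1) / 2)); last by field.
  rewrite normrM -[leRHS]mul1r; apply: ler_pM => //.
    by rewrite ger0_norm; case/andP: aa.
  by move: M2; rewrite !ler_norml => /andP[? ?]; apply/andP; split; nra.
have A4 : `|expR (a ^+ 2 / 2) - 1 - a ^+ 2 / 2| <= `|a| ^+ 3.
  apply: (le_trans (expR_taylor1 _)).
  have x0 : 0 <= a ^+ 2 / 2 by rewrite divr_ge0 ?sqr_ge0.
  rewrite (ger0_norm x0).
  have : expR (a ^+ 2 / 2) <= 2.
    have x1 : a ^+ 2 / 2 <= 1 / 2 by case/andP: aa => _ ?; lra.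
    have := expR_ge1Dx (- (a ^+ 2 / 2)); rewrite expRN.
    have K0 := expR_gt0 (a ^+ 2 / 2).
    rewrite -(ler_pM2r K0) mulVf ?gt_eqF//.
    by move: K0 x0 x1; move: (expR (a ^+ 2 / 2)) (a ^+ 2 / 2) => E x *; nra.
  have -> : (a ^+ 2 / 2) ^+ 2 = `|a| ^+ 3 * (`|a| / 4).
    by rewrite -[a ^+ 2]real_normK ?num_real//; field.
  move=> E2; rewrite -[leRHS]mulr1 -mulrA ler_wpM2l ?exprn_ge0//.
  have E0 := expR_ge0 (a ^+ 2 / 2).
  by move: E2 E0 a0 a1; move: (expR (a ^+ 2 / 2)) `|a| => E b *; nra.
move: h A1 A2 A3 A4; set E := expR (a ^+ 2 / 2); rewrite (_ : (K ^+ 2 + 1) * `|a| ^+ 3 = `|a| ^+ 3 * K ^+ 2 + `|a| ^+ 3); last by ring.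
rewrite !ler_norml => /andP[? ?] /andP[? ?] /andP[? ?] /andP[? ?] /andP[? ?].
by apply/andP; split; lra.
Qed.

End pair.

Lemma Ex_single_exp (i : nat * nat) (a : R) (g : R -> R) :
  `|a| <= 1 -> `|a| <= c -> bmeas g -> (forall z, `|z| <= tau -> `|g z| <= 1 + z ^+ 2) ->
  Ex (fun w => chi (Z i w) * expR (a * g (Z i w))) <=
  1 + `|a| * `|E1 (fun z => chi z * g z)| + expR 1 * K * a ^+ 2.
Proof.
move=> a1 ac bg gb.
have bag : bmeas (fun z => a * g z) by apply: bmeasM => //; exact: bmeas_cst.
have bcg : bmeas (fun z => chi z * g z) by exact: bmeasM.
have beag : bmeas (fun w => expR (a * g (Z i w))) by exact: bmeas_expR (bmeas_Zv X mzf i bag).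
have bf : bmeas (fun w => chi (Z i w) * expR (a * g (Z i w))).
  by apply: bmeasM => //; exact: (bmeas_Zv X mzf i bchi).
have b1 : bmeas (fun w => chi (Z i w)) by exact: (bmeas_Zv X mzf i bchi).
have b2' : bmeas (fun w => chi (Z i w) * g (Z i w)) by exact: (bmeas_Zv X mzf i bcg).
have b2 : bmeas (fun w => a * (chi (Z i w) * g (Z i w))) by apply: bmeasM => //; exact: bmeas_cst.
have b3' : bmeas (fun w => H (Z i w)) by exact: (bmeas_Zv X mzf i bH).
have b3 : bmeas (fun w => expR 1 * a ^+ 2 * H (Z i w)) by apply: bmeasM => //; exact: bmeas_cst.
have := Ex_close bf (bmeasD b1 b2) b3 _.
rewrite (ExD P b1 b2) (ExZ P a b2') (ExZ P (expR 1 * a ^+ 2) b3').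
rewrite (Ex_Zv1 Xid mzf i bchi) (Ex_Zv1 Xid mzf i bcg) (Ex_Zv1 Xid mzf i bH) => h.
have {}h := h _; move: h; set y := \int[P]_w _ => h.
have {}h : `|y - (E1 chi + a * E1 (fun z => chi z * g z))| <= expR 1 * a ^+ 2 * E1 H.
  apply: h => w; set z := Z i w; rewrite /majorant.
  have [zt|zt] := boolP (`|z| <= tau); last first.
    by rewrite !chiE (negbTE zt) !mul0r mulr0 addr0 subrr normr0 mulr0.
  rewrite !chiE zt !mul1r opprD addrA.
  apply: (le_trans (expR_taylor1 _)); rewrite exprMn normrM.
  rewrite [leRHS](_ : _ = (a ^+ 2 * (1 + z ^+ 2) ^+ 2) * (expR 1 * expR (c * z ^+ 2))); last by ring.
  have gz := gb z zt; have z0 : 0 <= 1 + z ^+ 2 by rewrite addr_ge0 ?sqr_ge0.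
  apply: ler_pM; [by rewrite mulr_ge0 ?sqr_ge0|exact: expR_ge0| |].
    rewrite ler_wpM2l ?sqr_ge0// -[leLHS]real_normK ?num_real//.
    by rewrite lerXn2r ?nnegrE.
  rewrite -expRD ler_expR; apply: (@le_trans _ _ (`|a| * (1 + z ^+ 2))).
    by rewrite ler_wpM2l.
  by rewrite mulrDr mulr1 lerD// ler_wpM2r ?sqr_ge0.
have m1 := E1_chi_le1.
have h1 : expR 1 * a ^+ 2 * E1 H <= expR 1 * K * a ^+ 2.
  by rewrite mulrAC ler_wpM2r ?sqr_ge0// ler_wpM2l ?expR_ge0.
have h2 : a * E1 (fun z => chi z * g z) <= `|a| * `|E1 (fun z => chi z * g z)|.
  by rewrite -normrM ler_norm.
move: h; rewrite ler_norml => /andP[_ h]; lra.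
Qed.

Section triple.
Variables (i j k : nat * nat) (a b th : R).
Hypotheses (ij : i != j) (ik : i != k) (jk : j != k).
Hypotheses (ath : `|a| <= th) (bth : `|b| <= th) (thc : th <= c).

Definition triple_weight (w : T) : R := chi (Z i w) * (chi (Z j w) * chi (Z k w)).
Definition triple_value (w : T) : R :=
  a * (trunc (Z i w) * trunc (Z j w)) + b * (trunc (Z i w) * trunc (Z k w)).

Let th0 : 0 <= th. Proof. exact: le_trans ath. Qed.

Lemma triple_rem_le w :
  triple_weight w * (`|triple_value w| ^+ 3 * expR `|triple_value w|) <=
  8 * th ^+ 3 * (H (Z i w) * (H (Z j w) * H (Z k w))).
Proof.
rewrite /triple_weight /triple_value /majorant.
set x := Z i w; set y := Z j w; set z := Z k w.
have [xt|xt] := boolP (`|x| <= tau); last first.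
  by rewrite !(chiE _ x) (negbTE xt) !mul0r mulr0.
have [yt|yt] := boolP (`|y| <= tau); last first.
  by rewrite !(chiE _ y) (negbTE yt) !mul0r !mulr0 ?mul0r ?mulr0.
have [zt|zt] := boolP (`|z| <= tau); last first.
  by rewrite !(chiE _ z) (negbTE zt) !mul0r !mulr0 ?mul0r ?mulr0.
rewrite !trunc_id// !chiE xt yt zt !mul1r.
have x0 := normr_ge0 x; have y0 := normr_ge0 y; have z0 := normr_ge0 z.
have hv : `|a * (x * y) + b * (x * z)| <= th * (`|x| * (`|y| + `|z|)).
  rewrite mulrDr mulrDr; apply: (le_trans (ler_normD _ _)).
  by rewrite !normrM; apply: lerD; rewrite ler_wpM2r ?mulr_ge0.
set v := a * _ + _ in hv *.
have h1 : expR `|v| <= expR (c * x ^+ 2) * (expR (c * y ^+ 2) * expR (c * z ^+ 2)).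
  rewrite -!expRD ler_expR -!mulrDr; apply: (le_trans hv).
  apply: ler_pM => //.
  rewrite -[x ^+ 2]real_normK ?num_real// -[y ^+ 2]real_normK ?num_real// -[z ^+ 2]real_normK ?num_real//.
  have : 0 <= (`|x| - `|y|) ^+ 2 by exact: sqr_ge0.
  have : 0 <= (`|x| - `|z|) ^+ 2 by exact: sqr_ge0.
  move: `|x| `|y| `|z| x0 y0 z0 => p q r *; nra.
have h2 : `|v| ^+ 3 <= 8 * th ^+ 3 * ((1 + x ^+ 2) ^+ 2 * ((1 + y ^+ 2) ^+ 2 * (1 + z ^+ 2) ^+ 2)).
  apply: (@le_trans _ _ ((th * (`|x| * (`|y| + `|z|))) ^+ 3)).
    by rewrite lerXn2r ?nnegrE ?mulr_ge0 ?addr_ge0.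
  rewrite !exprMn (mulrC 8) -[leRHS]mulrA ler_wpM2l ?exprn_ge0//.
  rewrite [leRHS]mulrCA; apply: ler_pM; rewrite ?exprn_ge0 ?addr_ge0//; first exact: norm3_le_sqr.
  have hy := norm3_le_sqr y; have hz := norm3_le_sqr z.
  have A1 : 1 <= (1 + y ^+ 2) ^+ 2 by rewrite exprn_ege1// lerDl sqr_ge0.
  have B1 : 1 <= (1 + z ^+ 2) ^+ 2 by rewrite exprn_ege1// lerDl sqr_ge0.
  have : (`|y| + `|z|) ^+ 3 <= 4 * (`|y| ^+ 3 + `|z| ^+ 3).
    have : 0 <= (`|y| - `|z|) ^+ 2 * (`|y| + `|z|) by rewrite mulr_ge0 ?sqr_ge0 ?addr_ge0.
    by move: `|y| `|z| y0 z0 => q r *; nra.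
  move: hy hz A1 B1; move: ((1 + y ^+ 2) ^+ 2) ((1 + z ^+ 2) ^+ 2) (`|y| ^+ 3) (`|z| ^+ 3) => A B q r *; nra.
rewrite [leRHS](_ : _ = (8 * th ^+ 3 * ((1 + x ^+ 2) ^+ 2 * ((1 + y ^+ 2) ^+ 2 * (1 + z ^+ 2) ^+ 2))) *
  (expR (c * x ^+ 2) * (expR (c * y ^+ 2) * expR (c * z ^+ 2)))); last by ring.
by apply: ler_pM => //; rewrite ?exprn_ge0 ?expR_ge0.
Qed.

Lemma Ex_triple_exp : Ex (fun w => triple_weight w * expR (triple_value w)) <=
  1 + 2 * th * eps + th ^+ 2 * (1 + 5 * eps) + 8 * th ^+ 3 * K ^+ 3.
Proof.
pose m0 := E1 chi; pose m1 := E1 trunc; pose m2 := E1 (fun z => trunc z ^+ 2).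
pose f1 w := trunc (Z i w) * (trunc (Z j w) * chi (Z k w)).
pose f2 w := trunc (Z i w) * (chi (Z j w) * trunc (Z k w)).
pose g1 w := trunc (Z i w) ^+ 2 * (trunc (Z j w) ^+ 2 * chi (Z k w)).
pose g2 w := trunc (Z i w) ^+ 2 * (chi (Z j w) * trunc (Z k w) ^+ 2).
pose g3 w := trunc (Z i w) ^+ 2 * (trunc (Z j w) * trunc (Z k w)).
pose h w := H (Z i w) * (H (Z j w) * H (Z k w)).
have b3 (p q r : R -> R) : bmeas p -> bmeas q -> bmeas r -> bmeas (fun w => p (Z i w) * (q (Z j w) * r (Z k w))).
  by move=> bp bq br; apply: bmeasM; [exact: (bmeas_Zv X mzf i bp)|apply: bmeasM; [exact: (bmeas_Zv X mzf j bq)|exact: (bmeas_Zv X mzf k br)]].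
have E3 (p q r : R -> R) : bmeas p -> bmeas q -> bmeas r -> Ex (fun w => p (Z i w) * (q (Z j w) * r (Z k w))) = E1 p * (E1 q * E1 r).
  exact: (Ex_Zv3 Xind Xid mzf ij ik jk).
have bw : bmeas triple_weight by exact: (b3 _ _ _ bchi bchi bchi).
have bf1 : bmeas f1 by exact: (b3 _ _ _ btr btr bchi). have bf2 : bmeas f2 by exact: (b3 _ _ _ btr bchi btr).
have bg1 : bmeas g1 by exact: (b3 _ _ _ btr2 btr2 bchi). have bg2 : bmeas g2 by exact: (b3 _ _ _ btr2 bchi btr2).
have bg3 : bmeas g3 by exact: (b3 _ _ _ btr2 btr btr). have bh : bmeas h by exact: (b3 _ _ _ bH bH bH).
have bc q (f : T -> R) : bmeas f -> bmeas (fun w => q * f w).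
  by move=> bf; apply: bmeasM => //; exact: bmeas_cst.
have bv : bmeas triple_value.
  by apply: bmeasD; apply: bc; apply: bmeasM; exact: (bmeas_Zv X mzf _ btr).
have s1 := bmeasD bw (bc a _ bf1).
have s2 := bmeasD s1 (bc b _ bf2).
have s3 := bmeasD s2 (bc (a ^+ 2 / 2) _ bg1).
have s4 := bmeasD s3 (bc (b ^+ 2 / 2) _ bg2).
have s5 := bmeasD s4 (bc (a * b) _ bg3).
have := Ex_close (bmeasM bw (bmeas_expR bv)) s5 (bc (8 * th ^+ 3) _ bh).
rewrite (ExD P s4 (bc _ _ bg3)) (ExD P s3 (bc _ _ bg2)) (ExD P s2 (bc _ _ bg1)).
rewrite (ExD P s1 (bc _ _ bf2)) (ExD P bw (bc _ _ bf1)).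
have Eg1 : Ex g1 = m2 * (m2 * m0) by exact: (E3 _ _ _ btr2 btr2 bchi).
have Eg2 : Ex g2 = m2 * (m0 * m2) by exact: (E3 _ _ _ btr2 bchi btr2).
have Eg3 : Ex g3 = m2 * (m1 * m1) by exact: (E3 _ _ _ btr2 btr btr).
rewrite !ExZ// !E3// Eg1 Eg2 Eg3 -/m0 -/m1 => cl.
have {}cl : `|\int[P]_w (triple_weight w * expR (triple_value w)) -
   (m0 * (m0 * m0) + a * (m1 * (m1 * m0)) + b * (m1 * (m0 * m1)) +
    a ^+ 2 / 2 * (m2 * (m2 * m0)) + b ^+ 2 / 2 * (m2 * (m0 * m2)) + a * b * (m2 * (m1 * m1)))|
   <= 8 * th ^+ 3 * (E1 H * (E1 H * E1 H)).
  apply: cl => w; apply: le_trans (triple_rem_le w).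
  rewrite (_ : _ - _ = triple_weight w * (expR (triple_value w) - 1 - triple_value w - triple_value w ^+ 2 / 2)).
    have p0 : 0 <= triple_weight w by rewrite !mulr_ge0 ?chi_ge0.
    by rewrite normrM (ger0_norm p0) ler_wpM2l// expR_taylor2.
  rewrite /triple_value /triple_weight /f1 /f2 /g1 /g2 /g3.
  have := chi_trunc tau (Z i w); have := chi_trunc tau (Z j w); have := chi_trunc tau (Z k w).
  set x := trunc (Z i w); set y := trunc (Z j w); set z := trunc (Z k w).
  move: (chi (Z i w)) (chi (Z j w)) (chi (Z k w)) (expR _) => p q r e hz hy hx.
  have exy : p * (q * r) * (x * y) = x * (y * r) by rewrite -{2}hx -{2}hy; ring.
  have exz : p * (q * r) * (x * z) = x * (q * z) by rewrite -{2}hx -{2}hz; ring.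
  rewrite [RHS](_ : _ = p * (q * r) * e - p * (q * r) - a * (p * (q * r) * (x * y)) - b * (p * (q * r) * (x * z))
    - a ^+ 2 / 2 * ((p * (q * r) * (x * y)) * (x * y)) - b ^+ 2 / 2 * ((p * (q * r) * (x * z)) * (x * z))
    - a * b * ((p * (q * r) * (x * y)) * (x * z))).
    rewrite exy exz.
    have -> : a * b * (x * (y * r) * (x * z)) = a * b * (x ^+ 2 * (y * (r * z))) by ring.
    by rewrite hz; field.
  by field.
move: cl; set y := Rintegral _ _ _ => cl.
have e0 : 0 <= eps by case/andP: eps01.
have e1 : eps <= 1 by case/andP: eps01.
have ma0 : 0 <= m0 by exact: E1_chi_ge0. have ma1 : m0 <= 1 by exact: E1_chi_le1.
have M1 : `|m1| <= eps by exact: m1_close.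
have M2 : `|m2 - 1| <= eps by exact: m2_close.
have H0 := E1_H_ge0.
have cH : 8 * th ^+ 3 * (E1 H * (E1 H * E1 H)) <= 8 * th ^+ 3 * K ^+ 3.
  rewrite ler_wpM2l ?mulr_ge0 ?exprn_ge0// !exprS expr0 mulr1.
  by apply: ler_pM; rewrite ?mulr_ge0//; apply: ler_pM.
have m11 : `|m1 * m1| <= eps.
  by rewrite normrM -[leRHS]mulr1; apply: ler_pM => //; exact: le_trans e1.
have A1 : `|a * (m1 * (m1 * m0))| <= th * eps.
  rewrite normrM; apply: ler_pM => //; rewrite mulrA normrM -[leRHS]mulr1.
  by apply: ler_pM => //; rewrite ger0_norm.
have A2 : `|b * (m1 * (m0 * m1))| <= th * eps.
  rewrite normrM; apply: ler_pM => //; rewrite (mulrC m0) mulrA normrM -[leRHS]mulr1.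
  by apply: ler_pM => //; rewrite ger0_norm.
have m20 : 0 <= m2 by move: M2; rewrite ler_norml => /andP[? ?]; lra.
have m21 : m2 <= 1 + eps by move: M2; rewrite ler_norml => /andP[? ?]; lra.
have sq q : `|q| <= th -> q ^+ 2 <= th ^+ 2.
  by move=> qt; rewrite -real_normK ?num_real// lerXn2r ?nnegrE.
have B0 : m2 * (m2 * m0) <= 1 + 3 * eps.
  rewrite mulrA; apply: (@le_trans _ _ ((1 + eps) * (1 + eps) * 1)).
    by apply: ler_pM; rewrite ?mulr_ge0//; apply: ler_pM.
  by nra.
have B1 : a ^+ 2 / 2 * (m2 * (m2 * m0)) <= th ^+ 2 / 2 * (1 + 3 * eps).
  apply: ler_pM => //; [by rewrite divr_ge0 ?sqr_ge0|by rewrite !mulr_ge0|].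
  by rewrite ler_pM2r ?invr_gt0// sq.
have B2 : b ^+ 2 / 2 * (m2 * (m0 * m2)) <= th ^+ 2 / 2 * (1 + 3 * eps).
  rewrite (mulrC m0); apply: ler_pM => //; [by rewrite divr_ge0 ?sqr_ge0|by rewrite !mulr_ge0|].
  by rewrite ler_pM2r ?invr_gt0// sq.
have B3 : `|a * b * (m2 * (m1 * m1))| <= th ^+ 2 * (2 * eps).
  rewrite normrM; apply: ler_pM => //; first by rewrite normrM expr2; apply: ler_pM.
  rewrite normrM; apply: ler_pM => //; rewrite ger0_norm//; lra.
have B4 : m0 * (m0 * m0) <= 1 by rewrite !mulr_ile1 ?mulr_ge0.
move: cl A1 A2 B3; rewrite !ler_norml => /andP[_ ?] /andP[_ ?] /andP[_ ?] /andP[_ ?].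
by lra.
Qed.

End triple.
End moments.

Section exp_integrals.
Context {R : realType}.
Local Notation mu := (@lebesgue_measure R).
Implicit Types a b y : R.

Let F b y : R := - b^-1 * expR (- (b * y)).

Let dF b y : b != 0 -> is_derive (y : R^o) (1 : R^o) (F b : R^o -> R^o) (expR (- (b * y))).
Proof.
move=> b0.
have h1 := is_deriveZ (- b) (is_derive_id (y : R^o) (1 : R^o)).
have h2 := is_derive1_comp (is_derive_expR ((- b \*: @id R^o) y)) h1.
have h3 := @is_deriveZ _ R^o R^o _ (- b^-1) _ _ _ h2.
rewrite (_ : F b = - b^-1 \*: (expR \o (- b \*: @id R^o))); last first.
  by apply/funext => z; rewrite /F /= /GRing.scale /= (mulNr b z).
have e : - b^-1 *: (expR ((- b \*: @id R^o) y) * (- b)%:A : R^o) = expR (- (b * y)).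
  by rewrite /= /GRing.scale/= mulr1 (mulNr b y) mulNr mulrN mulrN opprK mulrCA (mulVf b0) mulr1.
by rewrite e in h3.
Qed.

Let dFE b : b != 0 -> (F b)^`()%classic = (fun y => expR (- (b * y))).
Proof. by move=> b0; apply/funext => y; rewrite derive1E; have h := dF y b0; rewrite derive_val. Qed.

Let cf b : continuous (fun y : R => expR (- (b * y))).
Proof.
move=> y; apply: (@continuous_comp _ _ _ (fun y : R => - (b * y)) expR); last exact: continuous_expR.
apply: (@continuous_comp _ _ _ (fun y : R => b * y) -%R); last exact: opp_continuous.
exact: mulrl_continuous.
Qed.

Let cF b : continuous (F b).
Proof. by move=> y; apply: cvgM; [exact: cvg_cst|exact: cf]. Qed.

Lemma integral_expRN_y a b : 0 < b ->
  (\int[mu]_(y in `[a, +oo[) (expR (- (b * y)))%:E = (b^-1 * expR (- (b * a)))%:E)%E.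
Proof.
move=> b0; have bn0 : b != 0 by rewrite gt_eqF.
rewrite (@ge0_continuous_FTC2y _ _ (F b) a 0).
- by rewrite -EFinB sub0r /F mulNr opprK.
- by move=> y _; exact: expR_ge0.
- by apply: continuous_subspaceT; exact: cf.
- rewrite -(mulr0 (- b^-1)); apply: cvgM; first exact: cvg_cst.
  apply: (@cvg_comp _ _ _ (fun y => b * y) (fun z => expR (- z))); last exact: cvgr_expR.
  by apply: gt0_cvgMry => //; exact: cvg_id.
- by move=> y _; have [] := dF y bn0.
- by apply: cvg_at_right_filter; exact: cF.
- by move=> y _; rewrite dFE.
Qed.

Lemma integral_expR_Ny a b : 0 < b ->
  (\int[mu]_(y in `]-oo, a]) (expR (b * y))%:E = (b^-1 * expR (b * a))%:E)%E.
Proof.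
move=> b0; have := integral_expRN_y (- a) b0; rewrite mulrN opprK => <-.
rewrite -{1}[a]opprK ge0_integration_by_substitutionNy.
- by apply: eq_integral => y _ /=; rewrite mulrN.
- apply: continuous_subspaceT => y.
  apply: (@continuous_comp _ _ _ (fun y : R => b * y) expR); last exact: continuous_expR.
  exact: mulrl_continuous.
- by move=> y _; exact: expR_ge0.
Qed.

Lemma integral_expRN a c b : 0 < b -> a < c ->
  (\int[mu]_(y in `[a, c]) (expR (- (b * y)))%:E =
  (b^-1 * (expR (- (b * a)) - expR (- (b * c))))%:E)%E.
Proof.
move=> b0 ac; have bn0 : b != 0 by rewrite gt_eqF.
rewrite (@continuous_FTC2 _ _ (F b))//.
- by rewrite -EFinB; congr EFin; rewrite /F; ring.
- by apply: continuous_subspaceT; exact: cf.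
- split; first by move=> y _; have [] := dF y bn0.
  + by apply: cvg_at_right_filter; exact: cF.
  + by apply: cvg_at_left_filter; exact: cF.
- by move=> y _; rewrite dFE.
Qed.

End exp_integrals.

Section gauss_tail.
Context {R : realType}.
Local Notation mu := (@lebesgue_measure R).
Implicit Types x y m L B M : R.

Lemma phi_upper x y : phi y <= phi x * expR (- (x * (y - x))).
Proof.
rewrite !phiE -mulrA ler_wpM2l ?invr_ge0// -expRD ler_expR.
have : 0 <= (y - x) ^+ 2 by exact: sqr_ge0.
nra.
Qed.

Lemma phi_lower x y B : `|x * (y - x)| <= B -> 0 < x ->
  phi x * expR (- (x * (y - x))) * (1 - B ^+ 2 / (2 * x ^+ 2)) <= phi y.
Proof.
move=> hB x0; rewrite !phiE -(mulrA (_^-1)) -expRD -mulrA ler_wpM2l ?invr_ge0//.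
have -> : - y ^+ 2 / 2 = (- x ^+ 2 / 2 - x * (y - x)) - (y - x) ^+ 2 / 2 by field.
rewrite [leRHS]expRD ler_wpM2l ?expR_ge0//.
apply: le_trans (expR_ge1Dx _); rewrite lerD2l lerN2.
have x20 : 0 < x ^+ 2 by exact: exprn_gt0.
have : (x * (y - x)) ^+ 2 <= B ^+ 2.
  by rewrite -real_normK ?num_real// lerXn2r ?nnegrE// (le_trans _ hB).
rewrite exprMn => h; rewrite invfM mulrA ler_pdivlMr// mulrC.
lra.
Qed.

(* min (1, e^(L v)) dominates the logistic function of L v, and phi has
   log-derivative -x at x. *)
Lemma gsmooth_upper x m L : 0 < x -> 1 < L ->
  gsmooth (L * x) (- (L * (x ^+ 2 + m))) <= phi x / x * expR (- m) * (1 + (L - 1)^-1).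
Proof.
move=> x0 L1; rewrite -lee_fin EFin_gsmooth.
have L10 : 0 < L - 1 by rewrite subr_gt0.
pose a := x + m / x.
pose g1 y := phi x * expR (x ^+ 2) * expR (- (x * y)).
pose C := phi x * expR (x ^+ 2 - L * (x ^+ 2 + m)).
pose g2 y := C * expR ((L - 1) * x * y).
have b0 : 0 < (L - 1) * x by exact: mulr_gt0.
have ge1 y : (0 <= (g1 y)%:E)%E by rewrite lee_fin !mulr_ge0 ?phi_ge0 ?expR_ge0.
have ge2 y : (0 <= (g2 y)%:E)%E by rewrite lee_fin !mulr_ge0 ?phi_ge0 ?expR_ge0.
have me b : measurable_fun setT (fun y : R => expR (b * y)).
  by apply: measurableT_comp; [exact: measurable_expR|exact: measurable_funM].
have meN b : measurable_fun setT (fun y : R => expR (- (b * y))).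
  by under eq_fun do rewrite -mulNr; exact: me.
apply: (@le_trans _ _ (\int[mu]_(y in `[a, +oo[) (g1 y)%:E + \int[mu]_(y in `]-oo, a]) (g2 y)%:E)%E).
  pose G1 := ((fun y => (g1 y)%:E) \_ `[a, +oo[)%E; pose G2 := ((fun y => (g2 y)%:E) \_ `]-oo, a])%E.
  have G10 y : (0 <= G1 y)%E by rewrite /G1 patchE; case: ifP.
  have G20 y : (0 <= G2 y)%E by rewrite /G2 patchE; case: ifP.
  have mG1 : measurable_fun setT G1.
    apply/(measurable_restrictT _ _).1 => //; apply/measurable_EFinP; apply: measurable_funTS.
    by apply: measurable_funM => //; exact: meN.
  have mG2 : measurable_fun setT G2.
    apply/(measurable_restrictT _ _).1 => //; apply/measurable_EFinP; apply: measurable_funTS.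
    by apply: measurable_funM => //; exact: me.
  rewrite [X in (_ <= X + _)%E]integral_mkcond [X in (_ <= _ + X)%E]integral_mkcond -/G1 -/G2 -ge0_integralD//.
  apply: ge0_le_integral => //.
  - by move=> y _; rewrite lee_fin mulr_ge0 ?phi_ge0// ltW// logistic_gt0.
  - apply/measurable_EFinP; apply: measurable_funM; first exact: measurable_phi.
    exact: measurable_logistic_affine.
  - exact: emeasurable_funD.
  move=> y _; have hu := phi_upper x y.
  have eg1 : phi x * expR (- (x * (y - x))) = g1 y.
    by rewrite /g1 -mulrA -expRD; congr (_ * expR _); ring.
  have [ay|ya] := leP a y.
    apply: (@le_trans _ _ (G1 y)); last by rewrite leeDl.
    rewrite /G1 patchE mem_set/=; last by rewrite in_itv/= ay.
    rewrite lee_fin -eg1 -[leRHS]mulr1; apply: ler_pM; rewrite ?phi_ge0 ?(ltW (logistic_gt0 _))//.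
    exact: logistic_le1.
  apply: (@le_trans _ _ (G2 y)); last by rewrite leeDr.
  rewrite /G2 patchE mem_set/=; last by rewrite in_itv/= ltW.
  rewrite lee_fin.
  have -> : g2 y = g1 y * expR (- (L * (x ^+ 2 + m)) + L * x * y).
    by rewrite /g2 /C /g1 -!mulrA -!expRD; congr (_ * expR _); ring.
  by rewrite -eg1; apply: ler_pM; rewrite ?phi_ge0 ?(ltW (logistic_gt0 _))// logistic_le_exp.
rewrite /g1 /g2; under eq_integral do rewrite EFinM.
rewrite ge0_integralZl//=; [|by apply/measurable_EFinP; apply: measurable_funTS; exact: meN|by rewrite lee_fin mulr_ge0 ?phi_ge0 ?expR_ge0].
under [X in (_ + X)%E]eq_integral do rewrite EFinM.
rewrite ge0_integralZl//=; [|by apply/measurable_EFinP; apply: measurable_funTS; exact: me|by rewrite lee_fin mulr_ge0 ?phi_ge0 ?expR_ge0].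
rewrite integral_expRN_y// integral_expR_Ny// -!EFinM -EFinD lee_fin.
have xa : x * a = x ^+ 2 + m by rewrite /a; field; rewrite gt_eqF.
have p0 := phi_ge0 x.
have e1 : expR (x ^+ 2) * expR (- (x * a)) = expR (- m).
  by rewrite -expRD xa; congr expR; ring.
have e2 : expR (x ^+ 2 - L * (x ^+ 2 + m)) * expR ((L - 1) * x * a) = expR (- m).
  by rewrite -expRD -(mulrA (L - 1)) xa; congr expR; ring.
rewrite /C [leLHS](_ : _ = phi x / x * (expR (x ^+ 2) * expR (- (x * a)))
  + phi x / x * (L - 1)^-1 * (expR (x ^+ 2 - L * (x ^+ 2 + m)) * expR ((L - 1) * x * a))).
  by rewrite e1 e2 le_eqVlt; apply/orP; left; apply/eqP; ring.
by field; rewrite !gt_eqF.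
Qed.

Lemma gsmooth_lower x m L M B : 0 < x -> 0 < L -> `|m + M / L| < B ->
  B ^+ 2 <= 2 * x ^+ 2 ->
  phi x / x * (expR (- (m + M / L)) - expR (- B)) * (1 - B ^+ 2 / (2 * x ^+ 2)) * logistic M
  <= gsmooth (L * x) (- (L * (x ^+ 2 + m))).
Proof.
move=> x0 L0 mB Bx; rewrite -lee_fin EFin_gsmooth.
set m' := m + M / L in mB *.
pose a := x + m' / x; pose b := x + B / x.
have B0 : 0 < B by exact: le_lt_trans mB.
have m'B : m' < B by rewrite (le_lt_trans _ mB)// ler_norm.
have ab : a < b by rewrite ltrD2l ltr_pM2r ?invr_gt0.
pose k := 1 - B ^+ 2 / (2 * x ^+ 2).
have k0 : 0 <= k.
  rewrite subr_ge0 ler_pdivrMr ?mul1r// mulr_gt0// exprn_gt0//.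
pose C := phi x * expR (x ^+ 2) * k * logistic M.
have lM0 := logistic_gt0 M.
have C0 : 0 <= C by rewrite !mulr_ge0 ?phi_ge0 ?expR_ge0// ltW.
have meN : measurable_fun setT (fun y : R => expR (- (x * y))).
  apply: measurableT_comp; first exact: measurable_expR.
  by apply: measurableT_comp => //; exact: measurable_funM.
apply: (@le_trans _ _ (\int[mu]_(y in `[a, b]) (C * expR (- (x * y)))%:E)%E).
  under eq_integral do rewrite EFinM.
  rewrite ge0_integralZl//=; [|by apply/measurable_EFinP; apply: measurable_funTS; exact: meN].
  rewrite integral_expRN// -EFinM lee_fin.
  have xa : x * a = x ^+ 2 + m' by rewrite /a; field; rewrite gt_eqF.
  have xb : x * b = x ^+ 2 + B by rewrite /b; field; rewrite gt_eqF.
  rewrite xa xb !opprD !expRD /C -/k.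
  have xx : expR (x ^+ 2) * expR (- x ^+ 2) = 1 by rewrite expRN mulfV// gt_eqF ?expR_gt0.
  rewrite le_eqVlt; apply/orP; left; apply/eqP.
  rewrite -[LHS]mul1r -{1}xx; ring.
apply: (@le_trans _ _ (\int[mu]_(y in `[a, b]) (phi y * logistic (- (L * (x ^+ 2 + m)) + L * x * y))%:E)%E).
  apply: ge0_le_integral => //.
  - by move=> y _; rewrite lee_fin mulr_ge0 ?expR_ge0.
  - by apply/measurable_EFinP; apply: measurable_funTS; apply: measurable_funM => //; exact: meN.
  - apply/measurable_EFinP; apply: measurable_funTS; apply: measurable_funM; first exact: measurable_phi.
    exact: measurable_logistic_affine.
  move=> y /=; rewrite in_itv/= => /andP[ay yb]; rewrite lee_fin.
  have ay' : m' <= x * (y - x).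
    by move: ay; rewrite /a addrC -lerBrDr ler_pdivrMr// mulrC.
  have yb' : x * (y - x) <= B.
    by move: yb; rewrite /b addrC -lerBlDr ler_pdivlMr// mulrC.
  have hB : `|x * (y - x)| <= B.
    by rewrite ler_norml yb' andbT (le_trans _ ay')// lerNl; move: mB; rewrite ltr_norml => /andP[/ltW]; rewrite lerNl.
  have := phi_lower hB x0; rewrite -/k => hl.
  rewrite (_ : C * _ = (phi x * expR (- (x * (y - x))) * k) * logistic M); last first.
    rewrite /C (_ : - (x * (y - x)) = x ^+ 2 + - (x * y)); last by ring.
    by rewrite expRD; ring.
  apply: ler_pM => //.
  - by rewrite !mulr_ge0 ?phi_ge0 ?expR_ge0.
  - exact: ltW.
  rewrite /logistic lef_pV2 ?posrE ?logistic_den_gt0// lerD2l ler_expR lerN2.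
  have -> : - (L * (x ^+ 2 + m)) + L * x * y = L * (x * (y - x) - m) by ring.
  have -> : M = L * (m' - m) by rewrite /m'; field; rewrite gt_eqF.
  by rewrite ler_wpM2l ?(ltW L0)// lerD2r.
apply: ge0_subset_integral => //.
- apply/measurable_EFinP; apply: measurable_funM; first exact: measurable_phi.
  exact: measurable_logistic_affine.
- by move=> y _; rewrite lee_fin mulr_ge0 ?phi_ge0// ltW// logistic_gt0.
Qed.

End gauss_tail.

Section level_n.
Context {d : measure_display} {T : measurableType d} {R : realType}.
Context (P : probability T R) (X : nat * nat -> {RV P >-> R}).
Hypotheses (Xind : mutually_independent X) (Xid : identically_distributed X).
Local Notation Ex f := (\int[P]_w (f w)).
Variables (zf : R -> R).
Hypothesis mzf : measurable_fun setT zf.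
Local Notation Z := (Zv X zf).
Local Notation E1 := (E1 X zf).
Local Notation Pr A := (fine (P A)).

Lemma Pr_le (A : set T) (f : T -> R) : measurable A -> bmeas f ->
  (forall w, \1_A w <= f w) -> Pr A <= Ex f.
Proof.
move=> mA bf Af; rewrite -(Ex_indic P mA); apply: (Ex_le P _ bf Af).
exact: bmeas_indic.
Qed.

Lemma Pr_ge (A : set T) (f : T -> R) : measurable A -> bmeas f ->
  (forall w, f w <= \1_A w) -> Ex f <= Pr A.
Proof.
move=> mA bf Af; rewrite -(Ex_indic P mA); apply: (Ex_le P bf _ Af).
exact: bmeas_indic.
Qed.

Lemma chernoff_rows (w v : nat -> T -> R) (B q D : R) n (A : set T) :
  (forall k, meas_on X (row_set k) (w k)) -> (forall k, meas_on X (row_set k) (v k)) ->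
  (forall k x, 0 <= w k x <= 1) -> (forall k x, `|v k x| <= B) ->
  (forall k, Ex (fun x => w k x * expR (v k x)) <= 1 + q) ->
  measurable A -> (forall x, A x -> \prod_(k < n) w k x = 1 /\ D <= \sum_(k < n) v k x) ->
  Pr A <= expR (n%:R * q - D).
Proof.
move=> mw mv w01 vB wvq mA Ax.
have h := Ex_chernoff Xind mw mv w01 vB n.
have bprod := bmeas_prod mw w01 n.
have bexp : bmeas (fun x => expR (\sum_(k < n) v k x)).
  split; first by apply: measurableT_comp; [exact: measurable_expR|exact: meas_onW (@meas_on_sum _ _ _ _ X v mv n)].
  exists (expR (n%:R * B)) => x; rewrite ger0_norm ?expR_ge0// ler_expR.
  by rewrite (le_trans (ler_norm _))// (sum_bound vB).
have bf := bmeasM bprod bexp.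
apply: (@le_trans _ _ (expR (- D) * Ex (fun x => \prod_(k < n) w k x * expR (\sum_(k < n) v k x)))).
  rewrite -(ExZ P _ bf); apply: Pr_le => //; first by apply: bmeasM => //; exact: bmeas_cst.
  move=> x; rewrite indicE; have [xA|_] := boolP (x \in A); last first.
    by rewrite mulr_ge0 ?expR_ge0// mulr_ge0 ?expR_ge0//; have /andP[] := prod01 w01 n x.
  have [-> Dx] := Ax _ (set_mem xA); rewrite mul1r -expRD -expR0 ler_expR.
  by rewrite addrC subr_ge0.
rewrite addrC expRD ler_wpM2l ?expR_ge0// h mulrC expRM_natr.
rewrite -[X in _ <= _ ^+ X]card_ord -prodr_const; apply: ler_prod => k _.
rewrite Ex_ge0/=; last by move=> x; rewrite mulr_ge0 ?expR_ge0//; have /andP[] := w01 k x.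
exact: le_trans (wvq k) (expR_ge1Dx _).
Qed.

Variables (tau : R).
Hypotheses (tau0 : 0 <= tau).
Local Notation chi := (chi tau).
Local Notation trunc := (trunc tau).

Definition goodcol n (i : nat) : set T := [set w | forall k, (k < n)%N -> `|Z (k, i) w| <= tau].
Definition sum2 n (i j : nat) (w : T) : R := \sum_(k < n) Z (nat_of_ord k, i) w * Z (nat_of_ord k, j) w.

Lemma prod_chi n i w : \prod_(k < n) chi (Z (nat_of_ord k, i) w) = \1_(goodcol n i) w.
Proof.
rewrite indicE; have [/set_mem wG|/negP wG] := boolP (w \in goodcol n i).
  by rewrite big1// => k _; rewrite chiE wG.
apply/eqP/prodf_eq0.
have : ~ goodcol n i w by move=> h; apply: wG; exact/mem_set.
move=> /existsNP[k /not_implyP[kn kt]]; exists (Ordinal kn) => //=.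
by rewrite chiE; move/negP/negbTE : kt => ->.
Qed.

Lemma meas_on_chi (J : set (nat * nat)) ij : J ij -> meas_on X J (fun w => chi (Z ij w)).
Proof. by move=> Jij; apply: (meas_on_Zv mzf Jij); exact: measurable_chi. Qed.

Lemma meas_on_trunc (J : set (nat * nat)) ij : J ij -> meas_on X J (fun w => trunc (Z ij w)).
Proof. by move=> Jij; apply: (meas_on_Zv mzf Jij); exact: measurable_trunc. Qed.

Lemma measurable_Z ij : measurable_fun setT (Z ij).
Proof. exact: (measurableT_comp mzf). Qed.

Lemma measurable_goodcol n i : measurable (goodcol n i).
Proof.
have -> : goodcol n i = (fun w => \prod_(k < n) chi (Z (nat_of_ord k, i) w)) @^-1` [set 1].
  apply/seteqP; split => w /=; rewrite prod_chi indicE.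
    by move=> h; rewrite mem_set.
  by case: (boolP (w \in goodcol n i)) => [/set_mem//|_ /esym/eqP]; rewrite oner_eq0.
rewrite -[X in measurable X]setTI; apply: measurable_prod => // k _.
by apply: (measurableT_comp (measurable_chi tau)); exact: measurable_Z.
Qed.

Lemma measurable_sum2 n i j : measurable_fun setT (sum2 n i j).
Proof. by apply: measurable_sum => k; apply: measurable_funM; exact: measurable_Z. Qed.

Variables (c eps K : R).
Hypotheses (c0 : 0 <= c) (eps01 : 0 <= eps <= 1).
Hypothesis m0_close : `|E1 chi - 1| <= eps.
Hypothesis m1_close : `|E1 trunc| <= eps.
Hypothesis m2_close : `|E1 (fun z => trunc z ^+ 2) - 1| <= eps.
Hypothesis HK : E1 (majorant tau c) <= K.

Lemma Pr_goodcolC n i : Pr (~` goodcol n i) <= n%:R * eps.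
Proof.
have b1 (k : nat) : bmeas (fun w => 1 - chi (Z (k, i) w)).
  by apply: bmeasB; [exact: bmeas_cst|exact: (bmeas_Zv X mzf _ (bmeas_chi tau))].
have bs : bmeas (fun w => \sum_(k < n) (1 - chi (Z (nat_of_ord k, i) w))).
  elim: n => [|n IHn]; first by under eq_fun do rewrite big_ord0; exact: bmeas_cst.
  by under eq_fun do rewrite big_ord_recr; exact: bmeasD.
have nn k w : 0 <= 1 - chi (Z (k, i) w) by rewrite subr_ge0 chi_le1.
apply: (@le_trans _ _ (Ex (fun w => \sum_(k < n) (1 - chi (Z (nat_of_ord k, i) w))))).
  apply: Pr_le => //; first by apply: measurableC; exact: measurable_goodcol.
  move=> w; rewrite indicE; have [/set_mem wG|_] := boolP (w \in ~` goodcol n i).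
    move: wG => /existsNP[k /not_implyP[kn kt]].
    rewrite (bigD1 (Ordinal kn))//= chiE; move/negP/negbTE : kt => ->.
    by rewrite subr0 lerDl sumr_ge0.
  by rewrite sumr_ge0.
have -> : Ex (fun w => \sum_(k < n) (1 - chi (Z (nat_of_ord k, i) w))) = \sum_(k < n) (1 - E1 chi).
  elim: n {bs} => [|n IHn].
    by rewrite big_ord0; under eq_Rintegral do rewrite big_ord0; rewrite Ex_cst.
  rewrite big_ord_recr/=; under eq_Rintegral do rewrite big_ord_recr/=.
  rewrite ExD//; last first.
    elim: n {IHn} => [|n IHn]; first by under eq_fun do rewrite big_ord0; exact: bmeas_cst.
    by under eq_fun do rewrite big_ord_recr; exact: bmeasD.
  rewrite IHn ExB; [|exact: bmeas_cst|exact: (bmeas_Zv X mzf _ (bmeas_chi tau))].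
  by rewrite Ex_cst (Ex_Zv1 Xid mzf _ (bmeas_chi tau)).
rewrite sumr_const card_ord mulr_natl lerMn2r; apply/orP; right.
by move: m0_close; rewrite ler_norml => /andP[? ?]; lra.
Qed.

Lemma Pr_column_sum n i (g : R -> R) (b q D : R) :
  `|b| <= 1 -> `|b| <= c -> bmeas g -> (forall z, `|z| <= tau -> `|g z| <= 1 + z ^+ 2) ->
  `|E1 (fun z => chi z * g z)| <= q ->
  Pr (goodcol n i `&` [set w | D <= b * \sum_(k < n) g (Z (nat_of_ord k, i) w)])
  <= expR (n%:R * (`|b| * q + expR 1 * K * b ^+ 2) - D).
Proof.
move=> b1 bc bg gb gq; have [mg [M gM]] := bg.
apply: (@chernoff_rows (fun k w => chi (Z (k, i) w)) (fun k w => b * g (Z (k, i) w)) (`|b| * M)).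
- by move=> k; exact: meas_on_chi.
- move=> k; apply: measurable_funM => //; exact: (meas_on_Zv mzf (J := row_set k) (ij := (k, i)) erefl mg).
- by move=> k x; exact: chi01.
- by move=> k x; rewrite normrM ler_wpM2l.
- move=> k; have := Ex_single_exp Xid mzf tau0 c0 HK (k, i) b1 bc bg gb.
  by move=> /le_trans; apply; rewrite -addrA lerD2l lerD2r ler_wpM2l.
- apply: measurableI; first exact: measurable_goodcol.
  rewrite -[X in measurable X]setTI.
  have : measurable_fun setT (fun w => b * \sum_(k < n) g (Z (nat_of_ord k, i) w)).
    apply: measurable_funM => //; apply: measurable_sum => k.
    exact: (measurableT_comp mg (measurable_Z _)).
  move=> /(_ measurableT `[D, +oo[%classic) h.
  rewrite (_ : [set w | _] = (fun w => b * \sum_(k < n) g (Z (nat_of_ord k, i) w)) @^-1` `[D, +oo[%classic).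
    exact: h.
  by apply/seteqP; split => w /=; rewrite in_itv/= andbT.
- move=> w [wG wD]; split; first by rewrite prod_chi indicE mem_set.
  by move: wD; rewrite /= mulr_sumr.
Qed.

Lemma Pr_triple n i j k (s1 s2 b D : R) : i != j -> i != k -> j != k ->
  `|s1| = 1 -> `|s2| = 1 -> 0 <= b -> b <= c ->
  Pr [set w | [/\ goodcol n i w, goodcol n j w, goodcol n k w,
                  D <= s1 * sum2 n i j w & D <= s2 * sum2 n i k w]]
  <= expR (n%:R * (2 * b * eps + b ^+ 2 * (1 + 5 * eps) + 8 * b ^+ 3 * K ^+ 3) - 2 * b * D).
Proof.
move=> ij ik jk s11 s21 b0 bc.
have as1 : `|s1 * b| <= b by rewrite normrM s11 mul1r ger0_norm.
have as2 : `|s2 * b| <= b by rewrite normrM s21 mul1r ger0_norm.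
have tb ij' w := trunc_le tau0 (Z ij' w).
apply: (@chernoff_rows (fun l => triple_weight X zf tau (l, i) (l, j) (l, k))
  (fun l => triple_value X zf tau (l, i) (l, j) (l, k) (s1 * b) (s2 * b)) (b * (tau * tau) + b * (tau * tau))).
- by move=> l; apply: measurable_funM; [|apply: measurable_funM]; exact: meas_on_chi.
- move=> l; apply: measurable_funD; apply: measurable_funM => //; apply: measurable_funM;
  exact: meas_on_trunc.
- move=> l w; rewrite /triple_weight !mulr_ge0 ?chi_ge0//= !mulr_ile1 ?mulr_ge0 ?chi_ge0 ?chi_le1//.
- move=> l w; apply: (le_trans (ler_normD _ _)).
  by apply: lerD; rewrite normrM; apply: ler_pM => //; rewrite normrM; apply: ler_pM.
- move=> l; have nij (p q : nat) : p != q -> (l, p) != (l, q) by rewrite xpair_eqE eqxx.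
  have := Ex_triple_exp Xind Xid mzf tau0 c0 eps01 m1_close m2_close HK
    (nij _ _ ij) (nij _ _ ik) (nij _ _ jk) as1 as2 bc.
  by rewrite -!addrA.
- have mge s i' j' : measurable [set w | D <= s * sum2 n i' j' w].
    have h : measurable_fun setT (fun w => s * sum2 n i' j' w).
      by apply: measurable_funM => //; exact: measurable_sum2.
    have := h measurableT `[D, +oo[%classic (measurable_itv _); rewrite setTI; congr measurable.
    by apply/seteqP; split => w /=; rewrite in_itv/= andbT.
  rewrite (_ : [set w | _] = goodcol n i `&` goodcol n j `&` goodcol n k `&`
    [set w | D <= s1 * sum2 n i j w] `&` [set w | D <= s2 * sum2 n i k w]).
    by do 4 ?apply: measurableI => //; exact: measurable_goodcol.
  by apply/seteqP; split => w /= => [[]|[[[[]]]]].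
- move=> w [wi wj wk Dj Dk]; split.
    under eq_bigr do rewrite /triple_weight.
    by rewrite !big_split/= !prod_chi !indicE !mem_set// !mulr1.
  rewrite (_ : \sum_(l < n) _ = s1 * b * sum2 n i j w + s2 * b * sum2 n i k w); last first.
    rewrite /sum2 !mulr_sumr -big_split/=; apply: eq_bigr => l _.
    by rewrite /triple_value !trunc_id ?wi ?wj ?wk.
  have -> : 2 * b * D = b * D + b * D by ring.
  by rewrite (mulrC s1) (mulrC s2) -!mulrA; apply: lerD; rewrite ler_wpM2l.
Qed.

Section moderate_deviations.
Variables (n i j : nat) (s x L : R).
Hypotheses (n0 : (0 < n)%N) (ij : i != j) (s1 : `|s| = 1) (x0 : 0 < x) (L1 : 1 < L).
Definition md_th : R := L * x / Num.sqrt n%:R.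
Definition md_delta : R := 12 * (6 * eps + (K ^+ 2 + 1) * md_th ^+ 3) + 2 * (gauss_cst * md_th ^+ 3).
Local Notation th := md_th.
Local Notation delta := md_delta.
Hypotheses (thc : gauss_cst * th <= 1 / 4) (thc' : 5 * th <= 2 * c) (delta1 : delta <= 1).

Let L0 : 0 < L. Proof. exact: lt_trans L1. Qed.
Let th0 : 0 <= th. Proof. by rewrite divr_ge0 ?sqrtr_ge0// mulr_ge0// ltW. Qed.
Let sn0 : 0 < Num.sqrt n%:R :> R. Proof. by rewrite sqrtr_gt0 ltr0n. Qed.

Let delta_ge0 : 0 <= 1 + delta.
Proof.
have C0 : 0 <= gauss_cst :> R by exact: le_trans (@gauss_cst_ge54 R).
have t30 : 0 <= th ^+ 3 by exact: exprn_ge0.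
have e0 : 0 <= eps by case/andP: eps01.
have K0 : 0 <= K ^+ 2 + 1 by rewrite addr_ge0 ?sqr_ge0.
by repeat (apply: addr_ge0 => // || apply: mulr_ge0 => //).
Qed.

Let G := goodcol n i `&` goodcol n j.
Let mG : measurable G. Proof. by apply: measurableI; exact: measurable_goodcol. Qed.

Lemma pair_lindeberg u :
  (1 - delta) ^+ n * gsmooth (L * x) u <=
    Ex (fun w => \1_G w * logistic (u + s * th * sum2 n i j w))
  <= (1 + delta) ^+ n * gsmooth (L * x) u.
Proof.
pose a := s * th.
have an : `|a| = th by rewrite /a normrM s1 mul1r ger0_norm.
have C54 := @gauss_cst_ge54 R.
have th1 : th <= 1 by have := ler_wpM2r th0 C54; move: thc; set y := gauss_cst * th; lra.
have a1 : `|a| <= 1 by rewrite an.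
have ac : 5 * `|a| <= 2 * c by rewrite an.
pose wt k := pair_weight X zf tau (k, i) (k, j).
pose vl k := pair_value X zf tau (k, i) (k, j) a.
have e0 : 0 <= eps by case/andP: eps01.
have rij (k : nat) : (k, i) != (k, j) by rewrite xpair_eqE eqxx.
have -> : Ex (fun w => \1_G w * logistic (u + s * th * sum2 n i j w)) =
    Ex (fun w => \prod_(k < n) wt k w * gsmooth 0 (u + \sum_(k < n) vl k w)).
  apply: eq_Rintegral => w _; rewrite gsmooth0 /wt /pair_weight big_split/= !prod_chi.
  rewrite -[\1_(goodcol n i) w * _]/((\1_(goodcol n i) \* \1_(goodcol n j)) w) -indicI.
  rewrite indicE; have [/set_mem[wi wj]|_] := boolP (w \in G); last by rewrite !mul0r.
  congr (_ * logistic (_ + _)); rewrite /sum2 mulr_sumr; apply: eq_bigr => k _.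
  by rewrite /vl /pair_value !trunc_id ?wi ?wj.
have K30 : 0 <= (K ^+ 2 + 1) * th ^+ 3 by rewrite mulr_ge0 ?exprn_ge0// addr_ge0 ?sqr_ge0.
have t30 : 0 <= th ^+ 3 by exact: exprn_ge0.
have aE : a ^+ 2 / 2 = th ^+ 2 / 2 by rewrite -an real_normK ?num_real.
apply: (lindeberg_rows (X := X) Xind (w := wt) (v := vl) (B := tau * tau) _ _ _ _ (th := th)
  (eps := 6 * eps + (K ^+ 2 + 1) * th ^+ 3)) => //.
- by move=> k; apply: measurable_funM; exact: meas_on_chi.
- by move=> k; apply: measurable_funM => //; apply: measurable_funM; exact: meas_on_trunc.
- by move=> k w; rewrite /wt /pair_weight mulr_ge0 ?chi_ge0//= mulr_ile1 ?chi_ge0 ?chi_le1.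
- move=> k w; rewrite /vl /pair_value normrM an -[leRHS]mul1r; apply: ler_pM => //.
  by rewrite normrM; apply: ler_pM; rewrite ?trunc_le.
- move=> k; have h := Ex_pair_weight Xind Xid mzf m0_close (rij k).
  apply: le_trans h _.
  have : 3 * eps <= 6 * eps by rewrite ler_wpM2r// ler_nat.
  by lra.
- by move=> k; have := Ex_pair_exp Xind Xid mzf tau0 c0 eps01 m0_close m1_close m2_close HK (rij k) a1 ac; rewrite an aE.
- move=> k; rewrite (_ : (fun x => wt k x * expR (- vl k x)) =
    (fun x => pair_weight X zf tau (k, i) (k, j) x * expR (pair_value X zf tau (k, i) (k, j) (- a) x))).
    have := @Ex_pair_exp _ _ _ _ _ Xind Xid _ mzf _ _ _ _ tau0 c0 eps01 m0_close m1_close m2_close HK _ _ (- a) (rij k).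
    by rewrite normrN sqrrN an aE; apply.
  by apply/funext => w; rewrite /vl /pair_value mulNr.
- move=> k; apply: (le_trans (Ex_pair_rem3 Xind Xid mzf tau0 c0 HK (rij k) ac)); rewrite an.
  by lra.
- by rewrite mulr_ge0// ltW.
- rewrite expr0n add0r /md_th expr_div_n sqr_sqrtr ?ler0n//.
  by rewrite mulrCA divff ?mulr1// pnatr_eq0 -lt0n.
Qed.

Definition md_event (y : R) : set T := G `&` [set w | Num.sqrt n%:R * y < s * sum2 n i j w].

Lemma measurable_md_event y : measurable (md_event y).
Proof.
apply: measurableI => //.
have h : measurable_fun setT (fun w => s * sum2 n i j w).
  by apply: measurable_funM => //; exact: measurable_sum2.
have := h measurableT `]Num.sqrt n%:R * y, +oo[%classic (measurable_itv _); rewrite setTI; congr measurable.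
by apply/seteqP; split => w /=; rewrite in_itv/= andbT.
Qed.

Let arg m w : R := - (L * (x ^+ 2 + m)) + s * th * sum2 n i j w.

Let arg_gt0 m w : (Num.sqrt n%:R * (x + m / x) < s * sum2 n i j w) = (0 < arg m w).
Proof.
have sE : Num.sqrt n%:R * Num.sqrt n%:R = n%:R :> R by rewrite -expr2 sqr_sqrtr.
have -> : arg m w = (s * sum2 n i j w - Num.sqrt n%:R * (x + m / x)) * th.
  rewrite /arg /md_th; field; rewrite !gt_eqF//.
rewrite pmulr_lgt0 ?subr_gt0//.
by rewrite !mulr_gt0 ?invr_gt0.
Qed.

Let bG (f : T -> R) : measurable_fun setT f -> bmeas (fun w => \1_G w * logistic (f w)).
Proof.
move=> mf; apply: bmeasM; first exact: bmeas_indic.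
split; first by apply: measurableT_comp mf; exact: measurable_logistic.
by exists 1 => w; exact: logistic_norm.
Qed.

Let marg u : measurable_fun setT (fun w => u + s * th * sum2 n i j w).
Proof. by apply: measurable_funD => //; apply: measurable_funM => //; exact: measurable_sum2. Qed.

Lemma Pr_md_upper m M : Pr (md_event (x + m / x)) <=
  (1 + expR (- M)) * ((1 + delta) ^+ n *
   (phi x / x * expR (- (m - M / L)) * (1 + (L - 1)^-1))).
Proof.
have /andP[_ hi] := pair_lindeberg (- (L * (x ^+ 2 + (m - M / L)))).
have e1 : 0 < 1 + expR (- M) by rewrite addr_gt0 ?expR_gt0.
have d0 := delta_ge0.
apply: (@le_trans _ _ ((1 + expR (- M)) * Ex (fun w => \1_G w * logistic (- (L * (x ^+ 2 + (m - M / L))) + s * th * sum2 n i j w)))); last first.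
  rewrite ler_pM2l//; apply: (le_trans hi); rewrite ler_wpM2l ?exprn_ge0//.
  exact: gsmooth_upper.
rewrite -ExZ; last exact: bG.
apply: Pr_le; first exact: measurable_md_event.
  by apply: bmeasM; [exact: bmeas_cst|exact: bG].
move=> w; rewrite indicE; have [/set_mem[wG]|_] := boolP (w \in md_event _); last first.
  by rewrite mulr_ge0 ?(ltW e1)// mulr_ge0// ltW// logistic_gt0.
rewrite /= arg_gt0 indicE (mem_set wG) mul1r => h.
have -> : - (L * (x ^+ 2 + (m - M / L))) + s * th * sum2 n i j w = arg m w + M.
  by rewrite /arg; field; rewrite gt_eqF.
rewrite /logistic ler_pdivlMr ?logistic_den_gt0// mul1r lerD2l ler_expR lerN2.
by rewrite lerDr ltW.
Qed.

Lemma Pr_md_lower m M B : `|m + 2 * M / L| < B -> B ^+ 2 <= 2 * x ^+ 2 ->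
  (1 - delta) ^+ n * (phi x / x * (expR (- (m + 2 * M / L)) - expR (- B)) *
    (1 - B ^+ 2 / (2 * x ^+ 2)) * logistic M)
  - 2 * expR (- M) * ((1 + delta) ^+ n * (phi x / x * expR (- m) * (1 + (L - 1)^-1)))
  <= Pr (md_event (x + m / x)).
Proof.
move=> mB Bx.
have /andP[lo _] := pair_lindeberg (- (L * (x ^+ 2 + (m + M / L)))).
have /andP[_ hi] := pair_lindeberg (- (L * (x ^+ 2 + m))).
have d0 := delta_ge0.
have b1 := bG (marg (- (L * (x ^+ 2 + (m + M / L))))).
have b0 := bG (marg (- (L * (x ^+ 2 + m)))).
have b2 : bmeas (fun w => 2 * expR (- M) * (\1_G w * logistic (- (L * (x ^+ 2 + m)) + s * th * sum2 n i j w))).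
  by apply: bmeasM => //; exact: bmeas_cst.
apply: (@le_trans _ _ (Ex (fun w => \1_G w * logistic (- (L * (x ^+ 2 + (m + M / L))) + s * th * sum2 n i j w)
  - 2 * expR (- M) * (\1_G w * logistic (- (L * (x ^+ 2 + m)) + s * th * sum2 n i j w))))).
  rewrite (ExB P b1 b2) (ExZ P _ b0); apply: lerB.
    apply: le_trans lo; rewrite ler_wpM2l ?exprn_ge0 ?subr_ge0//.
    have := @gsmooth_lower R x (m + M / L) L M B x0 L0.
    rewrite (_ : m + M / L + M / L = m + 2 * M / L); last by ring.
    by move=> /(_ mB Bx).
  rewrite ler_wpM2l ?mulr_ge0 ?expR_ge0//; apply: (le_trans hi).
  by rewrite ler_wpM2l ?exprn_ge0// gsmooth_upper.
apply: Pr_ge; [exact: measurable_md_event|exact: bmeasB|move=> w].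
have E : - (L * (x ^+ 2 + (m + M / L))) + s * th * sum2 n i j w = arg m w - M.
  by rewrite /arg; field; rewrite gt_eqF.
rewrite E -/(arg m w) !indicE.
have [/set_mem wG|wG] := boolP (w \in G); last by rewrite !mul0r mulr0 subr0.
rewrite !mul1r; have [wA|wA] := boolP (w \in md_event _).
  rewrite lerBlDr (le_trans (logistic_le1 _))// lerDl mulr_ge0 ?mulr_ge0 ?expR_ge0//.
  exact: ltW (logistic_gt0 _).
have a0 : arg m w <= 0.
  rewrite leNgt -arg_gt0; apply/negP => h; move/negP: wA; apply.
  by apply/mem_set; split.
rewrite subr_le0; apply: (le_trans (logistic_le_exp _)).
rewrite expRD mulrC -mulrA mulrCA ler_wpM2l ?expR_ge0//.
rewrite /logistic ler_pdivlMr ?logistic_den_gt0// mulrDr mulr1 -expRD subrr expR0.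
have -> : 2 = 1 + 1 :> R by rewrite -mulr2n.
by rewrite lerD2r -expR0 ler_expR.
Qed.

End moderate_deviations.

End level_n.

Section truncation_bounds.
Context {R : realType}.

Lemma polynomial_le_expR_powR (s alpha : R) : 0 < s -> 0 < alpha ->
  exists2 C : R, 0 < C & forall z : R, (1 + z ^+ 2) ^+ 2 <= C * expR (s * `|z| `^ alpha).
Proof.
move=> s0 a0; pose N := (Num.truncn (4 / alpha)).+1.
have N4 : 4 / alpha <= N%:R by apply: ltW; exact: truncnS_gt.
have N0 : 0 < N%:R :> R by rewrite ltr0n.
pose D := (N%:R / s) ^+ N.
have D0 : 0 <= D by rewrite exprn_ge0// divr_ge0// ltW.
exists (4 * (1 + D)) => [|z]; first by rewrite mulr_gt0// ltr_pwDl.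
have [z1|z1] := leP `|z| 1.
  have z2 : z ^+ 2 <= 1 by rewrite -real_normK ?num_real// exprn_ile1.
  have : 1 <= expR (s * `|z| `^ alpha).
    by rewrite -expR0 ler_expR mulr_ge0 ?powR_ge0// ltW.
  have : (1 + z ^+ 2) ^+ 2 <= 4.
    by rewrite (_ : 4 = 2 ^+ 2)// ?lerXn2r ?nnegrE ?addr_ge0 ?sqr_ge0//; [lra|rewrite -natrX].
  move: (expR _) => e *; nra.
set y := `|z| `^ alpha.
have y1 : 1 <= y.
  have : 1 `^ alpha <= y by rewrite ge0_ler_powR ?nnegrE ?(ltW a0) ?(ltW z1).
  by rewrite powR1.
have z4 : `|z| ^+ 4 <= y ^+ N.
  rewrite -!powR_mulrn ?powR_ge0// -powRrM; apply: ler_powR; first exact: ltW.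
  by rewrite -ler_pdivrMl// mulrC.
have yN : y ^+ N <= D * expR (s * y).
  have h : s * y / N%:R <= expR (s * y / N%:R) by rewrite (le_trans _ (expR_ge1Dx _))// lerDr.
  have : (s * y / N%:R) ^+ N <= expR (s * y / N%:R) ^+ N.
    by rewrite lerXn2r ?nnegrE ?expR_ge0// divr_ge0// mulr_ge0// ltW// (lt_le_trans _ y1).
  rewrite -expRM_natr divfK ?gt_eqF//.
  rewrite (_ : s * y / N%:R = (N%:R / s)^-1 * y); last by rewrite invf_div; ring.
  rewrite exprMn exprVn -/D mulrC ler_pdivrMr; last by rewrite exprn_gt0// divr_gt0.
  by rewrite mulrC.
have z2 : 1 <= z ^+ 2 by rewrite -[leRHS]real_normK ?num_real// exprn_ege1// ltW.
apply: (@le_trans _ _ (4 * `|z| ^+ 4)).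
  rewrite (_ : `|z| ^+ 4 = (z ^+ 2) ^+ 2); first by nra.
  by rewrite -[z ^+ 2]real_normK ?num_real// -exprM.
rewrite -mulrA ler_wpM2l//; apply: (le_trans z4); apply: (le_trans yN).
by rewrite ler_wpM2r ?expR_ge0// lerDr.
Qed.

Context {d : measure_display} {T : measurableType d}.
Context (P : probability T R).
Local Notation Ex f := (\int[P]_w (f w)).
Variables (Y : T -> R) (t alpha : R).
Hypotheses (mY : measurable_fun setT Y) (t0 : 0 < t) (a02 : 0 < alpha <= 2).
Let psi w := expR (t * `|Y w| `^ alpha).
Hypothesis ipsi : P.-integrable setT (EFin \o psi).
Hypotheses (EY : Ex Y = 0) (EY2 : Ex (fun w => Y w ^+ 2) = 1).

Lemma truncation_bounds : exists Ce K : R, 0 < Ce /\ forall tau c, 0 <= tau -> 0 <= c ->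
  c * tau `^ (2 - alpha) <= t / 2 ->
  let e := Ce * expR (- (t / 2 * tau `^ alpha)) in
  [/\ `|Ex (fun w => chi tau (Y w)) - 1| <= e,
      `|Ex (fun w => trunc tau (Y w))| <= e,
      `|Ex (fun w => trunc tau (Y w) ^+ 2) - 1| <= e &
      Ex (fun w => majorant tau c (Y w)) <= K].
Proof.
have /andP[a0 a2] := a02.
have t20 : 0 < t / 2 by rewrite divr_gt0.
have [C C0 HC] := polynomial_le_expR_powR t20 a0.
have psi0 w : 0 <= psi w by exact: expR_ge0.
pose M := Ex psi.
have M1 : 1 <= M.
  rewrite -(Ex_cst P 1); apply: le_Rintegral => //.
  - exact: bmeas_integrable (bmeas_cst 1).
  - by move=> w _; rewrite -expR0 ler_expR mulr_ge0 ?powR_ge0// ltW.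
have psiE w : expR (t / 2 * `|Y w| `^ alpha) * expR (t / 2 * `|Y w| `^ alpha) = psi w.
  by rewrite -expRD; congr expR; field.
have q1 w : 1 <= expR (t / 2 * `|Y w| `^ alpha).
  by rewrite -[leLHS]expR0 ler_expR mulr_ge0 ?powR_ge0 ?(ltW t20).
have dom (f : T -> R) : measurable_fun setT f -> (forall w, `|f w| <= C * psi w) -> P.-integrable setT (EFin \o f).
  move=> mf fC; apply: (le_integrable _ _ _ (integrableZl measurableT C ipsi)) => //.
    exact/measurable_EFinP.
  by move=> w _ /=; rewrite lee_fin (le_trans (fC w))// ler_norm.
have polyle w : (1 + Y w ^+ 2) ^+ 2 <= C * psi w.
  apply: (le_trans (HC _)); rewrite ler_wpM2l ?(ltW C0)// -psiE ler_peMl ?expR_ge0//.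
have p1 (z : R) : 1 <= (1 + z ^+ 2) ^+ 2 :> R by rewrite exprn_ege1// lerDl sqr_ge0.
have p2 (z : R) : `|z| <= (1 + z ^+ 2) ^+ 2 :> R.
  rewrite -[z ^+ 2]real_normK ?num_real//; have := normr_ge0 z; move: `|z| => y y0.
  have := sqr_ge0 (y - 1); nra.
have p3 (z : R) : z ^+ 2 <= (1 + z ^+ 2) ^+ 2 :> R by have := sqr_ge0 z; nra.
have iY : P.-integrable setT (EFin \o Y).
  by apply: (dom Y mY) => w; apply: le_trans (polyle w); exact: p2.
have iY2 : P.-integrable setT (EFin \o (fun w => Y w ^+ 2)).
  apply: (dom (fun w => Y w ^+ 2)); first exact: measurable_funX.
  by move=> w; rewrite ger0_norm ?sqr_ge0//; apply: le_trans (polyle w); exact: p3.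
exists (C * M), (C * M); split; first by rewrite mulr_gt0// (lt_le_trans _ M1).
move=> tau c tau0 c0 ct /=.
set e := C * M * _.
have tail (f g : T -> R) : P.-integrable setT (EFin \o f) -> bmeas g ->
    (forall w, `|Y w| <= tau -> f w = g w) ->
    (forall w, tau < `|Y w| -> `|g w - f w| <= (1 + Y w ^+ 2) ^+ 2) ->
    `|Ex g - Ex f| <= e.
  move=> if_ bg fg fg'; have ig := bmeas_integrable P bg.
  rewrite -(RintegralB measurableT ig if_).
  have ifg := integrableB measurableT ig if_.
  apply: (le_trans (le_normr_Rintegral measurableT ifg)).
  rewrite (_ : e = C * expR (- (t / 2 * tau `^ alpha)) * M); last by rewrite /e; ring.
  rewrite -RintegralZl//; apply: le_Rintegral => //.
  - exact: (integrable_norm ifg).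
  - exact: (integrableZl measurableT _ ipsi).
  move=> w _; have [Yt|Yt] := leP `|Y w| tau.
    by rewrite fg// subrr normr0 !mulr_ge0 ?expR_ge0// ltW.
  apply: (le_trans (fg' w Yt)); apply: (le_trans (HC _)).
  rewrite -[leRHS]mulrA ler_wpM2l ?(ltW C0)// -psiE mulrA ler_peMl ?expR_ge0//.
  rewrite -expRD -[leLHS]expR0 ler_expR addrC subr_ge0 ler_wpM2l ?(ltW t20)//.
  by rewrite ge0_ler_powR ?nnegrE ?(ltW a0) ?(ltW Yt).
have bY (h : R -> R) : bmeas h -> bmeas (fun w => h (Y w)).
  by move=> [mh [B hB]]; split; [exact: measurableT_comp|exists B].
have chi0 w : tau < `|Y w| -> chi tau (Y w) = 0 by move=> h; rewrite chiE leNgt h.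
have chi1 w : `|Y w| <= tau -> chi tau (Y w) = 1 by move=> h; rewrite chiE h.
split.
- rewrite -[X in _ - X](Ex_cst P); apply: tail.
  + exact: bmeas_integrable (bmeas_cst 1).
  + exact: bY (bmeas_chi tau).
  + by move=> w /chi1 ->.
  + by move=> w /chi0 ->; rewrite sub0r normrN normr1.
- rewrite -[X in `|X|]subr0 -EY; apply: tail => //.
  + exact: bY (bmeas_trunc tau0).
  + by move=> w h; rewrite trunc_id.
  + by move=> w /chi0 h; rewrite /trunc h mulr0 sub0r normrN.
- rewrite -EY2; apply: tail => //.
  + have bt := bY _ (bmeas_trunc tau0).
    by under eq_fun do rewrite expr2; exact: bmeasM.
  + by move=> w h; rewrite trunc_id.
  + by move=> w /chi0 h; rewrite /trunc h mulr0 expr0n sub0r normrN ger0_norm ?sqr_ge0.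
have bm := bY _ (bmeas_majorant tau0 c0).
rewrite /M -RintegralZl//; apply: le_Rintegral => //.
- exact: bmeas_integrable bm.
- exact: (integrableZl measurableT _ ipsi).
move=> w _; rewrite /majorant; have [Yt|Yt] := leP `|Y w| tau; last first.
  by rewrite chi0// mul0r mulr_ge0// ltW.
rewrite chi1// mul1r -psiE mulrA; apply: ler_pM; rewrite ?exprn_ge0 ?expR_ge0 ?addr_ge0 ?sqr_ge0//.
rewrite ler_expR.
have -> : Y w ^+ 2 = `|Y w| `^ (2 - alpha) * `|Y w| `^ alpha.
  have [->|Y0] := eqVneq (Y w) 0.
    by rewrite normr0 (@powR0 _ alpha) ?gt_eqF// mulr0 expr0n.
  rewrite -powRD; last by rewrite normr_eq0 Y0 implybT.
  by rewrite subrK powR_mulrn// real_normK ?num_real.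
rewrite mulrA ler_wpM2r ?powR_ge0//; apply: le_trans ct; rewrite ler_wpM2l//.
by rewrite ge0_ler_powR ?nnegrE// subr_ge0.
Qed.

End truncation_bounds.

Section correlation.
Context {R : realType}.

Section corr_formula.
Variables (n p : nat) (A : 'M[R]_(n, p)) (z : 'I_n -> 'I_p -> R) (mu sigma : R).
Hypotheses (n0 : (0 < n)%N) (sigma0 : sigma != 0).
Hypothesis Az : forall k i, A k i = mu + sigma * z k i.
Local Notation N := (n%:R : R).
Let s i := \sum_(k < n) z k i.
Let q i j := \sum_(k < n) z k i * z k j.
Let N0 : N != 0. Proof. by rewrite pnatr_eq0 -lt0n. Qed.

Lemma centered_colE i k : centered_col A i k 0 = sigma * (z k i - s i / N).
Proof.
rewrite !mxE /col_mean Az.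
have -> : \sum_(k0 < n) A k0 i = N * mu + sigma * s i.
  under eq_bigr do rewrite Az.
  by rewrite big_split/= sumr_const card_ord -mulr_sumr -[mu *+ n]mulr_natl.
by rewrite mulrDr mulrA mulVf// mul1r; ring.
Qed.

Let dot i j : \sum_(k < n) centered_col A i k 0 * centered_col A j k 0 =
  sigma ^+ 2 * (q i j - s i * s j / N).
Proof.
under eq_bigr do rewrite !centered_colE.
have -> : q i j - s i * s j / N = \sum_(k < n) (z k i * z k j - s j / N * z k i - s i / N * z k j + s i * s j / N / N).
  rewrite big_split/= !sumrB -!mulr_sumr sumr_const card_ord -[_ *+ n]mulr_natl -/(s i) -/(s j) -/(q i j).
  by field.
by rewrite mulr_sumr; apply: eq_bigr => k _; ring.
Qed.

Lemma norm2E i : norm2 (centered_col A i) = `|sigma| * Num.sqrt (q i i - s i ^+ 2 / N).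
Proof.
rewrite /norm2; under eq_bigr do rewrite expr2.
by rewrite dot sqrtrM ?sqr_ge0// sqrtr_sqr expr2.
Qed.

Lemma sample_corrE i j : sample_corr A i j =
  (q i j - s i * s j / N) / (Num.sqrt (q i i - s i ^+ 2 / N) * Num.sqrt (q j j - s j ^+ 2 / N)).
Proof.
rewrite mxE !norm2E mxE.
under eq_bigr do rewrite mxE.
rewrite dot mulrACA -expr2 real_normK ?num_real//.
by rewrite -mulf_div divff ?mul1r// expf_neq0.
Qed.

End corr_formula.

Section link.
Variables (N x eta d h qi qj si sj S : R).
Hypotheses (N0 : 0 < N) (x0 : 0 < x) (d0 : 0 <= d) (d2 : 2 * d < 1).
Hypotheses (Hqi : `|qi - N| <= d * N) (Hqj : `|qj - N| <= d * N).
Hypotheses (Hsi : `|si| <= h) (Hsj : `|sj| <= h) (hN : h ^+ 2 / N <= d * N).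
Hypothesis slack : 2 * d * (Num.sqrt N * x) + h ^+ 2 / N <= Num.sqrt N * (eta / x).

Let r := Num.sqrt (qi - si ^+ 2 / N) * Num.sqrt (qj - sj ^+ 2 / N).

Let var_bounds q s : `|q - N| <= d * N -> `|s| <= h ->
  N * (1 - 2 * d) <= q - s ^+ 2 / N <= N * (1 + d).
Proof.
move=> Hq Hs; have hs : s ^+ 2 / N <= h ^+ 2 / N.
  by rewrite ler_pM2r ?invr_gt0// -real_normK ?num_real// lerXn2r ?nnegrE// (le_trans _ Hs).
have s0 : 0 <= s ^+ 2 / N by rewrite divr_ge0 ?sqr_ge0// ltW.
move: Hq hN hs s0; rewrite ler_norml; set a := s ^+ 2 / N; set b := h ^+ 2 / N.
by move=> /andP[? ?] *; apply/andP; split; nra.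
Qed.

Let r_bounds : N * (1 - 2 * d) <= r <= N * (1 + d).
Proof.
have /andP[i1 i2] := var_bounds Hqi Hsi; have /andP[j1 j2] := var_bounds Hqj Hsj.
have e (y : R) : 0 <= y -> y = Num.sqrt y * Num.sqrt y by move=> y0; rewrite -expr2 sqr_sqrtr.
have l0 : 0 <= N * (1 - 2 * d) by rewrite mulr_ge0 ?ltW// subr_gt0.
have u0 : 0 <= N * (1 + d) by rewrite mulr_ge0 ?addr_ge0// ltW.
apply/andP; split.
  rewrite (e _ l0); apply: ler_pM; rewrite ?sqrtr_ge0// ler_sqrt//; exact: le_trans l0 _.
rewrite (e _ u0); apply: ler_pM; rewrite ?sqrtr_ge0// ler_sqrt//.
Qed.

Let rho := (S - si * sj / N) / r.
Let sN := Num.sqrt N.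
Let sN0 : 0 < sN. Proof. by rewrite sqrtr_gt0. Qed.
Let sNN : sN * sN = N. Proof. by rewrite -expr2 sqr_sqrtr// ltW. Qed.
Let r0 : 0 < r.
Proof. by have /andP[+ _] := r_bounds; apply: lt_le_trans; rewrite mulr_gt0// subr_gt0. Qed.

Let cross : `|si * sj / N| <= h ^+ 2 / N.
Proof.
have i0 : 0 <= N^-1 by rewrite invr_ge0 ltW.
by rewrite normrM (ger0_norm i0) ler_wpM2r// normrM expr2; apply: ler_pM.
Qed.

Let rhoE : (x ^+ 2 < N * rho ^+ 2) = (x * r < sN * `|S - si * sj / N|).
Proof.
have -> : N * rho ^+ 2 = (sN * `|rho|) ^+ 2 by rewrite [RHS]exprMn real_normK ?num_real// [sN ^+ 2]expr2 sNN.
rewrite ltr_pXn2r ?nnegrE ?mulr_ge0 ?(ltW x0) ?(ltW sN0)//=.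
by rewrite /rho normrM normfV (gtr0_norm r0) mulrA ltr_pdivlMr.
Qed.

Lemma corr_gt_imp : x ^+ 2 < N * rho ^+ 2 -> sN * (x - eta / x) < `|S|.
Proof.
rewrite rhoE => H; have /andP[r1 _] := r_bounds.
have H1 : sN * (x * (1 - 2 * d)) < `|S - si * sj / N|.
  rewrite -(ltr_pM2l sN0); apply: le_lt_trans H.
  rewrite mulrA sNN mulrCA ler_pM2l//.
have := ler_normB S (si * sj / N).
by move: H1 slack cross; rewrite -/sN; move: `|S - _| `|S| `|si * _ / _| (h ^+ 2 / N) => *; lra.
Qed.

Lemma corr_gt_if : sN * (x + eta / x) < `|S| -> x ^+ 2 < N * rho ^+ 2.
Proof.
rewrite rhoE => H; have /andP[_ r2] := r_bounds.
have H1 : sN * (x * (1 + d)) < `|S - si * sj / N|.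
  have := lerB_dist S (si * sj / N).
  have dx : d * (sN * x) >= 0 by rewrite mulr_ge0// mulr_ge0// ltW.
  by move: H slack cross; rewrite -/sN; move: `|S - _| `|S| `|si * _ / _| (h ^+ 2 / N) => *; lra.
apply: (@le_lt_trans _ _ (sN * (sN * (x * (1 + d))))); last by rewrite ltr_pM2l.
by rewrite [leRHS]mulrA sNN [leRHS]mulrCA ler_pM2l.
Qed.

End link.

End correlation.

Section real_probability.
Context {d : measure_display} {T : measurableType d} {R : realType}.
Context (P : probability T R).
Local Notation Pr A := (fine (P A)).
Implicit Types A B C : set T.

Lemma Pr_ge0 A : 0 <= Pr A.
Proof. by apply: fine_ge0. Qed.

Lemma Pr_mono A B : measurable A -> measurable B -> A `<=` B -> Pr A <= Pr B.
Proof.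
move=> mA mB AB; rewrite fine_le ?fin_num_measure//.
by apply: le_measure; rewrite ?inE.
Qed.

Lemma PrT : Pr [set: T] = 1.
Proof. by rewrite probability_setT. Qed.

Lemma Pr_le1 A : measurable A -> Pr A <= 1.
Proof. by move=> mA; rewrite -PrT Pr_mono. Qed.

Lemma Pr_split A B : measurable A -> measurable B ->
  Pr A = Pr (A `&` B) + Pr (A `&` ~` B).
Proof.
move=> mA mB.
have mAB : measurable (A `&` B) by exact: measurableI.
have mABc : measurable (A `&` ~` B) by apply: measurableI => //; exact: measurableC.
rewrite -fineD ?fin_num_measure//; congr fine.
rewrite -(@measureU _ _ _ P)//; last by rewrite setIACA setICr setI0.
by rewrite -setIUr setUv setIT.
Qed.

Lemma Pr_setU A B : measurable A -> measurable B -> Pr (A `|` B) <= Pr A + Pr B.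
Proof.
move=> mA mB; rewrite -fineD ?fin_num_measure// fine_le ?fin_numD ?fin_num_measure//.
- exact: measurableU.
- exact: measureU2.
Qed.

End real_probability.

Section poisson_approximation.
Context {d : measure_display} {T : measurableType d} {R : realType}.
Context (P : probability T R).
Local Notation Pr A := (fine (P A)).
Context {I : eqType} (A : I -> set T).
Hypothesis mA : forall a, measurable (A a).

Definition none (s : seq I) : set T := [set w | forall a, a \in s -> ~ A a w].

Lemma none_nil : none [::] = setT.
Proof. by apply/seteqP. Qed.

Lemma none_cons a s : none (a :: s) = ~` A a `&` none s.
Proof.
apply/seteqP; split => w /=.
  by move=> h; split => [|b bs]; apply: h; rewrite inE ?eqxx ?bs ?orbT.
by move=> [ha hs] b; rewrite inE => /predU1P[->//|]; exact: hs.
Qed.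

Lemma measurable_none s : measurable (none s).
Proof.
elim: s => [|a s IH]; first by rewrite none_nil.
by rewrite none_cons; apply: measurableI => //; exact: measurableC.
Qed.

Lemma Pr_none_filter (C : set T) (Q : pred I) s : measurable C ->
  0 <= Pr (C `&` none [seq b <- s | ~~ Q b]) - Pr (C `&` none s)
    <= \sum_(b <- s | Q b) Pr (C `&` A b).
Proof.
move=> mC; have mCn B s' : measurable B -> measurable (C `&` B `&` none s').
  by move=> mB; apply: measurableI (measurable_none s'); exact: measurableI.
apply/andP; split.
  rewrite subr_ge0 Pr_mono//; try exact: measurableI _ (measurable_none _).
  by apply: setIS => w h b; rewrite mem_filter => /andP[_]; exact: h.
elim: s C mC mCn => [|a s IH] C mC mCn; first by rewrite big_nil subrr.
rewrite big_cons/= none_cons.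
have mCI B s' : measurable B -> measurable (C `&` B `&` none s').
  by move=> mB; apply: measurableI (measurable_none s'); exact: measurableI.
have mCn' s' : measurable (C `&` none s') by apply: measurableI (measurable_none _).
case: (Q a) => /=.
  have h1 := IH C mC mCn; have h2 := Pr_split P (mCn' s) (mA a).
  have h3 : Pr (C `&` none s `&` A a) <= Pr (C `&` A a).
    rewrite setIAC; apply: Pr_mono; [by rewrite setIAC; exact: measurableI|exact: measurableI|].
    exact: subIsetl.
  have E : C `&` (~` A a `&` none s) = C `&` none s `&` ~` A a by rewrite setIA setIAC.
  by rewrite E; lra.
rewrite none_cons !setIA; set C' := C `&` ~` A a.
have mC' : measurable C' by apply: measurableI => //; exact: measurableC.
apply: (le_trans (IH C' mC' _)).
  by move=> B s' mB; apply: measurableI (measurable_none s'); exact: measurableI.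
apply: ler_sum => b _; apply: Pr_mono; try exact: measurableI.
by apply: setSI; exact: subIsetl.
Qed.

Variables (adj : rel I) (lam del gam : R) (m : nat).
Hypotheses (lam0 : 0 <= lam) (gam0 : 0 <= gam).
Hypothesis indep : forall a s, ~~ has (adj a) s -> Pr (A a `&` none s) = Pr (A a) * Pr (none s).

(* Conditioning on an earlier event only matters through the adjacent ones, so
   each further event multiplies the probability that none has occurred by
   1 - lam up to the stated error. *)
Lemma poisson_none s : uniq s ->
  (forall a, a \in s -> `|Pr (A a) - lam| <= del) ->
  (forall a, a \in s -> (count (adj a) s <= m)%N) ->
  (forall a b, a \in s -> b \in s -> a != b -> adj a b ->
     Pr (A a `&` A b) + Pr (A a) * Pr (A b) <= gam) ->
  `|Pr (none s) - expR (- (lam * (size s)%:R))| <=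
    (size s)%:R * (del + lam ^+ 2 + m%:R * gam).
Proof.
elim: s => [|a s IH] us Hlam Hm Hgam.
  by rewrite none_nil PrT mulr0 oppr0 expR0 subrr normr0 mul0r.
have /andP[as_ us'] := us.
have sub b : b \in s -> b \in a :: s by rewrite inE orbC => ->.
have := IH us' (fun b bs => Hlam b (sub b bs))
  (fun b bs => leq_trans (leq_addl _ _) (Hm b (sub b bs)))
  (fun b c bs cs => Hgam b c (sub b bs) (sub c cs)).
set err := del + _ + _ => {}IH.
have ain : a \in a :: s by rewrite inE eqxx.
set u := Pr (none s); set pa := Pr (A a).
have mn := measurable_none s.
have u0 : 0 <= u by exact: Pr_ge0.
have u1 : u <= 1 by exact: Pr_le1.
have pa0 : 0 <= pa by exact: Pr_ge0.
have := Pr_none_filter (adj a) s (mA a).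
have := Pr_none_filter (adj a) s (@measurableT _ T).
rewrite !setTI; set s' := [seq b <- s | ~~ adj a b].
under eq_bigr do rewrite setTI.
rewrite indep; last by rewrite -all_predC; exact: filter_all.
rewrite -/u -/pa; set u' := Pr (none s'); set v := Pr (A a `&` none s).
set D2 := \sum_(b <- s | adj a b) Pr (A b).
set D1 := \sum_(b <- s | adj a b) Pr (A a `&` A b).
move=> /andP[d2l d2u] /andP[d1l d1u].
have sm : D1 + pa * D2 <= m%:R * gam.
  rewrite /D1 /D2 mulr_sumr -big_split/=.
  apply: (@le_trans _ _ (\sum_(b <- s | adj a b) gam)).
    rewrite big_seq_cond [leRHS]big_seq_cond; apply: ler_sum => b /andP[bs ab].
    apply: (Hgam a b ain (sub b bs) _ ab).
    by apply/negP => /eqP ab'; move: as_; rewrite ab' bs.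
  rewrite big_const_seq iter_addr_0 mulr_natl; apply: ler_wpMn2l => //.
  by apply: leq_trans (Hm a ain); rewrite leq_addl.
have D10 : 0 <= D1 by apply: sumr_ge0 => b _; exact: Pr_ge0.
have D20 : 0 <= D2 by apply: sumr_ge0 => b _; exact: Pr_ge0.
have uE : Pr (none (a :: s)) = u - v.
  by rewrite none_cons setIC /u (Pr_split P mn (mA a)) /v (setIC (A a)); ring.
have e1 : 1 - lam <= expR (- lam) by exact: expR_ge1Dx.
have e2 : expR (- lam) <= 1 - lam + lam ^+ 2.
  have l1 : 0 < 1 + lam by rewrite ltr_pwDl.
  rewrite expRN (le_trans (y := (1 + lam)^-1))//.
    by rewrite lef_pV2 ?posrE ?expR_gt0// expR_ge1Dx.
  rewrite -[leLHS]mul1r ler_pdivrMr//.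
  have : 0 <= lam ^+ 3 by exact: exprn_ge0.
  lra.
have ha : `|pa - lam| <= del by exact: Hlam.
have hd : `|v - pa * u| <= m%:R * gam.
  rewrite ler_norml; apply/andP; split.
    have : pa * (u' - u) >= 0 by rewrite mulr_ge0.
    have : pa * D2 >= 0 by rewrite mulr_ge0.
    by lra.
  have : pa * (u' - u) <= pa * D2 by rewrite ler_wpM2l.
  by lra.
have step : `|u - v - expR (- lam) * u| <= err.
  have -> : u - v - expR (- lam) * u =
    (1 - lam - expR (- lam)) * u + (lam - pa) * u + (pa * u - v) by ring.
  rewrite /err; apply: (le_trans (ler_normD _ _)); apply: lerD; last by rewrite distrC.
  apply: (le_trans (ler_normD _ _)); rewrite addrC !normrM (ger0_norm u0); apply: lerD.
    by rewrite -[leRHS]mulr1; apply: ler_pM => //; rewrite distrC.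
  rewrite -[leRHS]mulr1; apply: ler_pM => //.
  by rewrite ler0_norm; lra.
rewrite uE /= -natr1 mulrDr mulr1 opprD expRD.
set E := expR (- (lam * _)) in IH *.
have -> : u - v - E * expR (- lam) = (u - v - expR (- lam) * u) + expR (- lam) * (u - E) by ring.
apply: (le_trans (ler_normD _ _)); rewrite mulrDl mul1r addrC; apply: lerD => //.
rewrite normrM (ger0_norm (expR_ge0 _)) -[leRHS]mul1r; apply: ler_pM => //.
by rewrite -expR0 ler_expR oppr_le0.
Qed.

End poisson_approximation.

Section md_close.
Context {d : measure_display} {T : measurableType d} {R : realType}.
Context (P : probability T R) (X : nat * nat -> {RV P >-> R}).
Hypotheses (Xind : mutually_independent X) (Xid : identically_distributed X).
Variables (zf : R -> R).
Hypothesis mzf : measurable_fun setT zf.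
Local Notation E1 := (E1 X zf).
Local Notation Pr A := (fine (P A)).
Variables (tau c eps K : R).
Hypotheses (tau0 : 0 <= tau) (c0 : 0 <= c) (eps01 : 0 <= eps <= 1).
Hypothesis m0_close : `|E1 (chi tau) - 1| <= eps.
Hypothesis m1_close : `|E1 (trunc tau)| <= eps.
Hypothesis m2_close : `|E1 (fun z => trunc tau z ^+ 2) - 1| <= eps.
Hypothesis HK : E1 (majorant tau c) <= K.
Variables (n i j : nat) (s x v : R).
Hypotheses (n0 : (0 < n)%N) (ij : i != j) (s1 : `|s| = 1) (x0 : 0 < x).
Hypotheses (v0 : 0 < v) (v10 : v <= 1 / 10).
Let L := (v ^+ 2)^-1 + 1.
Local Notation th := (md_th n x L).
Local Notation delta := (md_delta eps K n x L).
Hypotheses (thc : gauss_cst * th <= 1 / 4) (thc' : 5 * th <= 2 * c) (delta1 : delta <= 1).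
Hypotheses (dn1 : (1 + delta) ^+ n <= 1 + v) (dn2 : 1 - v <= (1 - delta) ^+ n).
Hypothesis Bx : 1 <= 2 * x ^+ 2 * v ^+ 3.

Let iv0 : 0 < v^-1. Proof. by rewrite invr_gt0. Qed.
Let L1 : 1 < L. Proof. by rewrite ltrDr invr_gt0 exprn_gt0. Qed.
Let eM : expR (- v^-1) <= v.
Proof.
rewrite expRN -[leRHS]invrK lef_pV2 ?posrE ?expR_gt0//.
by rewrite (le_trans _ (expR_ge1Dx _))// lerDr.
Qed.
Let w := v^-1 / L.
Let w_bounds : 0 <= w <= v.
Proof.
have L0 : 0 < L by exact: lt_trans L1.
apply/andP; split; first by rewrite divr_ge0 ?ltW.
rewrite ler_pdivrMr// /L mulrDr mulr1 expr2 invfM mulrA divff ?gt_eqF// mul1r.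
by rewrite lerDl ltW.
Qed.
Let L1v : (L - 1)^-1 = v ^+ 2. Proof. by rewrite /L addrK invrK. Qed.
Let k0 : 0 <= phi x / x. Proof. by rewrite divr_ge0 ?phi_ge0 ?ltW. Qed.

Lemma Pr_md_close_upper :
  Pr (md_event X zf tau n i j s (x - v / x)) <= (1 + 20 * v) * (phi x / x).
Proof.
have := Pr_md_upper Xind Xid mzf tau0 c0 eps01 m0_close m1_close m2_close HK n0 ij s1 x0 L1 thc thc' delta1 (- v) v^-1.
rewrite mulNr => /le_trans; apply; rewrite -/w L1v opprD !opprK.
have /andP[w0 wv] := w_bounds.
have e2 : expR (v + w) <= 1 + 4 * v.
  have vw : 0 <= v + w <= 1 / 2 by have := v0; have := v10; move=> *; apply/andP; split; lra.
  by apply: (le_trans (expR_le1D2x vw)); lra.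
have eM0 := expR_ge0 (- v^-1).
have D0 : 0 <= (1 + delta) ^+ n.
  have : 0 <= md_delta eps K n x L; last by move=> ?; rewrite exprn_ge0// addr_ge0.
  have e0 : 0 <= eps by case/andP: eps01.
  have C0 : 0 <= gauss_cst :> R by exact: le_trans (@gauss_cst_ge54 R).
  have th0 : 0 <= md_th n x L ^+ 3.
    by rewrite exprn_ge0// divr_ge0 ?sqrtr_ge0// mulr_ge0// ltW// (lt_trans _ L1).
  have K0 : 0 <= K ^+ 2 + 1 by rewrite addr_ge0 ?sqr_ge0.
  by repeat (apply: addr_ge0 => // || apply: mulr_ge0 => //).
have E0 := expR_ge0 (v + w).
have dn1' := dn1; set D := (1 + delta) ^+ n in D0 dn1' *; set E := expR (v + w) in e2 E0 *.
rewrite [leLHS](_ : _ = (1 + expR (- v^-1)) * D * (E * (1 + v ^+ 2)) * (phi x / x)); last by ring.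
rewrite ler_wpM2r//.
have v2 : v ^+ 2 <= v / 10 by rewrite expr2 ler_wpM2l ?(ltW v0)//; move: v10; rewrite mul1r.
have v20 : 0 <= v ^+ 2 by exact: sqr_ge0.
apply: (@le_trans _ _ ((1 + v) * (1 + v) * ((1 + 4 * v) * (1 + v / 10)))).
  have p1 : (1 + expR (- v^-1)) * D <= (1 + v) * (1 + v).
    by apply: ler_pM => //; first [exact: addr_ge0 | by rewrite lerD2l; exact: eM].
  have p2 : E * (1 + v ^+ 2) <= (1 + 4 * v) * (1 + v / 10).
    by apply: ler_pM => //; first [exact: addr_ge0 | by rewrite lerD2l].
  by apply: ler_pM => //; rewrite mulr_ge0// addr_ge0.
have v0' := v0; have v10' := v10.
have q1 : (1 + v) * (1 + v) <= 1 + 3 * v by nra.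
have q2 : (1 + 4 * v) * (1 + v / 10) <= 1 + 5 * v by nra.
apply: (@le_trans _ _ ((1 + 3 * v) * (1 + 5 * v))); last by nra.
by apply: ler_pM => //; rewrite mulr_ge0 ?addr_ge0 ?mulr_ge0 ?divr_ge0// ltW.
Qed.

Lemma Pr_md_close_lower :
  (1 - 20 * v) * (phi x / x) <= Pr (md_event X zf tau n i j s (x + v / x)).
Proof.
have /andP[w0 wv] := w_bounds.
have B10 : 10 <= v^-1 by rewrite -[leLHS]invrK lef_pV2 ?posrE//; move: v10; rewrite mul1r.
have b2 : (v^-1) ^+ 2 <= v * (2 * x ^+ 2).
  rewrite exprVn -[leLHS]mul1r ler_pdivrMr ?exprn_gt0//.
  by apply: (le_trans Bx); rewrite le_eqVlt; apply/orP; left; apply/eqP; ring.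
have x20 : 0 < 2 * x ^+ 2 by rewrite mulr_gt0 ?exprn_gt0.
have H2 : (v^-1) ^+ 2 <= 2 * x ^+ 2.
  by apply: (le_trans b2); rewrite ler_piMl ?(ltW x20)//; move: v10; lra.
have H1 : `|v + 2 * v^-1 / L| < v^-1.
  rewrite -mulrA -/w ger0_norm; first by have := v10; lra.
  by have := v0; lra.
have := Pr_md_lower Xind Xid mzf tau0 c0 eps01 m0_close m1_close m2_close HK n0 ij s1 x0 L1 thc thc' delta1 H1 H2.
apply: le_trans; rewrite -[2 * v^-1 / L]mulrA -/w L1v.
set b := (v^-1) ^+ 2 / (2 * x ^+ 2).
have bv : b <= v by rewrite ler_pdivrMr.
set k := phi x / x; have k0' : 0 <= k by exact: k0.
have e1 : 1 - 3 * v <= expR (- (v + 2 * w)).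
  by apply: le_trans (expR_ge1Dx _); lra.
have eM0 := expR_ge0 (- v^-1).
have lg : 1 - v <= logistic v^-1.
  rewrite /logistic -[leLHS]mul1r -[leRHS]mul1r ler_pdivlMr ?logistic_den_gt0//.
  by have := eM; have := v0; nra.
have ev : expR (- v) <= 1 by rewrite -expR0 ler_expR oppr_le0 ltW.
have ev0 := expR_ge0 (- v).
have dn1' := dn1; have dn2' := dn2; set D := (1 + delta) ^+ n in dn1' *; set D' := (1 - delta) ^+ n in dn2' *.
set lgv := logistic _ in lg *; set e := expR (- v^-1) in eM0 *.
have eM' : e <= v := eM.
set f := expR (- (v + 2 * w)) in e1 *.
have v0' := v0; have v10' := v10.
have t1 : (1 - v) * ((1 - 4 * v) * (1 - v) * (1 - v)) <= D' * ((f - e) * (1 - b) * lgv).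
  have z1 : 0 <= 1 - v by lra.
  have z4 : 0 <= 1 - 4 * v by lra.
  apply: ler_pM => //; first by rewrite !mulr_ge0.
  apply: ler_pM => //; first by rewrite mulr_ge0.
  by apply: ler_pM => //; lra.
have t2 : D * (expR (- v) * (1 + v ^+ 2)) <= 2.
  have h : expR (- v) * (1 + v ^+ 2) <= 1 + v ^+ 2 by rewrite ler_piMl// addr_ge0 ?sqr_ge0.
  have h0 : 0 <= expR (- v) * (1 + v ^+ 2) by rewrite mulr_ge0// addr_ge0 ?sqr_ge0.
  apply: (@le_trans _ _ ((1 + v) * (1 + v ^+ 2))); first by nra.
  have : v ^+ 2 <= 1 / 100 by nra.
  nra.
have t3 : 2 * e * (D * (expR (- v) * (1 + v ^+ 2))) <= 4 * v.
  by apply: (@le_trans _ _ (2 * e * 2)); [rewrite ler_wpM2l// mulr_ge0|lra].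
have t4 : 1 - 16 * v <= (1 - v) * ((1 - 4 * v) * (1 - v) * (1 - v)).
  have q : 1 - 8 * v <= (1 - 4 * v) * (1 - v) * (1 - v) by nra.
  have z1 : 0 <= 1 - v by lra.
  have := ler_wpM2l z1 q; have := sqr_ge0 v; lra.
rewrite [leRHS](_ : _ = (D' * ((f - e) * (1 - b) * lgv) - 2 * e * (D * (expR (- v) * (1 + v ^+ 2)))) * k); last by ring.
by rewrite ler_wpM2r//; lra.
Qed.

End md_close.

Section exceedance.
Context {d : measure_display} {T : measurableType d} {R : realType}.
Context (P : probability T R) (X : nat * nat -> {RV P >-> R}).
Hypothesis Xind : mutually_independent X.
Variables (zf : R -> R).
Hypothesis mzf : measurable_fun setT zf.
Local Notation Z := (Zv X zf).
Local Notation sum2 := (sum2 X zf).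
Local Notation Pr A := (fine (P A)).
Variable n : nat.

Definition colsum (i : nat) (w : T) : R := \sum_(k < n) Z (nat_of_ord k, i) w.

Definition colvar (i : nat) (w : T) : R := sum2 n i i w - colsum i w ^+ 2 / n%:R.

Definition colcorr (i j : nat) (w : T) : R :=
  (sum2 n i j w - colsum i w * colsum j w / n%:R) /
  (Num.sqrt (colvar i w) * Num.sqrt (colvar j w)).

Definition exceed (x : R) (a : nat * nat) : set T :=
  [set w | x ^+ 2 < n%:R * colcorr a.1 a.2 w ^+ 2].

Definition col_set (i : nat) : set (nat * nat) := [set kl | kl.2 = i].

Let mon_Z (J : set (nat * nat)) k i : J (k, i) -> meas_on X J (Z (k, i)).
Proof. by move=> Jki; apply: (meas_on_Zv mzf Jki (h := id)). Qed.

Lemma meas_on_colsum (J : set (nat * nat)) i : col_set i `<=` J -> meas_on X J (colsum i).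
Proof. by move=> iJ; apply: measurable_sum => k; apply: mon_Z; exact: iJ. Qed.

Lemma meas_on_sum2 (J : set (nat * nat)) i j :
  col_set i `<=` J -> col_set j `<=` J -> meas_on X J (sum2 n i j).
Proof.
move=> iJ jJ; apply: measurable_sum => k; apply: measurable_funM; apply: mon_Z.
- exact: iJ.
- exact: jJ.
Qed.

Lemma meas_on_colvar (J : set (nat * nat)) i : col_set i `<=` J -> meas_on X J (colvar i).
Proof.
move=> iJ; apply: measurable_funB; first exact: meas_on_sum2.
by apply: measurable_funM => //; apply: measurable_funX; exact: meas_on_colsum.
Qed.

Lemma meas_on_colcorr (J : set (nat * nat)) i j :
  col_set i `<=` J -> col_set j `<=` J -> meas_on X J (colcorr i j).
Proof.
move=> iJ jJ; apply: measurable_funM.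
  apply: measurable_funB; first exact: meas_on_sum2.
  by apply: measurable_funM => //; apply: measurable_funM; exact: meas_on_colsum.
under eq_fun do rewrite -powR_inv1 ?mulr_ge0 ?sqrtr_ge0//.
apply: (@measurableT_comp _ _ _ _ _ _ (fun x : R => x `^ (-1))).
  exact: measurable_powR.
have ms k : col_set k `<=` J -> meas_on X J (fun w => Num.sqrt (colvar k w)).
  move=> kJ; apply: (@measurableT_comp _ _ _ _ _ _ (@Num.sqrt R)).
    by apply: continuous_measurable_fun; exact: sqrt_continuous.
  exact: meas_on_colvar.
by apply: measurable_funM; exact: ms.
Qed.

Lemma event_on_exceed (J : set (nat * nat)) x a :
  col_set a.1 `<=` J -> col_set a.2 `<=` J -> event_on X J (exceed x a).
Proof.
move=> iJ jJ.
have h : meas_on X J (fun w => n%:R * colcorr a.1 a.2 w ^+ 2).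
  by apply: measurable_funM => //; apply: measurable_funX; exact: meas_on_colcorr.
have := meas_on_event h (measurable_itv `]x ^+ 2, +oo[); congr event_on.
by apply/seteqP; split => w /=; rewrite in_itv/= andbT.
Qed.

Lemma measurable_exceed x a : measurable (exceed x a).
Proof. by apply: (@event_on_measurable _ _ _ _ _ X setT); exact: event_on_exceed. Qed.

Lemma measurable_colsum i : measurable_fun setT (colsum i).
Proof. by apply: (@meas_onW _ _ _ _ _ X _ _ setT); exact: meas_on_colsum. Qed.

Definition share (a b : nat * nat) : bool :=
  [|| a.1 == b.1, a.1 == b.2, a.2 == b.1 | a.2 == b.2].

Lemma event_on_none (J : set (nat * nat)) x s :
  (forall a, a \in s -> col_set a.1 `<=` J /\ col_set a.2 `<=` J) ->
  event_on X J (none (exceed x) s).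
Proof.
elim: s => [|a s IH] sJ.
  rewrite none_nil; exact: (@measurableT _ (g_sigma_algebraType (fcyl X J))).
rewrite none_cons; apply: (@measurableI _ (g_sigma_algebraType (fcyl X J))).
  apply: (@measurableC _ (g_sigma_algebraType (fcyl X J))).
  by have [] := sJ a (mem_head _ _); exact: event_on_exceed.
by apply: IH => b bs; apply: sJ; rewrite inE bs orbT.
Qed.

Lemma exceed_indep x a s : ~~ has (share a) s ->
  Pr (exceed x a `&` none (exceed x) s) = Pr (exceed x a) * Pr (none (exceed x) s).
Proof.
move=> /hasPn sa.
rewrite (@event_on_indep _ _ _ _ _ _ Xind (col_set a.1 `|` col_set a.2)
  (~` (col_set a.1 `|` col_set a.2))).
- rewrite fineM// fin_num_measure//; first exact: measurable_exceed.
  exact: measurable_none (measurable_exceed x) s.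
- exact: setICr.
- by apply: event_on_exceed; [exact: subsetUl|exact: subsetUr].
apply: event_on_none => b /sa; rewrite /share !negb_or => /and4P[a11 a12 a21 a22].
by split => -[k l] /= kl [] /= h; move: a11 a12 a21 a22; rewrite -kl -h eqxx.
Qed.

Lemma colcorrC i j w : colcorr i j w = colcorr j i w.
Proof.
rewrite /colcorr mulrC [RHS]mulrC; congr (_^-1 * _); first by rewrite mulrC.
congr (_ - _ / _); last exact: mulrC.
by apply: eq_bigr => k _; exact: mulrC.
Qed.

Lemma exceedC x i j : exceed x (i, j) = exceed x (j, i).
Proof. by apply/seteqP; split => w; rewrite /exceed /= colcorrC. Qed.

End exceedance.

Section bad_columns.
Context {d : measure_display} {T : measurableType d} {R : realType}.
Context (P : probability T R) (X : nat * nat -> {RV P >-> R}).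
Hypotheses (Xind : mutually_independent X) (Xid : identically_distributed X).
Variables (zf : R -> R).
Hypothesis mzf : measurable_fun setT zf.
Local Notation Z := (Zv X zf).
Local Notation E1 := (E1 X zf).
Local Notation sum2 := (sum2 X zf).
Local Notation colsum := (colsum X zf).
Local Notation exceed := (exceed X zf).
Local Notation Pr A := (fine (P A)).
Variables (tau c eps K : R).
Hypotheses (tau0 : 0 <= tau) (c0 : 0 <= c).
Hypothesis m0_close : `|E1 (chi tau) - 1| <= eps.
Hypothesis m1_close : `|E1 (trunc tau)| <= eps.
Hypothesis m2_close : `|E1 (fun z => trunc tau z ^+ 2) - 1| <= eps.
Hypothesis HK : E1 (majorant tau c) <= K.
Variable n : nat.

Let btr2 : bmeas (fun z => trunc tau z ^+ 2).
Proof. by under eq_fun do rewrite expr2; exact: bmeasM (bmeas_trunc tau0) (bmeas_trunc tau0). Qed.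

Let Pr_abs_gt (f : T -> R) (G : set T) (b D E : R) :
  measurable G -> measurable_fun setT f -> 0 < b ->
  Pr (G `&` [set w | b * D <= b * f w]) <= E ->
  Pr (G `&` [set w | b * D <= - b * f w]) <= E ->
  measurable (G `&` [set w | D < `|f w|]) /\ Pr (G `&` [set w | D < `|f w|]) <= 2 * E.
Proof.
move=> mG mf b0 H1 H2.
have mge s : measurable (G `&` [set w | b * D <= s * f w]).
  apply: measurableI => //.
  have h : measurable_fun setT (fun w => s * f w) by exact: measurable_funM.
  have := h measurableT `[b * D, +oo[%classic (measurable_itv _); rewrite setTI; congr measurable.
  by apply/seteqP; split => w /=; rewrite in_itv/= andbT.
have mA : measurable (G `&` [set w | D < `|f w|]).
  apply: measurableI => //.
  have h : measurable_fun setT (fun w => `|f w|) by exact: measurableT_comp.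
  have := h measurableT `]D, +oo[%classic (measurable_itv _); rewrite setTI; congr measurable.
  by apply/seteqP; split => w /=; rewrite in_itv/= andbT.
split => //; rewrite mulr_natl mulr2n; apply: le_trans (lerD H1 H2).
apply: le_trans (Pr_setU P (mge b) (mge (- b))).
apply: Pr_mono => //; first exact: measurableU.
move=> w [Gw] /=; have [f0|f0] := leP 0 (f w).
  by rewrite ger0_norm// => h; left; split => //=; rewrite ler_pM2l// ltW.
by rewrite ltr0_norm// => h; right; split => //=; rewrite mulNr -mulrN ler_pM2l// ltW.
Qed.

Definition good_column (dl h : R) (i : nat) : set T :=
  [set w | [/\ goodcol X zf tau n i w, `|sum2 n i i w - n%:R| <= dl & `|colsum n i w| <= h]].

Lemma good_columnE dl h i : ~` good_column dl h i =
  ~` goodcol X zf tau n i `|`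
  ((goodcol X zf tau n i `&` [set w | dl < `|sum2 n i i w - n%:R|]) `|`
   (goodcol X zf tau n i `&` [set w | h < `|colsum n i w|])).
Proof.
apply/seteqP; split => w /=.
  move=> nG; have [wG|wG] := pselect (goodcol X zf tau n i w); last by left.
  right; have [h1|h1] := leP `|sum2 n i i w - n%:R| dl; last by left.
  by right; split => //; rewrite ltNge; apply/negP => h2; exact: nG.
by move=> [nG [] //|[[wG]|[wG]]] /= hlt [_ h1 h2]; move: hlt; rewrite ltNge ?h1 ?h2.
Qed.

Let mgood i : measurable (goodcol X zf tau n i). Proof. exact: measurable_goodcol. Qed.

Section bound.
Variables (i : nat) (dl h b1 b2 : R).
Hypotheses (b10 : 0 < b1) (b11 : b1 <= 1) (b1c : b1 <= c).
Hypotheses (b20 : 0 < b2) (b21 : b2 <= 1) (b2c : b2 <= c).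

Let q_event : measurable (goodcol X zf tau n i `&` [set w | dl < `|sum2 n i i w - n%:R|]) /\
  Pr (goodcol X zf tau n i `&` [set w | dl < `|sum2 n i i w - n%:R|]) <=
  2 * expR (n%:R * (b1 * (2 * eps) + expR 1 * K * b1 ^+ 2) - b1 * dl).
Proof.
have bg : bmeas (fun z => trunc tau z ^+ 2 - 1) by apply: bmeasB => //; exact: bmeas_cst.
have gb z : `|z| <= tau -> `|trunc tau z ^+ 2 - 1| <= 1 + z ^+ 2.
  move=> zt; rewrite trunc_id// (le_trans (ler_normB _ _))// normr1 addrC.
  by rewrite ger0_norm ?sqr_ge0.
have gq : `|E1 (fun z => chi tau z * (trunc tau z ^+ 2 - 1))| <= 2 * eps.
  have -> : E1 (fun z => chi tau z * (trunc tau z ^+ 2 - 1)) =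
      E1 (fun z => trunc tau z ^+ 2) - E1 (chi tau).
    rewrite /E1 -ExB; [|exact: (bmeas_Zv X mzf _ btr2)|exact: (bmeas_Zv X mzf _ (bmeas_chi tau))].
    apply: eq_Rintegral => w _; rewrite mulrBr mulr1; congr (_ - _).
    by rewrite trunc_sqr mulrA chi_idem.
  move: m0_close m2_close; rewrite !ler_norml => /andP[? ?] /andP[? ?]; apply/andP; split; lra.
have sumE w : goodcol X zf tau n i w ->
    \sum_(k < n) (trunc tau (Z (nat_of_ord k, i) w) ^+ 2 - 1) = sum2 n i i w - n%:R.
  move=> wG; rewrite big_split/= sumrN sumr_const card_ord; congr (_ - _).
  by apply: eq_bigr => k _; rewrite trunc_id ?wG// expr2.
have side b : `|b| = b1 ->
    Pr (goodcol X zf tau n i `&` [set w | b1 * dl <= b * (sum2 n i i w - n%:R)]) <=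
    expR (n%:R * (b1 * (2 * eps) + expR 1 * K * b1 ^+ 2) - b1 * dl).
  move=> bE; have b2E : b ^+ 2 = b1 ^+ 2 by rewrite -bE real_normK ?num_real.
  rewrite (_ : _ `&` _ = goodcol X zf tau n i `&`
      [set w | b1 * dl <= b * \sum_(k < n) (trunc tau (Z (nat_of_ord k, i) w) ^+ 2 - 1)]).
    have := @Pr_column_sum _ _ _ _ _ Xind Xid _ mzf _ tau0 _ _ c0 HK n i (fun z => trunc tau z ^+ 2 - 1) b (2 * eps) (b1 * dl).
    by rewrite bE b2E; apply.
  by apply/seteqP; split => w /= [wG]; rewrite sumE.
apply: (@Pr_abs_gt _ _ b1) => //.
- apply: measurable_funB => //; exact: measurable_sum2.
- by apply: side; rewrite gtr0_norm.
- by apply: side; rewrite normrN gtr0_norm.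
Qed.

Let s_event : measurable (goodcol X zf tau n i `&` [set w | h < `|colsum n i w|]) /\
  Pr (goodcol X zf tau n i `&` [set w | h < `|colsum n i w|]) <=
  2 * expR (n%:R * (b2 * eps + expR 1 * K * b2 ^+ 2) - b2 * h).
Proof.
have bg := bmeas_trunc tau0.
have gb z : `|z| <= tau -> `|trunc tau z| <= 1 + z ^+ 2.
  move=> zt; rewrite trunc_id// -[z ^+ 2]real_normK ?num_real//.
  have := sqr_ge0 (`|z| - 1); have := normr_ge0 z; nra.
have gq : `|E1 (fun z => chi tau z * trunc tau z)| <= eps.
  by rewrite (_ : (fun z => _) = trunc tau)//; apply/funext => z; exact: chi_trunc.
have sumE w : goodcol X zf tau n i w ->
    \sum_(k < n) trunc tau (Z (nat_of_ord k, i) w) = colsum n i w.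
  by move=> wG; apply: eq_bigr => k _; rewrite trunc_id ?wG.
have side b : `|b| = b2 ->
    Pr (goodcol X zf tau n i `&` [set w | b2 * h <= b * colsum n i w]) <=
    expR (n%:R * (b2 * eps + expR 1 * K * b2 ^+ 2) - b2 * h).
  move=> bE; have b2E : b ^+ 2 = b2 ^+ 2 by rewrite -bE real_normK ?num_real.
  rewrite (_ : _ `&` _ = goodcol X zf tau n i `&`
      [set w | b2 * h <= b * \sum_(k < n) trunc tau (Z (nat_of_ord k, i) w)]).
    have := @Pr_column_sum _ _ _ _ _ Xind Xid _ mzf _ tau0 _ _ c0 HK n i (trunc tau) b eps (b2 * h).
    by rewrite bE b2E; apply.
  by apply/seteqP; split => w /= [wG]; rewrite sumE.
apply: (@Pr_abs_gt _ _ b2) => //.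
- exact: measurable_colsum.
- by apply: side; rewrite gtr0_norm.
- by apply: side; rewrite normrN gtr0_norm.
Qed.

Lemma measurable_bad_column : measurable (~` good_column dl h i).
Proof.
rewrite good_columnE; apply: measurableU; first exact: measurableC.
by apply: measurableU; [case: q_event|case: s_event].
Qed.

Lemma Pr_bad_column : Pr (~` good_column dl h i) <= n%:R * eps +
  (2 * expR (n%:R * (b1 * (2 * eps) + expR 1 * K * b1 ^+ 2) - b1 * dl) +
   2 * expR (n%:R * (b2 * eps + expR 1 * K * b2 ^+ 2) - b2 * h)).
Proof.
have [mq Pq] := q_event; have [ms Ps] := s_event; rewrite good_columnE.
apply: (le_trans (Pr_setU P (measurableC (mgood i)) (measurableU _ _ mq ms))).
apply: lerD; first exact: (Pr_goodcolC Xid mzf m0_close).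
apply: (le_trans (Pr_setU P mq ms)); exact: lerD.
Qed.

End bound.

End bad_columns.

Section exceed_bounds.
Context {d : measure_display} {T : measurableType d} {R : realType}.
Context (P : probability T R) (X : nat * nat -> {RV P >-> R}).
Variables (zf : R -> R).
Hypothesis mzf : measurable_fun setT zf.
Local Notation sum2 := (sum2 X zf).
Local Notation exceed := (exceed X zf).
Local Notation Pr A := (fine (P A)).
Variables (tau : R) (n : nat).
Hypothesis n0 : (0 < n)%N.
Variables (x v dd h : R).
Hypotheses (x0 : 0 < x) (v0 : 0 < v) (dd0 : 0 <= dd) (dd2 : 2 * dd < 1).
Hypothesis hN : h ^+ 2 / n%:R <= dd * n%:R.
Hypothesis slack : 2 * dd * (Num.sqrt n%:R * x) + h ^+ 2 / n%:R <= Num.sqrt n%:R * (v / x).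
Local Notation G := (good_column X zf tau n (dd * n%:R) h).
Local Notation md s i j := (md_event X zf tau n i j s).
Let N0 : 0 < n%:R :> R. Proof. by rewrite ltr0n. Qed.

Lemma exceed_sum2_gt i j w : G i w -> G j w -> exceed n x (i, j) w ->
  Num.sqrt n%:R * (x - v / x) < `|sum2 n i j w|.
Proof. by move=> [_ qi si] [_ qj sj]; exact: (corr_gt_imp N0 x0 dd0 dd2 qi qj si sj hN slack). Qed.

Lemma sum2_gt_exceed i j w : G i w -> G j w ->
  Num.sqrt n%:R * (x + v / x) < `|sum2 n i j w| -> exceed n x (i, j) w.
Proof. by move=> [_ qi si] [_ qj sj]; exact: (corr_gt_if N0 x0 dd0 dd2 qi qj si sj hN slack). Qed.

Variable pb : R.
Hypothesis mbad : forall i, measurable (~` G i).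
Hypothesis Pbad : forall i, Pr (~` G i) <= pb.

Let mex a : measurable (exceed n x a). Proof. exact: measurable_exceed. Qed.
Let mmd s i j y : measurable (md s i j y). Proof. exact: measurable_md_event. Qed.
Let mbad2 i j : measurable (~` G i `|` ~` G j). Proof. exact: measurableU. Qed.
Let Pbad2 i j : Pr (~` G i `|` ~` G j) <= pb + pb.
Proof. by apply: (le_trans (Pr_setU P (mbad i) (mbad j))); exact: lerD. Qed.

Let norm_gt (t y : R) : t < `|y| -> t < 1 * y \/ t < -1 * y.
Proof. by rewrite mul1r mulN1r ltr_normr => /orP[]; [left|right]. Qed.

Lemma Pr_exceed_le i j :
  Pr (exceed n x (i, j)) <= Pr (md 1 i j (x - v / x)) + Pr (md (-1) i j (x - v / x)) + (pb + pb).
Proof.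
apply: le_trans (lerD (Pr_setU P (mmd _ _ _ _) (mmd _ _ _ _)) (Pbad2 i j)).
have mU : measurable (md 1 i j (x - v / x) `|` md (-1) i j (x - v / x)) by exact: measurableU.
apply: (le_trans _ (Pr_setU P mU (mbad2 i j))).
apply: Pr_mono => //; first exact: measurableU.
move=> w ex; have [Gi|Gi] := pselect (G i w); last by right; left.
have [Gj|Gj] := pselect (G j w); last by right; right.
left; have := exceed_sum2_gt Gi Gj ex.
have [gi _ _] := Gi; have [gj _ _] := Gj.
by move=> /norm_gt[]; [left|right].
Qed.

Lemma Pr_exceed_ge i j :
  Pr (md 1 i j (x + v / x)) + Pr (md (-1) i j (x + v / x)) - (pb + pb) <= Pr (exceed n x (i, j)).
Proof.
rewrite lerBlDr.
have y0 : 0 <= Num.sqrt n%:R * (x + v / x).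
  by rewrite mulr_ge0 ?sqrtr_ge0// addr_ge0 ?divr_ge0// ltW.
have mU : measurable (md 1 i j (x + v / x) `|` md (-1) i j (x + v / x)) by exact: measurableU.
apply: (le_trans _ (lerD (lexx _) (Pbad2 i j))).
apply: (le_trans _ (Pr_setU P (mex (i, j)) (mbad2 i j))).
have dis : md 1 i j (x + v / x) `&` md (-1) i j (x + v / x) = set0.
  rewrite -subset0 => w [[_ /= h1] [_ /= h2]].
  by move: h1 h2 y0; set a := Num.sqrt _ * _; set b := sum2 n i j w; lra.
rewrite -fineD ?fin_num_measure// -measureU//.
apply: Pr_mono => //; first exact: measurableU.
move=> w Hw; have [Gi|Gi] := pselect (G i w); last by right; left.
have [Gj|Gj] := pselect (G j w); last by right; right.
left; apply: sum2_gt_exceed => //.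
by case: Hw => -[_] /=; rewrite ?mul1r ?mulN1r ltr_normr => ->; rewrite ?orbT.
Qed.

Definition double_event (D s1 s2 : R) (i j k : nat) : set T :=
  [set w | [/\ goodcol X zf tau n i w, goodcol X zf tau n j w, goodcol X zf tau n k w,
      D <= s1 * sum2 n i j w & D <= s2 * sum2 n i k w]].

Lemma measurable_double_event D s1 s2 i j k : measurable (double_event D s1 s2 i j k).
Proof.
have mge s i' j' : measurable [set w | D <= s * sum2 n i' j' w].
  have h' : measurable_fun setT (fun w => s * sum2 n i' j' w).
    by apply: measurable_funM => //; exact: measurable_sum2.
  have := h' measurableT `[D, +oo[%classic (measurable_itv _); rewrite setTI; congr measurable.
  by apply/seteqP; split => w /=; rewrite in_itv/= andbT.
rewrite (_ : double_event _ _ _ _ _ _ =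
  goodcol X zf tau n i `&` goodcol X zf tau n j `&` goodcol X zf tau n k `&`
  [set w | D <= s1 * sum2 n i j w] `&` [set w | D <= s2 * sum2 n i k w]).
  by do 4 ?apply: measurableI => //; exact: measurable_goodcol.
by apply/seteqP; split => w /= => [[]|[[[[]]]]].
Qed.

Lemma Pr_exceed2 i j k (E : R) :
  (forall s1 s2, `|s1| = 1 -> `|s2| = 1 ->
     Pr (double_event (Num.sqrt n%:R * (x - v / x)) s1 s2 i j k) <= E) ->
  Pr (exceed n x (i, j) `&` exceed n x (i, k)) <= 4 * E + 3 * pb.
Proof.
move=> HE; set D := Num.sqrt n%:R * (x - v / x) in HE.
pose F s1 s2 := double_event D s1 s2 i j k.
have mF s1 s2 : measurable (F s1 s2) by exact: measurable_double_event.
have mF2 s1 : measurable (F s1 1 `|` F s1 (-1)) by exact: measurableU.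
have n11 : `|1 : R| = 1 by rewrite normr1.
have n12 : `|-1 : R| = 1 by rewrite normrN1.
have PF2 s1 : `|s1| = 1 -> Pr (F s1 1 `|` F s1 (-1)) <= E + E.
  by move=> h1; apply: (le_trans (Pr_setU P (mF _ _) (mF _ _))); apply: lerD; exact: HE.
have mF4 := measurableU _ _ (mF2 1) (mF2 (-1)).
have mB3 := measurableU _ _ (mbad2 i j) (mbad k).
have PF4 := Pr_setU P (mF2 1) (mF2 (-1)).
have PB3 := Pr_setU P (mbad2 i j) (mbad k).
have PU := Pr_setU P mF4 mB3.
have a1 := PF2 1 n11; have a2 := PF2 _ n12; have a3 := Pbad2 i j; have a4 := Pbad k.
apply: (@le_trans _ _ (Pr ((F 1 1 `|` F 1 (-1) `|` (F (-1) 1 `|` F (-1) (-1))) `|` (~` G i `|` ~` G j `|` ~` G k)))); last by lra.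
apply: Pr_mono; [exact: measurableI|exact: measurableU|].
move=> w [e1 e2].
have [Gi|Gi] := pselect (G i w); last by right; left; left.
have [Gj|Gj] := pselect (G j w); last by right; left; right.
have [Gk|Gk] := pselect (G k w); last by right; right.
left; have [gi _ _] := Gi; have [gj _ _] := Gj; have [gk _ _] := Gk.
have := exceed_sum2_gt Gi Gj e1; have := exceed_sum2_gt Gi Gk e2.
by move=> /norm_gt[] /ltW h2 /norm_gt[] /ltW h1; [left; left|right; left|left; right|right; right].
Qed.

End exceed_bounds.

Section index_pairs.
Local Open Scope nat_scope.

Fixpoint index_pairs (p : nat) : seq (nat * nat) :=
  if p is q.+1 then index_pairs q ++ [seq (i, q) | i <- iota 0 q] else [::].

Lemma mem_index_pairs p a : (a \in index_pairs p) = (a.1 < a.2 < p).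
Proof.
case: a => i j /=; elim: p => [|p IH] /=; first by rewrite andbF.
rewrite mem_cat IH ltnS [j <= p]leq_eqVlt.
have -> : ((i, j) \in [seq (k, p) | k <- iota 0 p]) = (i < p) && (j == p).
  apply/mapP/andP => [[k]|[ip /eqP ->]]; last by exists i; rewrite ?mem_iota.
  by rewrite mem_iota => kp [-> ->].
by have [->|jp] := eqVneq j p; rewrite /= ?ltnn ?andbF ?andbT ?orbF.
Qed.

Lemma uniq_index_pairs p : uniq (index_pairs p).
Proof.
elim: p => //= p IH; rewrite cat_uniq IH /= map_inj_uniq ?iota_uniq ?andbT; last by move=> i j [].
apply/hasPn => _ /mapP[k _ ->].
by rewrite mem_index_pairs/= ltnn andbF.
Qed.

Lemma size_index_pairs (R : numFieldType) p :
  (size (index_pairs p))%:R = p%:R * (p%:R - 1) / 2 :> R.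
Proof.
elim: p => [|p IH]; first by rewrite !mul0r.
by rewrite /= size_cat size_map size_iota natrD IH -natr1; field.
Qed.

Lemma count_share p a : count (share a) (index_pairs p) <= 4 * p.
Proof.
rewrite -size_filter.
pose nb := [seq (a.1, k) | k <- iota 0 p] ++ [seq (k, a.1) | k <- iota 0 p] ++
  [seq (a.2, k) | k <- iota 0 p] ++ [seq (k, a.2) | k <- iota 0 p].
have -> : 4 * p = size nb by rewrite !size_cat !size_map size_iota; ring.
apply: uniq_leq_size; first exact: filter_uniq (uniq_index_pairs p).
move=> [i j]; rewrite mem_filter mem_index_pairs/= => /andP[sh /andP[ij jp]].
have mi (i' j' : nat) (f : nat -> nat * nat) k : k < p -> f k = (i', j') -> (i', j') \in map f (iota 0 p).
  by move=> kp <-; apply: map_f; rewrite mem_iota.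
have ip := ltn_trans ij jp.
rewrite !mem_cat; case/or4P: sh => /eqP /= E.
- by rewrite (mi i j _ j)// E.
- by rewrite (mi i j (fun k => (k, a.1)) i)// ?orbT ?E.
- by rewrite (mi i j (fun k => (a.2, k)) j)// ?orbT ?E.
- by rewrite (mi i j (fun k => (k, a.2)) i)// ?orbT ?E.
Qed.

End index_pairs.

Section coherence_events.
Context {d : measure_display} {T : measurableType d} {R : realType}.
Context (P : probability T R) (X : nat -> nat -> {RV P >-> R}).
Variables (mu sigma : R) (n p : nat) (x y : R).
Hypotheses (sigma0 : sigma != 0) (n0 : (0 < n)%N) (x0 : 0 <= x).
Hypothesis xE : x ^+ 2 = 4 * ln p%:R - ln (ln p%:R) + y.
Let zf (t : R) := (t - mu) / sigma.
Let X2 (ij : nat * nat) : {RV P >-> R} := X ij.1 ij.2.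

Lemma sample_corr_colcorr (i j : 'I_p) w :
  sample_corr (data_matrix X n p w) i j = colcorr X2 zf n i j w.
Proof.
rewrite (@sample_corrE _ _ _ _ (fun k i => (X k i w - mu) / sigma) mu sigma)//.
by move=> k i'; rewrite mxE mulrC divfK// addrC subrK.
Qed.

Lemma coherence_stat_le : [set w | coherence_stat X n p w <= y] =
  none (exceed X2 zf n x) (index_pairs p).
Proof.
have N0 : 0 < n%:R :> R by rewrite ltr0n.
have sN0 : 0 < Num.sqrt n%:R :> R by rewrite sqrtr_gt0.
have key (t : R) : 0 <= t -> (n%:R * t ^+ 2 <= x ^+ 2) = (t <= x / Num.sqrt n%:R).
  move=> t0; rewrite ler_pdivlMr//.
  have -> : n%:R * t ^+ 2 = (Num.sqrt n%:R * t) ^+ 2 by rewrite exprMn sqr_sqrtr// ltW.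
  by rewrite ler_pXn2r ?nnegrE ?mulr_ge0 ?(ltW sN0)// mulrC.
have coh0 w : 0 <= coherence (data_matrix X n p w) by exact: bigmax_ge_id.
have eq1 w : (coherence_stat X n p w <= y) = (coherence (data_matrix X n p w) <= x / Num.sqrt n%:R).
  rewrite -key// xE /coherence_stat.
  by apply/idP/idP; set c := _ * _ ^+ 2; lra.
have nex a w : (~ exceed X2 zf n x a w) <-> `|colcorr X2 zf n a.1 a.2 w| <= x / Num.sqrt n%:R.
  by rewrite -key// real_normK ?num_real// /exceed/=; split => [/negP|h]; [|apply/negP]; rewrite -leNgt.
apply/seteqP; split => w /=.
  rewrite eq1 => /bigmax_leP[_ h] [i j]; rewrite mem_index_pairs/= => /andP[ij jp]; apply/nex.
  have ip := ltn_trans ij jp.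
  by have := h (Ordinal ip, Ordinal jp) ij; rewrite sample_corr_colcorr.
move=> h; rewrite eq1; apply/bigmax_leP; split; first by rewrite divr_ge0// ltW.
move=> [i j] /= ij; rewrite sample_corr_colcorr.
apply: (nex (nat_of_ord i, nat_of_ord j) w).1; apply: h.
by rewrite mem_index_pairs/= ij ltn_ord.
Qed.

End coherence_events.

Section regime_inequalities.
Context {R : realType}.
Variables (n : nat) (l x v c eps K : R).
Hypotheses (n0 : (0 < n)%N) (l1 : 1 <= l) (x0 : 0 < x) (x2l : x ^+ 2 <= 5 * l).
Hypotheses (v0 : 0 < v) (v10 : v <= 1 / 10) (c0 : 0 < c) (eps0 : 0 <= eps) (K0 : 0 <= K).
Local Notation N := (n%:R : R).
Let N0 : 0 < N. Proof. by rewrite ltr0n. Qed.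
Let l0 : 0 < l. Proof. exact: lt_le_trans l1. Qed.
Let sN0 : 0 < Num.sqrt N. Proof. by rewrite sqrtr_gt0. Qed.
Let sNE : Num.sqrt N ^+ 2 = N. Proof. by rewrite sqr_sqrtr// ltW. Qed.

Let sqr_le (a b : R) : 0 <= b -> a ^+ 2 <= b ^+ 2 -> a <= b.
Proof.
move=> b0 ab; have [a0|a0] := leP 0 a; last by rewrite (le_trans (ltW a0)).
by rewrite -(@ler_pXn2r _ 2).
Qed.

Let l_le_l3 : l <= l ^+ 3.
Proof. by rewrite exprS ler_peMr ?(ltW l0)// exprn_ege1. Qed.
Let l2_le_l3 : l ^+ 2 <= l ^+ 3.
Proof. by rewrite [leRHS]exprS ler_peMl ?exprn_ge0 ?(ltW l0). Qed.

Lemma ratio_sqr : (x / Num.sqrt N) ^+ 2 <= 5 * l / N.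
Proof. by rewrite expr_div_n sNE ler_pM2r ?invr_gt0. Qed.

Lemma ratio_le (W r : R) : 0 <= W -> 0 <= r -> 5 * W ^+ 2 * l <= r ^+ 2 * N ->
  W * (x / Num.sqrt N) <= r.
Proof.
move=> W0 r0 H; apply: sqr_le => //; rewrite exprMn.
apply: (le_trans (ler_wpM2l (sqr_ge0 W) ratio_sqr)).
by rewrite mulrA ler_pdivrMr// (le_trans _ H)// le_eqVlt; apply/orP; left; apply/eqP; ring.
Qed.

Lemma ratio_cube_le (W : R) : 0 <= W -> 125 * W ^+ 2 * l ^+ 3 <= N ->
  W * (x ^+ 3 / Num.sqrt N) <= 1.
Proof.
move=> W0 H; apply: sqr_le => //; rewrite expr1n exprMn expr_div_n sNE.
have -> : (x ^+ 3) ^+ 2 = (x ^+ 2) ^+ 3 by rewrite -!exprM mulnC.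
have x6 : (x ^+ 2) ^+ 3 <= (5 * l) ^+ 3 by rewrite lerXn2r ?nnegrE ?sqr_ge0 ?mulr_ge0 ?(ltW l0).
rewrite mulrA ler_pdivrMr// mul1r; apply: le_trans H.
apply: (le_trans (ler_wpM2l (sqr_ge0 W) x6)).
by rewrite le_eqVlt; apply/orP; left; apply/eqP; ring.
Qed.

Let L := (v ^+ 2)^-1 + 1.
Let L0 : 0 < L. Proof. by rewrite addr_gt0 ?invr_gt0 ?exprn_gt0. Qed.

Let thE : md_th n x L = L * (x / Num.sqrt N). Proof. by rewrite /md_th mulrA. Qed.

Lemma md_th_small : 80 * (gauss_cst * L) ^+ 2 * l ^+ 3 <= N ->
  gauss_cst * md_th n x L <= 1 / 4.
Proof.
move=> H; rewrite thE mulrA; apply: ratio_le => //.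
  by rewrite mulr_ge0 ?(ltW L0)// (le_trans _ (@gauss_cst_ge54 R)).
apply: (@le_trans _ _ ((80 * (gauss_cst * L) ^+ 2 * l ^+ 3) / 16)); last first.
  have -> : (1 / 4 : R) ^+ 2 * N = N / 16 by field.
  by rewrite ler_pM2r.
rewrite ler_pdivlMr//; have -> : 5 * (gauss_cst * L) ^+ 2 * l * 16 = 80 * (gauss_cst * L) ^+ 2 * l by ring.
by rewrite ler_wpM2l// mulr_ge0 ?sqr_ge0.
Qed.

Lemma md_th_le_c : 125 * L ^+ 2 * l <= N * c ^+ 2 -> 5 * md_th n x L <= 2 * c.
Proof.
move=> H; rewrite thE mulrA; apply: ratio_le.
- by rewrite mulr_ge0 ?(ltW L0).
- by rewrite mulr_ge0 ?(ltW c0).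
have -> : 5 * (5 * L) ^+ 2 * l = 125 * L ^+ 2 * l by ring.
apply: (le_trans H); rewrite exprMn mulrC ler_wpM2r ?ler_peMl ?sqr_ge0 ?(ltW N0)//.
by rewrite -natrX ler1n.
Qed.

Lemma md_delta_small : 144 * (N * eps) <= v / 2 ->
  125 * (L ^+ 3 * (12 * (K ^+ 2 + 1) + 2 * gauss_cst) * (4 / v)) ^+ 2 * l ^+ 3 <= N ->
  0 <= md_delta eps K n x L /\ N * md_delta eps K n x L <= v / 2.
Proof.
move=> H1 H2; have g0 : 0 <= gauss_cst :> R by rewrite (le_trans _ (@gauss_cst_ge54 R)).
have K20 : 0 <= 12 * (K ^+ 2 + 1) + 2 * gauss_cst :> R.
  by rewrite addr_ge0 ?mulr_ge0// addr_ge0 ?sqr_ge0.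
have dE : md_delta eps K n x L = 72 * eps + (12 * (K ^+ 2 + 1) + 2 * gauss_cst) * md_th n x L ^+ 3.
  by rewrite /md_delta; ring.
have th0 : 0 <= md_th n x L by rewrite thE mulr_ge0 ?(ltW L0)// divr_ge0 ?ltW.
split; first by rewrite dE; apply: addr_ge0; apply: mulr_ge0 => //; exact: exprn_ge0.
set A := 12 * (K ^+ 2 + 1) + 2 * gauss_cst in H2 K20 dE.
have W0 : 0 <= L ^+ 3 * A * (4 / v) by rewrite mulr_ge0 ?divr_ge0 ?(ltW v0)// mulr_ge0// exprn_ge0// ltW.
have := ratio_cube_le W0 H2; rewrite mulrAC.
have -> : L ^+ 3 * A * (x ^+ 3 / Num.sqrt N) = N * (A * md_th n x L ^+ 3).
  rewrite thE exprMn expr_div_n [Num.sqrt N ^+ 3]exprS sNE.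
  by field; rewrite !gt_eqF.
set B := N * _; rewrite mulrA ler_pdivrMr// mul1r => h.
by rewrite dE mulrDr -/B; lra.
Qed.

Lemma delta_powers (del : R) : 0 <= del -> N * del <= v / 2 ->
  [/\ del <= 1, (1 + del) ^+ n <= 1 + v & 1 - v <= (1 - del) ^+ n].
Proof.
move=> d0 H; have N1 : 1 <= N by rewrite ler1n.
have d1 : del <= 1.
  have : del <= N * del by rewrite ler_peMl.
  have := v10; lra.
split => //.
  apply: (@le_trans _ _ (expR (N * del))).
    by rewrite mulrC expRM_natr lerXn2r ?nnegrE ?addr_ge0 ?expR_ge0// expR_ge1Dx.
  have Nd0 : 0 <= N * del by rewrite mulr_ge0// ltW.
  have Nd : 0 <= N * del <= 1 / 2 by rewrite Nd0; have := v10; lra.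
  by apply: (le_trans (expR_le1D2x Nd)); lra.
apply: (@le_trans _ _ (1 - N * del)); first by have := v0; lra.
have d1' : 0 <= 1 - del by rewrite subr_ge0.
elim: n => [|k IH]; first by rewrite mul0r subr0 expr0.
rewrite exprS -natr1.
have : (1 - del) * (1 - k%:R * del) <= (1 - del) * (1 - del) ^+ k by rewrite ler_wpM2l.
have : 0 <= k%:R * del * del by rewrite !mulr_ge0.
lra.
Qed.

Let dd := v / (20 * l).
Let C0 := expR 1 * K + 6.
Let h := C0 * Num.sqrt (N * l).
Let C00 : 0 <= C0. Proof. by rewrite addr_ge0// mulr_ge0 ?expR_ge0. Qed.
Let hE : h ^+ 2 / N = C0 ^+ 2 * l.
Proof. by rewrite exprMn sqr_sqrtr ?mulr_ge0 ?ltW//; field; rewrite gt_eqF. Qed.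

Lemma link_hyps : 20 / v * C0 ^+ 2 * l ^+ 3 <= N ->
  20 * (C0 ^+ 2) ^+ 2 * l ^+ 3 <= v ^+ 2 * N ->
  [/\ 0 <= dd, 2 * dd < 1, h ^+ 2 / N <= dd * N &
      2 * dd * (Num.sqrt N * x) + h ^+ 2 / N <= Num.sqrt N * (v / x)].
Proof.
move=> H1 H2.
have dd0 : 0 < dd by rewrite divr_gt0// mulr_gt0.
split; first exact: ltW.
- rewrite /dd mulrA ltr_pdivrMr ?mulr_gt0// mul1r.
  have := l1; have := v10; lra.
- rewrite hE /dd; have -> : v / (20 * l) * N = v * N / (20 * l) by ring.
  rewrite ler_pdivlMr ?mulr_gt0// -ler_pdivrMl//.
  apply: le_trans H1; rewrite [leLHS](_ : _ = 20 / v * C0 ^+ 2 * l ^+ 2); last by ring.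
  by rewrite ler_wpM2l// mulr_ge0 ?sqr_ge0// divr_ge0// ltW.
rewrite hE [leRHS]mulrA ler_pdivlMr//.
have t1 : 2 * dd * x ^+ 2 <= v / 2.
  apply: (@le_trans _ _ (2 * dd * (5 * l))).
    by rewrite ler_wpM2l// mulr_ge0// ltW.
  by rewrite le_eqVlt; apply/orP; left; apply/eqP; rewrite /dd; field; rewrite gt_eqF.
have t2 : C0 ^+ 2 * l * (x / Num.sqrt N) <= v / 2.
  apply: ratio_le; rewrite ?mulr_ge0 ?sqr_ge0 ?divr_ge0 ?(ltW l0) ?(ltW v0)//.
  have -> : (v / 2) ^+ 2 * N = v ^+ 2 * N / 4 by field.
  rewrite ler_pdivlMr//; apply: le_trans H2.
  by rewrite le_eqVlt; apply/orP; left; apply/eqP; ring.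
rewrite [leLHS](_ : _ = Num.sqrt N * (2 * dd * x ^+ 2 + C0 ^+ 2 * l * (x / Num.sqrt N))).
  by rewrite ler_pM2l//; lra.
by field; rewrite gt_eqF.
Qed.

Let M1 := 160 / v.
Let b1 := M1 * l ^+ 2 / N.
Let b2 := Num.sqrt (l / N).
Let M10 : 0 < M1. Proof. by rewrite divr_gt0. Qed.

Lemma chernoff_q : M1 * l ^+ 3 <= N -> M1 ^+ 2 * l ^+ 3 <= N -> M1 ^+ 2 * l <= N * c ^+ 2 ->
  expR 1 * K * M1 ^+ 2 * l ^+ 3 <= N -> 2 * (N * eps) <= 1 ->
  [/\ 0 < b1, b1 <= 1, b1 <= c &
   expR (N * (b1 * (2 * eps) + expR 1 * K * b1 ^+ 2) - b1 * (dd * N)) <= expR (1 - 7 * l)].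
Proof.
move=> H1 H1' H2 H3 H4.
have b10 : 0 < b1 by rewrite divr_gt0// mulr_gt0// exprn_gt0.
have b11 : b1 <= 1.
  rewrite ler_pdivrMr// mul1r; apply: le_trans H1.
  by rewrite ler_wpM2l ?(ltW M10).
split => //.
  apply: sqr_le; first exact: ltW.
  rewrite expr_div_n exprMn ler_pdivrMr ?exprn_gt0//.
  have -> : c ^+ 2 * N ^+ 2 = N * (N * c ^+ 2) by ring.
  apply: (@le_trans _ _ (N * (M1 ^+ 2 * l))); last by rewrite ler_wpM2l// ltW.
  have -> : M1 ^+ 2 * (l ^+ 2) ^+ 2 = (l ^+ 3) * (M1 ^+ 2 * l) by ring.
  have Ml0 : 0 <= M1 ^+ 2 * l by apply: mulr_ge0; [exact: sqr_ge0|exact: ltW].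
  apply: ler_wpM2r => //.
  apply: le_trans H1'; rewrite ler_peMl ?exprn_ge0 ?(ltW l0)// exprn_ege1// /M1 ler_pdivlMr// mul1r.
  by have := v10; lra.
rewrite ler_expR.
have -> : b1 * (dd * N) = 8 * l by rewrite /b1 /dd /M1; field; rewrite !gt_eqF.
have e1 : N * (b1 * (2 * eps)) <= 1.
  apply: le_trans H4; rewrite mulrCA -[leRHS]mul1r.
  have -> : N * (2 * eps) = 2 * (N * eps) by ring.
  by rewrite ler_wpM2r// mulr_ge0// mulr_ge0// ltW.
have e2 : N * (expR 1 * K * b1 ^+ 2) <= l.
  have -> : N * (expR 1 * K * b1 ^+ 2) = expR 1 * K * M1 ^+ 2 * l ^+ 3 * l / N.
    by rewrite /b1; field; rewrite gt_eqF.
  by rewrite ler_pdivrMr// mulrC ler_wpM2l// ltW.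
rewrite mulrDr; move: e1 e2; set a := N * (b1 * _); set b := N * (_ * b1 ^+ 2) => *; lra.
Qed.

Lemma chernoff_s : l ^+ 3 <= N -> l <= N * c ^+ 2 -> 2 * (N * eps) <= 1 ->
  [/\ 0 < b2, b2 <= 1, b2 <= c &
   expR (N * (b2 * eps + expR 1 * K * b2 ^+ 2) - b2 * h) <= expR (1 - 6 * l)].
Proof.
move=> H1 H2 H3.
have lN : 0 < l / N by rewrite divr_gt0.
have b20 : 0 < b2 by rewrite sqrtr_gt0.
have b2E : b2 ^+ 2 = l / N by rewrite sqr_sqrtr// ltW.
have b21 : b2 <= 1.
  apply: sqr_le => //; rewrite b2E expr1n ler_pdivrMr// mul1r.
  exact: le_trans H1.
split => //.
  by apply: sqr_le; [exact: ltW|rewrite b2E ler_pdivrMr// mulrC].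
rewrite ler_expR b2E.
have -> : b2 * h = C0 * l.
  rewrite /h mulrCA /b2 -sqrtrM ?ltW//; congr (_ * _).
  have -> : l / N * (N * l) = l ^+ 2 by field; rewrite gt_eqF.
  by rewrite sqrtr_sqr gtr0_norm.
have e1 : N * (b2 * eps) <= N * eps.
  by rewrite ler_wpM2l ?(ltW N0)// ler_piMl.
have -> : N * (b2 * eps + expR 1 * K * (l / N)) = N * (b2 * eps) + expR 1 * K * l.
  by field; rewrite gt_eqF.
rewrite /C0; have Ne : 0 <= N * eps by rewrite mulr_ge0// ltW.
by move: e1 H3 Ne; set a := N * (b2 * _); set b := N * eps => *; lra.
Qed.

Lemma triple_exponent : 5 * l <= N -> 5 * l <= N * c ^+ 2 -> 2 * (N * eps) <= 1 ->
  125 * (8 * K ^+ 3) ^+ 2 * l ^+ 3 <= N ->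
  let b := x / Num.sqrt N in
  [/\ 0 <= b, b <= c &
    expR (N * (2 * b * eps + b ^+ 2 * (1 + 5 * eps) + 8 * b ^+ 3 * K ^+ 3)
      - 2 * b * (Num.sqrt N * (x - v / x))) <= expR (6 - x ^+ 2)].
Proof.
move=> H1 H2 H3 H4 b.
have b0 : 0 <= b by rewrite divr_ge0 ?ltW.
have bE : b ^+ 2 = x ^+ 2 / N by rewrite expr_div_n sNE.
have b1' : b <= 1.
  by have := @ratio_le 1 1; rewrite mul1r !expr1n mulr1 mul1r; apply.
split => //.
  have := @ratio_le 1 c; rewrite mul1r expr1n mulr1 [c ^+ 2 * _]mulrC; apply => //.
  exact: ltW.
rewrite ler_expR.
have Ne : 0 <= N * eps by rewrite mulr_ge0// ltW.
have b21 : b ^+ 2 <= 1 by rewrite exprn_ile1.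
have e1 : N * (2 * b * eps) <= 2 * (N * eps).
  have -> : N * (2 * b * eps) = b * (2 * (N * eps)) by ring.
  by rewrite ler_piMl// mulr_ge0.
have e2 : N * (b ^+ 2 * (1 + 5 * eps)) <= x ^+ 2 + 5 * (N * eps).
  have -> : N * (b ^+ 2 * (1 + 5 * eps)) = N * b ^+ 2 + b ^+ 2 * (5 * (N * eps)) by ring.
  apply: lerD; last by rewrite ler_piMl// mulr_ge0.
  by rewrite bE mulrCA divff ?mulr1// gt_eqF.
have e3 : N * (8 * b ^+ 3 * K ^+ 3) <= 1.
  have -> : N * (8 * b ^+ 3 * K ^+ 3) = 8 * K ^+ 3 * (x ^+ 3 / Num.sqrt N).
    rewrite /b expr_div_n [Num.sqrt N ^+ 3]exprS sNE.
    by field; rewrite !gt_eqF.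
  by apply: ratio_cube_le => //; rewrite mulr_ge0 ?exprn_ge0.
have -> : 2 * b * (Num.sqrt N * (x - v / x)) = 2 * x ^+ 2 - 2 * v.
  by rewrite /b; field; rewrite !gt_eqF.
rewrite !mulrDr; move: e1 e2 e3 Ne H3 v10.
set q := N * eps; set q1 := N * (2 * _ * _); set q2 := N * (8 * _ * _).
by rewrite !mulrDr; set q3 := N * (_ * 1); set q4 := N * (_ * (5 * _)) => *; lra.
Qed.

End regime_inequalities.

Section none_close.
Context {d : measure_display} {T : measurableType d} {R : realType}.
Context (P : probability T R) (X : nat * nat -> {RV P >-> R}).
Hypotheses (Xind : mutually_independent X) (Xid : identically_distributed X).
Variables (zf : R -> R).
Hypothesis mzf : measurable_fun setT zf.
Local Notation E1 := (E1 X zf).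
Local Notation exceed := (exceed X zf).
Local Notation Pr A := (fine (P A)).
Variables (tau c eps K : R).
Hypotheses (tau0 : 0 <= tau) (c0 : 0 < c) (eps01 : 0 <= eps <= 1).
Hypothesis m0_close : `|E1 (chi tau) - 1| <= eps.
Hypothesis m1_close : `|E1 (trunc tau)| <= eps.
Hypothesis m2_close : `|E1 (fun z => trunc tau z ^+ 2) - 1| <= eps.
Hypothesis HK : E1 (majorant tau c) <= K.
Variables (n p : nat) (l x v : R).
Hypotheses (n0 : (0 < n)%N) (l1 : 1 <= l) (x0 : 0 < x) (x2l : x ^+ 2 <= 5 * l).
Hypotheses (v0 : 0 < v) (v10 : v <= 1 / 10) (Bx : 1 <= 2 * x ^+ 2 * v ^+ 3).
Local Notation N := (n%:R : R).

(* One constant dominating all those that the inequalities in n, l, c and eps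
   required below involve. *)
Definition regime_const (v K : R) : R :=
  let L := (v ^+ 2)^-1 + 1 in
  let C0 := expR 1 * K + 6 in
  let M1 := 160 / v in
  foldr Num.max 288 [:: 288 / v; 80 * (gauss_cst * L) ^+ 2; 125 * L ^+ 2;
    125 * (L ^+ 3 * (12 * (K ^+ 2 + 1) + 2 * gauss_cst) * (4 / v)) ^+ 2;
    20 / v * C0 ^+ 2; 20 * (C0 ^+ 2) ^+ 2 / v ^+ 2; M1; M1 ^+ 2;
    expR 1 * K * M1 ^+ 2; 125 * (8 * K ^+ 3) ^+ 2].

Hypothesis reg1 : regime_const v K * l ^+ 3 <= N.
Hypothesis reg2 : regime_const v K * l <= N * c ^+ 2.
Hypothesis reg3 : regime_const v K * (N * eps) <= 1.

Let W := regime_const v K.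
Let K0 : 0 <= K.
Proof. by apply: le_trans HK; apply: E1_H_ge0 => //; exact: ltW. Qed.
Let eps0 : 0 <= eps. Proof. by case/andP: eps01. Qed.
Let l0 : 0 < l. Proof. exact: lt_le_trans l1. Qed.
Let Ne0 : 0 <= N * eps. Proof. by rewrite mulr_ge0. Qed.
Let c0' : 0 <= c. Proof. exact: ltW. Qed.

Let up3 w : w <= W -> w * l ^+ 3 <= N.
Proof. by move=> wW; apply: le_trans reg1; rewrite ler_wpM2r// exprn_ge0// ltW. Qed.
Let upc w : w <= W -> w * l <= N * c ^+ 2.
Proof. by move=> wW; apply: le_trans reg2; rewrite ler_wpM2r// ltW. Qed.
Let upe w : w <= W -> w * (N * eps) <= 1.
Proof. by move=> wW; apply: le_trans reg3; rewrite ler_wpM2r. Qed.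
Let l_le_l3 : l <= l ^+ 3.
Proof. by rewrite exprS ler_peMr ?(ltW l0)// exprn_ege1. Qed.

Let W288 : 288 <= W. Proof. by rewrite /W /regime_const /= !le_max lexx !orbT. Qed.
Let W_small w : w <= 288 -> w <= W. Proof. by move=> h; exact: le_trans W288. Qed.

Let Ne_small : 144 * (N * eps) <= v / 2.
Proof.
have : 288 / v * (N * eps) <= 1 by apply: upe; rewrite /W /regime_const /= !le_max lexx ?orbT.
have -> : 288 / v * (N * eps) = 2 * (144 * (N * eps)) / v by ring.
by rewrite ler_pdivrMr// mul1r ler_pdivlMr// [_ * 2]mulrC.
Qed.

Let L := (v ^+ 2)^-1 + 1.
Let delta_bounds : [/\ md_delta eps K n x L <= 1, (1 + md_delta eps K n x L) ^+ n <= 1 + v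
  & 1 - v <= (1 - md_delta eps K n x L) ^+ n].
Proof.
have [] := @md_delta_small _ n l x v eps K n0 l1 x0 x2l v0 eps0 Ne_small.
  by apply: up3; rewrite /W /regime_const /= !le_max lexx !orbT.
exact: delta_powers.
Qed.

Let thc : gauss_cst * md_th n x L <= 1 / 4.
Proof.
apply: (@md_th_small _ n l x v) => //.
by apply: up3; rewrite /W /regime_const /= !le_max lexx !orbT.
Qed.

Let thc' : 5 * md_th n x L <= 2 * c.
Proof.
apply: (@md_th_le_c _ n l x v c) => //.
by apply: upc; rewrite /W /regime_const /= !le_max lexx !orbT.
Qed.

Let k := phi x / x.
Let pb := N * eps + (2 * expR (1 - 7 * l) + 2 * expR (1 - 6 * l)).
Let E := expR (6 - x ^+ 2).
Let dd := v / (20 * l).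
Let h := (expR 1 * K + 6) * Num.sqrt (N * l).

Let k0 : 0 <= k. Proof. by rewrite divr_ge0 ?phi_ge0 ?ltW. Qed.
Let pb0 : 0 <= pb. Proof. by rewrite addr_ge0// addr_ge0// mulr_ge0 ?expR_ge0. Qed.

Let md_up i j s : i != j -> `|s| = 1 ->
  Pr (md_event X zf tau n i j s (x - v / x)) <= (1 + 20 * v) * k.
Proof.
have [d1 d2 d3] := delta_bounds => ij s1.
exact: (Pr_md_close_upper Xind Xid mzf tau0 c0' eps01 m0_close m1_close m2_close HK n0 ij s1 x0 v0 v10 thc thc' d1 d2).
Qed.

Let md_lo i j s : i != j -> `|s| = 1 ->
  (1 - 20 * v) * k <= Pr (md_event X zf tau n i j s (x + v / x)).
Proof.
have [d1 d2 d3] := delta_bounds => ij s1.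
exact: (Pr_md_close_lower Xind Xid mzf tau0 c0' eps01 m0_close m1_close m2_close HK n0 ij s1 x0 v0 v10 thc thc' d1 d2 d3 Bx).
Qed.

Let link : [/\ 0 <= dd, 2 * dd < 1, h ^+ 2 / N <= dd * N &
      2 * dd * (Num.sqrt N * x) + h ^+ 2 / N <= Num.sqrt N * (v / x)].
Proof.
apply: link_hyps => //.
  by apply: up3; rewrite /W /regime_const /= !le_max lexx !orbT.
have : 20 * ((expR 1 * K + 6) ^+ 2) ^+ 2 / v ^+ 2 * l ^+ 3 <= N.
  by apply: up3; rewrite /W /regime_const /= !le_max lexx !orbT.
by rewrite mulrAC ler_pdivrMr ?exprn_gt0// mulrC [_ ^+ 2 * N]mulrC [l ^+ 3 * _]mulrC.
Qed.

Let bad i : measurable (~` good_column X zf tau n (dd * N) h i) /\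
  Pr (~` good_column X zf tau n (dd * N) h i) <= pb.
Proof.
have Ne2 : 2 * (N * eps) <= 1 by apply: upe; apply: W_small; rewrite ler_nat.
have [] := @chernoff_q _ n l v c eps K n0 l1 v0 v10 c0 eps0.
- by apply: up3; rewrite /W /regime_const /= !le_max lexx !orbT.
- by apply: up3; rewrite /W /regime_const /= !le_max lexx !orbT.
- by apply: upc; rewrite /W /regime_const /= !le_max lexx !orbT.
- by apply: up3; rewrite /W /regime_const /= !le_max lexx !orbT.
- exact: Ne2.
move=> b10 b11 b1c H1.
have [] := @chernoff_s _ n l c eps K n0 l1 c0 eps0.
- by rewrite -[l ^+ 3]mul1r; apply: up3; apply: W_small; rewrite ler1n.
- by rewrite -[leLHS]mul1r; apply: upc; apply: W_small; rewrite ler1n.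
- exact: Ne2.
move=> b20 b21 b2c H2.
split.
  exact: (measurable_bad_column Xind Xid mzf tau0 c0' m0_close m1_close m2_close HK n i (dd * N) h b10 b11 b1c b20 b21 b2c).
apply: (le_trans (Pr_bad_column Xind Xid mzf tau0 c0' m0_close m1_close m2_close HK n i (dd * N) h b10 b11 b1c b20 b21 b2c)).
by rewrite lerD2l; apply: lerD; rewrite ler_pM2l.
Qed.

Let del := 40 * v * k + 2 * pb.

Lemma Pr_exceed_close i j : i != j -> `|Pr (exceed n x (i, j)) - 2 * k| <= del.
Proof.
move=> ij; have [dd0 dd2 hN slack] := link.
have mb i' := (bad i').1; have Pb i' := (bad i').2.
have lo := Pr_exceed_ge mzf n0 x0 v0 dd0 dd2 hN slack mb Pb i j.
have hi := Pr_exceed_le mzf n0 x0 dd0 dd2 hN slack mb Pb i j.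
have n1 : `|1 : R| = 1 by rewrite normr1.
have n2 : `|-1 : R| = 1 by rewrite normrN1.
have u1 := md_up ij n1; have u2 := md_up ij n2.
have l1' := md_lo ij n1; have l2' := md_lo ij n2.
rewrite ler_norml /del; apply/andP; split.
  by move: l1' l2' lo; move: (fine _) (fine _) (fine _) => a b e; lra.
by move: u1 u2 hi; move: (fine _) (fine _) (fine _) => a b e; lra.
Qed.

Let triple i j i' : i != j -> i != i' -> j != i' ->
  Pr (exceed n x (i, j) `&` exceed n x (i, i')) <= 4 * E + 3 * pb.
Proof.
move=> ij ii' ji'; have [dd0 dd2 hN slack] := link.
have mb i' := (bad i').1; have Pb i' := (bad i').2.
apply: (Pr_exceed2 mzf n0 x0 dd0 dd2 hN slack mb Pb) => s1 s2 hs1 hs2.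
have := @triple_exponent _ n l x v c eps K n0 l1 x0 x2l v10 c0 eps0 K0.
case => [||||b0 bc H].
- apply: (@le_trans _ _ (5 * l ^+ 3)); first by rewrite ler_pM2l.
  by apply: up3; apply: W_small; rewrite ler_nat.
- by apply: upc; apply: W_small; rewrite ler_nat.
- by apply: upe; apply: W_small; rewrite ler_nat.
- by apply: up3; rewrite /W /regime_const /= !le_max lexx !orbT.
by apply: le_trans H; apply: (Pr_triple Xind Xid mzf tau0 c0' eps01 m1_close m2_close HK).
Qed.

Let gam := 4 * E + 3 * pb + (6 * k + 2 * pb) ^+ 2.

Let pair_gam a b : (a.1 < a.2)%N -> (b.1 < b.2)%N -> a != b -> share a b ->
  Pr (exceed n x a `&` exceed n x b) <= 4 * E + 3 * pb.
Proof.
case: a b => i j [i' j'] /= ij ij' ab /or4P[] /= /eqP e.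
- move: ab; rewrite e xpair_eqE eqxx /= => jj'.
  by apply: triple => //; rewrite -?e neq_ltn ?ij ?ij' // e ij'.
- rewrite -e in ij' *; rewrite [exceed n x (i', i)]exceedC.
  by apply: triple; rewrite neq_ltn ?ij ?ij' ?(ltn_trans ij' ij) ?orbT.
- rewrite -e in ij' *; rewrite [exceed n x (i, j)]exceedC.
  by apply: triple; rewrite neq_ltn ?ij ?ij' ?(ltn_trans ij ij') ?orbT.
- move: ab; rewrite -e xpair_eqE eqxx andbT => ii'; rewrite -e in ij'.
  rewrite [exceed n x (i, j)]exceedC [exceed n x (i', j)]exceedC.
  by apply: triple => //; rewrite neq_ltn ?ij ?ij' ?orbT.
Qed.

Lemma none_close :
  `|Pr (none (exceed n x) (index_pairs p)) - expR (- (2 * k * (size (index_pairs p))%:R))| <=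
  (size (index_pairs p))%:R * (del + (2 * k) ^+ 2 + (4 * p)%:R * gam).
Proof.
have E0 : 0 <= E by exact: expR_ge0.
have kpb0 : 0 <= 6 * k + 2 * pb by rewrite addr_ge0// mulr_ge0.
have gam0 : 0 <= gam by rewrite addr_ge0 ?sqr_ge0// addr_ge0// mulr_ge0.
have H := @poisson_none _ _ _ P _ (exceed n x) (measurable_exceed X mzf n x) share (2 * k) del gam (4 * p).
apply: H => //.
- by rewrite mulr_ge0.
- by move=> a s; exact: exceed_indep.
- exact: uniq_index_pairs.
- move=> [i j]; rewrite mem_index_pairs/= => /andP[ij _]; apply: Pr_exceed_close.
  by rewrite neq_ltn ij.
- by move=> a _; exact: count_share.
move=> a b; rewrite !mem_index_pairs => /andP[a12 _] /andP[b12 _] ab sab.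
apply: lerD; first exact: pair_gam.
have le6 e : (e.1 < e.2)%N -> Pr (exceed n x e) <= 6 * k + 2 * pb.
  case: e => i j /= ij; have /Pr_exceed_close : i != j by rewrite neq_ltn ij.
  rewrite /del ler_norml => /andP[_].
  have : v * k <= 1 / 10 * k by rewrite ler_wpM2r.
  by move: (fine _) => q; lra.
by rewrite expr2; apply: ler_pM; rewrite ?Pr_ge0 ?le6.
Qed.

End none_close.

Section growth_regime.
Context {R : realType}.

Lemma near_powR (s C : R) : 0 < s -> \forall n \near \oo, C <= n%:R `^ s.
Proof.
move=> s0; pose D := Num.max 1 C.
have D1 : 1 <= D by rewrite le_max lexx.
near=> n; apply: (@le_trans _ _ D); first by rewrite le_max lexx orbT.
have -> : D = (D `^ s^-1) `^ s by rewrite -powRrM mulVf ?gt_eqF// powRr1// (le_trans _ D1).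
rewrite ge0_ler_powR ?nnegrE ?powR_ge0 ?(ltW s0)//.
near: n; exact: nbhs_infty_ger.
Unshelve. all: by end_near. Qed.

Variables (alpha t Ce : R) (p : nat -> nat).
Hypotheses (a02 : 0 < alpha <= 2) (t0 : 0 < t) (Ce0 : 0 < Ce).
Hypothesis p_oo : p n @[n --> \oo] --> \oo.
Let l n : R := ln (p n)%:R.
Let beta := alpha / (4 + alpha).
Hypothesis l_small : l =o_\oo (fun n => n%:R `^ beta : R).

Definition trunc_level (n : nat) : R := n%:R `^ (1 / (4 + alpha)).
Definition exp_rate (n : nat) : R := t / 2 / trunc_level n `^ (2 - alpha).
Definition trunc_error (n : nat) : R := Ce * expR (- (t / 2 * trunc_level n `^ alpha)).

Let a0 : 0 < alpha. Proof. by case/andP: a02. Qed.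
Let a2 : alpha <= 2. Proof. by case/andP: a02. Qed.
Let a4 : 0 < 4 + alpha. Proof. by rewrite addr_gt0. Qed.
Let beta0 : 0 < beta. Proof. by rewrite divr_gt0. Qed.
Let beta3 : 3 * beta <= 1.
Proof. by rewrite mulrA ler_pdivrMr// mul1r; have := a2; lra. Qed.

Lemma near_ln_ge C : \forall n \near \oo, C <= l n.
Proof.
move/cvgnyPge : p_oo => /(_ (Num.truncn (expR C)).+1) H.
near=> n; rewrite -[C]expRK /l ler_ln ?posrE ?expR_gt0//.
  apply: ltW; apply: (lt_le_trans (truncnS_gt (expR C))).
  by rewrite ler_nat; near: n.
have : ((Num.truncn (expR C)).+1 <= p n)%N by near: n.
by rewrite ltr0n; exact: leq_trans.
Unshelve. all: by end_near. Qed.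

Lemma near_ln_le e : 0 < e -> \forall n \near \oo, l n <= e * n%:R `^ beta.
Proof.
move=> e0; have /eqoP/(_ _ e0) H := l_small.
near=> n; apply: le_trans (ler_norm _) _.
rewrite -[X in _ <= _ * X]ger0_norm ?powR_ge0//.
by near: n; exact: H.
Unshelve. all: by end_near. Qed.

Lemma near_ln_cube C : \forall n \near \oo, C * l n ^+ 3 <= n%:R.
Proof.
pose e := (1 + `|C|)^-1; have C1 : 0 < 1 + `|C| by rewrite ltr_pwDl.
have e0 : 0 < e by rewrite invr_gt0.
near=> n.
have l0 : 0 <= l n by near: n; exact: near_ln_ge.
have ln_ : l n <= e * n%:R `^ beta by near: n; exact: near_ln_le.
have n1 : 1 <= n%:R :> R by near: n; exact: nbhs_infty_ger.
have l3 : l n ^+ 3 <= e * n%:R.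
  apply: (@le_trans _ _ ((e * n%:R `^ beta) ^+ 3)).
    by rewrite lerXn2r ?nnegrE// mulr_ge0 ?powR_ge0// ltW.
  rewrite exprMn; apply: ler_pM; rewrite ?exprn_ge0 ?powR_ge0 ?(ltW e0)//.
    rewrite exprS ler_piMr ?(ltW e0)// exprn_ile1 ?(ltW e0)//.
    by rewrite /e invf_le1// lerDl.
  rewrite -powR_mulrn ?powR_ge0// -powRrM -[leRHS]powRr1 ?(le_trans ler01 n1)//.
  by apply: ler_powR => //; rewrite mulrC.
apply: (@le_trans _ _ ((1 + `|C|) * (e * n%:R))); last first.
  by rewrite mulrA /e divff ?mul1r// gt_eqF.
apply: (@le_trans _ _ ((1 + `|C|) * l n ^+ 3)); last by rewrite ler_wpM2l// ltW.
by rewrite ler_wpM2r ?exprn_ge0// (le_trans (ler_norm C))// lerDr.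
Unshelve. all: by end_near. Qed.

Lemma trunc_levelE n : trunc_level n `^ alpha = n%:R `^ beta.
Proof. by rewrite /trunc_level -powRrM /beta mulrAC mul1r. Qed.

Lemma near_ln_rate C : \forall n \near \oo, C * l n <= n%:R * exp_rate n ^+ 2.
Proof.
pose e := (t / 2) ^+ 2 / (1 + `|C|); have C1 : 0 < 1 + `|C| by rewrite ltr_pwDl.
have t2 : 0 < (t / 2) ^+ 2 by rewrite exprn_gt0// divr_gt0.
have e0 : 0 < e by rewrite divr_gt0.
near=> n.
have l0 : 0 <= l n by near: n; exact: near_ln_ge.
have ln_ : l n <= e * n%:R `^ beta by near: n; exact: near_ln_le.
have n1 : 1 <= n%:R :> R by near: n; exact: nbhs_infty_ger.
have n0 : 0 < n%:R :> R by exact: lt_le_trans n1.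
have -> : n%:R * exp_rate n ^+ 2 = (t / 2) ^+ 2 * n%:R `^ (3 * beta).
  rewrite /exp_rate expr_div_n mulrCA; congr (_ * _).
  rewrite /trunc_level -powRrM -powR_mulrn ?powR_ge0// -powRrM -powRN.
  rewrite -[X in X * _]powRr1 ?(ltW n0)// -powRD; last by rewrite (gt_eqF n0) implybT.
  by congr powR; rewrite /beta; field; rewrite gt_eqF.
apply: (@le_trans _ _ ((1 + `|C|) * (e * n%:R `^ beta))); last first.
  rewrite mulrA /e mulrCA divff ?mulr1 ?gt_eqF// ler_pM2l//.
  by apply: ler_powR => //; rewrite ler_peMl ?(ltW beta0)// ler1n.
apply: (@le_trans _ _ ((1 + `|C|) * l n)); last by rewrite ler_wpM2l// ltW.
by rewrite ler_wpM2r// (le_trans (ler_norm C))// lerDr.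
Unshelve. all: by end_near. Qed.

Lemma near_trunc_error e : 0 < e ->
  \forall n \near \oo, n%:R * trunc_error n * expR (3 * l n) <= e.
Proof.
move=> e0; near=> n.
have n1 : 1 <= n%:R :> R by near: n; exact: nbhs_infty_ger.
have n0 : 0 < n%:R :> R by exact: lt_le_trans n1.
set q := n%:R `^ beta; set r := n%:R `^ (beta / 2).
have qE : q = r ^+ 2.
  rewrite /q /r -powR_mulrn ?powR_ge0// -powRrM; congr powR.
  by rewrite divfK.
have r0 : 0 < r by exact: powR_gt0.
have ln_ : l n <= t / 24 * q by rewrite /q; near: n; apply: near_ln_le; rewrite divr_gt0.
have q1 : 4 * Ce / (t * e) <= q by rewrite /q; near: n; exact: near_powR.
have r1 : 16 / (beta * t) <= r by rewrite /r; near: n; apply: near_powR; rewrite divr_gt0.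
have lnn : ln n%:R <= t / 8 * q.
  have h1 : ln r <= r by apply: ltW; exact: ln_sublinear.
  have h2 : ln n%:R = 2 / beta * ln r.
    by rewrite /r ln_powR; field; rewrite gt_eqF.
  rewrite h2; apply: (@le_trans _ _ (2 / beta * r)).
    by rewrite ler_wpM2l// divr_ge0// ltW.
  rewrite qE expr2 mulrA ler_wpM2r ?(ltW r0)//.
  apply: (@le_trans _ _ (t / 8 * (16 / (beta * t)))).
    by rewrite le_eqVlt; apply/orP; left; apply/eqP; field; rewrite !gt_eqF.
  by rewrite ler_wpM2l// divr_ge0// ltW.
rewrite /trunc_error trunc_levelE -/q -[X in X * _ * _]lnK ?posrE//.
rewrite mulrCA -mulrA -mulrA -!expRD.
apply: (@le_trans _ _ (Ce * expR (- (t / 4 * q)))).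
  by rewrite ler_pM2l// ler_expR; lra.
rewrite expRN ler_pdivrMr ?expR_gt0//.
have : 1 + t / 4 * q <= expR (t / 4 * q) by exact: expR_ge1Dx.
move: q1; rewrite ler_pdivrMr ?mulr_gt0// => q1 hq.
have : e * (t / 4 * q) <= e * expR (t / 4 * q) by rewrite ler_pM2l//; lra.
by lra.
Unshelve. all: by end_near. Qed.

End growth_regime.

Section standardization.
Context {d : measure_display} {T : measurableType d} {R : realType}.
Context (P : probability T R) (X : {RV P >-> R}).
Variables (mu sigma alpha t : R).
Local Notation Ex f := (\int[P]_w (f w)).

Lemma powRD_le (a b : R) : 0 < alpha <= 2 -> 0 <= a -> 0 <= b ->
  (a + b) `^ alpha <= 4 * (a `^ alpha + b `^ alpha).
Proof.
move=> /andP[a0 a2] a_0 b_0.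
wlog ab : a b a_0 b_0 / a <= b.
  move=> H; have [|/ltW] := leP a b; first exact: H.
  by rewrite addrC [X in 4 * X]addrC; exact: H.
apply: (@le_trans _ _ ((2 * b) `^ alpha)).
  by rewrite ge0_ler_powR ?nnegrE ?(ltW a0) ?addr_ge0 ?mulr_ge0//; lra.
rewrite powRM//; apply: ler_pM; rewrite ?powR_ge0// ?lerDr ?powR_ge0//.
have -> : 4 = 2 `^ 2 :> R by rewrite powR_mulrn// -natrX.
by apply: ler_powR => //; rewrite ler1n.
Qed.

Hypotheses (a02 : 0 < alpha <= 2) (t0 : 0 < t) (sigma0 : 0 < sigma ^+ 2).
Hypothesis EX : ('E_P[X] = mu%:E)%E.
Hypothesis VX : ('V_P[X] = (sigma ^+ 2)%:E)%E.
Hypothesis Epsi : ('E_P[fun w => expR (t * `|X w| `^ alpha)] < +oo)%E.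
Let Y w := (X w - mu) / sigma.

Let mexp (s : R) (Z : T -> R) : measurable_fun setT Z ->
  measurable_fun setT (fun w => expR (s * `|Z w| `^ alpha)).
Proof.
move=> mZ; apply: measurableT_comp; first exact: measurable_expR.
apply: measurable_funM => //.
apply: (@measurableT_comp _ _ _ _ _ _ (fun x : R => x `^ alpha)); first exact: measurable_powR.
exact: measurableT_comp.
Qed.

Let ipsi : P.-integrable setT (EFin \o (fun w => expR (t * `|X w| `^ alpha))).
Proof.
apply/integrableP; split; first by apply/measurable_EFinP; exact: mexp.
move: Epsi; rewrite unlock; congr (_ < _)%E; apply: eq_integral => w _ /=.
by congr EFin; rewrite [RHS]ger0_norm ?expR_ge0.
Qed.

Let dom (C : R) (f : T -> R) : measurable_fun setT f ->
  (forall w, `|f w| <= C * expR (t * `|X w| `^ alpha)) -> P.-integrable setT (EFin \o f).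
Proof.
move=> mf fC; apply: (le_integrable _ _ _ (integrableZl measurableT C ipsi)) => //.
  exact/measurable_EFinP.
by move=> w _ /=; rewrite lee_fin (le_trans (fC w))// ler_norm.
Qed.

Let sig0 : 0 < `|sigma|.
Proof. by rewrite normr_gt0; apply: contraTneq sigma0 => ->; rewrite expr0n ltxx. Qed.

Let iX : P.-integrable setT (EFin \o X).
Proof.
have /andP[a0 _] := a02; have [C C0 HC] := polynomial_le_expR_powR t0 a0.
apply: (dom (C := C)) => // w; apply: le_trans (HC (X w)).
rewrite -[X w ^+ 2]real_normK ?num_real//; have := normr_ge0 (X w); move: `|X w| => z z0.
have := sqr_ge0 (z - 1); nra.
Qed.

Let iX2 : P.-integrable setT (EFin \o (fun w => (X w - mu) ^+ 2)).
Proof.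
have /andP[a0 _] := a02; have [C C0 HC] := polynomial_le_expR_powR t0 a0.
apply: (dom (C := 2 * (1 + mu ^+ 2) * C)).
  by apply: measurable_funX; exact: measurable_funB.
move=> w; rewrite ger0_norm ?sqr_ge0// -mulrA.
apply: (@le_trans _ _ (2 * (1 + mu ^+ 2) * (1 + X w ^+ 2) ^+ 2)); last first.
  by apply: ler_wpM2l; [apply: mulr_ge0 => //; rewrite addr_ge0 ?sqr_ge0|exact: HC].
move: (X w) => z.
have h1 : (z - mu) ^+ 2 <= 2 * (z ^+ 2 + mu ^+ 2) by have := sqr_ge0 (z + mu); nra.
have h2 : 1 + z ^+ 2 <= (1 + z ^+ 2) ^+ 2 by have := sqr_ge0 z; nra.
apply: (le_trans h1); rewrite -mulrA ler_pM2l//.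
apply: (@le_trans _ _ ((1 + mu ^+ 2) * (1 + z ^+ 2))).
  have := sqr_ge0 (mu * z); rewrite exprMn; move: (z ^+ 2) (mu ^+ 2) => a b; lra.
by rewrite ler_wpM2l// addr_ge0 ?sqr_ge0.
Qed.

Let ExX : Ex X = mu.
Proof. by move: EX; rewrite unlock /Rintegral => ->. Qed.

Let ExX2 : Ex (fun w => (X w - mu) ^+ 2) = sigma ^+ 2.
Proof.
move: VX; rewrite /variance /= unlock EX /= unlock /Rintegral => h.
rewrite -[RHS]/(fine (sigma ^+ 2)%:E) -h; congr fine.
Qed.

Lemma standardized_mean : Ex Y = 0.
Proof.
have iB : P.-integrable setT (EFin \o (fun w => X w - mu)).
  exact: (integrableB measurableT iX (bmeas_integrable P (bmeas_cst mu))).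
have -> : Ex Y = sigma^-1 * Ex (fun w => X w - mu).
  by rewrite -(RintegralZl _ measurableT iB); apply: eq_Rintegral => w _; rewrite /Y mulrC.
rewrite RintegralB//; last exact: (bmeas_integrable P (bmeas_cst mu)).
by rewrite ExX Ex_cst subrr mulr0.
Qed.

Lemma standardized_second_moment : Ex (fun w => Y w ^+ 2) = 1.
Proof.
have -> : Ex (fun w => Y w ^+ 2) = (sigma ^+ 2)^-1 * Ex (fun w => (X w - mu) ^+ 2).
  by rewrite -(RintegralZl _ measurableT iX2); apply: eq_Rintegral => w _; rewrite /Y expr_div_n mulrC.
by rewrite ExX2 mulVf// gt_eqF.
Qed.

Lemma standardized_exp_moment : exists2 s, 0 < s &
  P.-integrable setT (EFin \o (fun w => expR (s * `|Y w| `^ alpha))).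
Proof.
have sa0 : 0 < `|sigma| `^ alpha by exact: powR_gt0.
pose s := t * `|sigma| `^ alpha / 4; exists s; first by rewrite divr_gt0// mulr_gt0.
apply: (dom (C := expR (t * `|mu| `^ alpha))).
  by apply: mexp; apply: measurable_funM => //; exact: measurable_funB.
move=> w; rewrite ger0_norm ?expR_ge0// -expRD ler_expR.
have Yle : `|sigma| `^ alpha * `|Y w| `^ alpha <= 4 * (`|X w| `^ alpha + `|mu| `^ alpha).
  rewrite -powRM// /Y normrM normfV mulrC divfK ?gt_eqF//.
  apply: (@le_trans _ _ ((`|X w| + `|mu|) `^ alpha)); last exact: powRD_le.
  by have /andP[a0 _] := a02; rewrite ge0_ler_powR ?nnegrE ?(ltW a0)// ?addr_ge0// ler_normB.
have -> : s * `|Y w| `^ alpha = t / 4 * (`|sigma| `^ alpha * `|Y w| `^ alpha) by rewrite /s; ring.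
apply: (@le_trans _ _ (t / 4 * (4 * (`|X w| `^ alpha + `|mu| `^ alpha)))).
  by rewrite ler_wpM2l// divr_ge0// ltW.
by rewrite le_eqVlt; apply/orP; left; apply/eqP; field.
Qed.

End standardization.

Section error_terms.
Context {R : realType}.

Lemma expRN_lip (a b : R) : 0 <= a -> 0 <= b -> `|expR (- a) - expR (- b)| <= `|a - b|.
Proof.
wlog ab : a b / a <= b.
  move=> H; have [|/ltW] := leP a b; first exact: H.
  by move=> ba a0 b0; rewrite distrC (distrC a); exact: H.
move=> a0 b0; rewrite (distrC a) [leRHS]ger0_norm ?subr_ge0// ger0_norm; last first.
  by rewrite subr_ge0 ler_expR lerN2.
have -> : expR (- b) = expR (- a) * expR (- (b - a)) by rewrite -expRD; congr expR; ring.
have h1 : expR (- a) <= 1 by rewrite -expR0 ler_expR oppr_le0.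
have h2 : 1 - (b - a) <= expR (- (b - a)) by exact: expR_ge1Dx.
have h3 := expR_ge0 (- a).
have h4 : expR (- (b - a)) <= 1 by rewrite -expR0 ler_expR oppr_le0 subr_ge0.
move: h1 h2 h3 h4; move: (expR (- a)) (expR (- (b - a))) => u w *.
have : u * (1 - w) <= 1 * (1 - w) by rewrite ler_wpM2r// subr_ge0.
lra.
Qed.

Definition error_const (A : R) : R :=
  20 * (A + 1) + 15 + 2 * (A + 1) ^+ 2 + 2 * (6 * (A + 1) + 2) ^+ 2 + (A + 2).

Lemma poisson_error (q p k pb E v A e S : R) : 1 <= p -> 0 <= k -> 0 <= pb -> 0 <= E ->
  0 <= v -> 0 <= A -> e <= 1 -> S = p * (p - 1) / 2 ->
  `|q - expR (- (2 * k * S))| <=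
    S * (40 * v * k + 2 * pb + (2 * k) ^+ 2 + 4 * p * (4 * E + 3 * pb + (6 * k + 2 * pb) ^+ 2)) ->
  `|p ^+ 2 * k - A| <= e -> v <= e -> p ^+ 3 * pb <= e -> p ^+ 3 * E <= e -> p^-1 <= e ->
  `|q - expR (- A)| <= error_const A * e.
Proof.
move=> p1 k0 pb0 E0 v0 A0 e1 SE hq hk hv hpb hE hp.
have p0 : 0 < p by exact: lt_le_trans p1.
have e0 : 0 < e by rewrite (lt_le_trans _ hp)// invr_gt0.
pose w := p^-1; pose Q := p ^+ 2 * k; pose a := p ^+ 3 * pb; pose b := p ^+ 3 * E.
have w0 : 0 < w by rewrite invr_gt0.
have w1 : w <= 1 by exact: le_trans e1.
have Q0 : 0 <= Q by rewrite mulr_ge0// exprn_ge0// ltW.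
have a_0 : 0 <= a by rewrite mulr_ge0// exprn_ge0// ltW.
have b_0 : 0 <= b by rewrite mulr_ge0// exprn_ge0// ltW.
have QA : Q <= A + 1.
  by move: hk; rewrite -/Q ler_norml => /andP[_]; lra.
have t1 : S * (40 * v * k + 2 * pb + (2 * k) ^+ 2 + 4 * p * (4 * E + 3 * pb + (6 * k + 2 * pb) ^+ 2))
    <= 20 * (v * Q) + a * w + 2 * (Q * w) ^+ 2 + 8 * b + 6 * a + 2 * (6 * Q + 2 * (a * w)) ^+ 2 * w.
  apply: (@le_trans _ _ (p ^+ 2 / 2 * (40 * v * k + 2 * pb + (2 * k) ^+ 2 + 4 * p * (4 * E + 3 * pb + (6 * k + 2 * pb) ^+ 2)))).
    rewrite ler_wpM2r//.
      have z1 : 0 <= 4 * E + 3 * pb + (6 * k + 2 * pb) ^+ 2 by rewrite addr_ge0 ?sqr_ge0// addr_ge0// mulr_ge0.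
      rewrite addr_ge0//; last by rewrite mulr_ge0// mulr_ge0// ltW.
      by rewrite addr_ge0 ?sqr_ge0// addr_ge0// mulr_ge0// mulr_ge0.
    by rewrite SE ler_pM2r// expr2 ler_pM2l//; lra.
  rewrite le_eqVlt; apply/orP; left; apply/eqP; rewrite /Q /a /b /w; field.
  by rewrite gt_eqF.
have t2 : `|expR (- (2 * k * S)) - expR (- A)| <= e + (A + 1) * e.
  have S0 : 0 <= S by rewrite SE mulr_ge0// mulr_ge0 ?subr_ge0// ltW.
  apply: le_trans (expRN_lip _ A0) _; first by rewrite mulr_ge0// mulr_ge0.
  have -> : 2 * k * S - A = (Q - A) - Q * w.
    by rewrite SE /Q /w; field; rewrite gt_eqF.
  apply: (le_trans (ler_normB _ _)); apply: lerD => //.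
  have Qw0 : 0 <= Q * w by rewrite mulr_ge0// ltW.
  by rewrite (ger0_norm Qw0); apply: ler_pM => //; exact: ltW.
have -> : q - expR (- A) = (q - expR (- (2 * k * S))) + (expR (- (2 * k * S)) - expR (- A)) by ring.
apply: (le_trans (ler_normD _ _)).
apply: (le_trans (lerD (le_trans hq t1) t2)).
have s1 : v * Q <= e * (A + 1) by exact: ler_pM.
have s2 : a * w <= e * 1 by apply: ler_pM => //; exact: ltW.
have s3 : (Q * w) ^+ 2 <= (A + 1) ^+ 2 * e.
  rewrite exprMn; apply: ler_pM; rewrite ?sqr_ge0//.
    by rewrite lerXn2r ?nnegrE// (le_trans Q0).
  by apply: le_trans hp; rewrite expr2 ler_piMl// ltW.
have s4 : (6 * Q + 2 * (a * w)) ^+ 2 * w <= (6 * (A + 1) + 2) ^+ 2 * e.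
  have aw0 : 0 <= a * w by rewrite mulr_ge0// ltW.
  apply: ler_pM; rewrite ?sqr_ge0 ?(ltW w0)//.
  have z1 : 0 <= 6 * Q + 2 * (a * w) by apply: addr_ge0; apply: mulr_ge0.
  have z2 : 0 <= 6 * (A + 1) + 2 by move: A0; lra.
  rewrite lerXn2r ?nnegrE//.
  by apply: lerD; [rewrite ler_pM2l|move: s2 e1; lra].
rewrite /error_const.
set X2 := (6 * (A + 1) + 2) ^+ 2 in s4 *; set X1 := (A + 1) ^+ 2 in s3 *.
set Y2 := (6 * Q + _) ^+ 2 * w in s4; set Y1 := (Q * w) ^+ 2 in s3.
have -> : 2 * (6 * Q + 2 * (a * w)) ^+ 2 * w = 2 * Y2 by rewrite /Y2; ring.
rewrite -/Y1; have hE' : b <= e := hE; have hp' : a <= e := hpb.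
by move: s1 s2 s3 s4 hE' hp'; lra.
Qed.

Lemma kappa_close (y l x p : R) : 1 <= l -> 0 < x -> 3 * l <= x ^+ 2 ->
  x ^+ 2 = 4 * l - ln l + y -> p = expR l ->
  `|p ^+ 2 * (phi x / x) - 1 / Num.sqrt (8 * pi) * expR (- y / 2)| <=
    (Num.sqrt (2 * pi))^-1 * expR (- y / 2) * (2 + `|y|) / Num.sqrt l.
Proof.
move=> l1 x0 x3 xE pE.
have l0 : 0 < l by exact: lt_le_trans l1.
pose s := Num.sqrt l; have s0 : 0 < s by rewrite sqrtr_gt0.
have sE : s ^+ 2 = l by rewrite sqr_sqrtr// ltW.
have s1 : 1 <= s by rewrite -sqrtr1 ler_sqrt// ltW.
pose B := (Num.sqrt (2 * pi))^-1 * expR (- y / 2) : R.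
have B0 : 0 <= B by rewrite mulr_ge0 ?expR_ge0// invr_ge0 sqrtr_ge0.
have -> : p ^+ 2 * (phi x / x) = B * (s / x).
  have e1 : p ^+ 2 * expR (- x ^+ 2 / 2) = expR (- y / 2) * s.
    have -> : s = expR (ln l / 2).
      have -> : ln l / 2 = ln s by rewrite -sE lnXn// -[ln s *+ 2]mulr_natl; field.
      by rewrite lnK// posrE.
    rewrite pE -expRM_natr -!expRD; congr expR; rewrite xE; by field.
  rewrite phiE (_ : p ^+ 2 * _ = (Num.sqrt (2 * pi))^-1 * (p ^+ 2 * expR (- x ^+ 2 / 2)) / x); last by ring.
  by rewrite e1 /B; ring.
have -> : 1 / Num.sqrt (8 * pi) * expR (- y / 2) = B * (1 / 2).
  have -> : Num.sqrt (8 * pi) = 2 * Num.sqrt (2 * pi) :> R.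
    have -> : 8 * pi = 2 ^+ 2 * (2 * pi) :> R by ring.
    by rewrite sqrtrM ?sqr_ge0// sqrtr_sqr ger0_norm.
  by rewrite /B; field; rewrite gt_eqF// sqrtr_gt0 mulr_gt0// pi_gt0.
rewrite -mulrBr normrM (ger0_norm B0) -[leRHS]mulrA ler_wpM2l//.
have lnl : 0 <= ln l <= 2 * s.
  rewrite ln_ge0//= -sE lnXn// mulr_natl.
  have : ln s < s by exact: ln_sublinear.
  rewrite !mulr2n; lra.
have -> : s / x - 1 / 2 = (4 * l - x ^+ 2) / (2 * (x * (x + 2 * s))).
  by rewrite -sE; field; rewrite !gt_eqF// addr_gt0// mulr_gt0.
have D0 : 0 < 2 * (x * (x + 2 * s)) by rewrite !mulr_gt0// addr_gt0// mulr_gt0.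
rewrite normrM normfV (gtr0_norm D0) ler_pdivrMr//.
have -> : 4 * l - x ^+ 2 = ln l - y by rewrite xE; ring.
have n1 : `|ln l - y| <= 2 * s + `|y|.
  by move: lnl => /andP[a b]; apply: (le_trans (ler_normB _ _)); rewrite lerD2r ger0_norm.
apply: (le_trans n1).
have D1 : s ^+ 2 <= 2 * (x * (x + 2 * s)).
  have : 0 <= x * s by rewrite mulr_ge0// ltW.
  rewrite mulrDr -expr2 sE; nra.
apply: (@le_trans _ _ ((2 + `|y|) / s * s ^+ 2)); last first.
  by rewrite ler_wpM2l// divr_ge0 ?addr_ge0// ltW.
have -> : (2 + `|y|) / s * s ^+ 2 = 2 * s + `|y| * s by field; rewrite gt_eqF.
by rewrite lerD2l ler_peMr.
Qed.

End error_terms.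

Section small_terms.
Context {R : realType}.
Variables (y e : R).
Hypothesis e0 : 0 < e.
Let B : R := (Num.sqrt (2 * pi))^-1 * expR (- y / 2).

Definition log_threshold : R := foldr Num.max 16 [:: 2 * `|y|; (e ^+ 3)^-1; 8 / e + 1;
  4 * expR (6 - y) / e; e^-1; (B * (2 + `|y|) / e) ^+ 2].

Variables (l p : R).
Hypotheses (ll : log_threshold <= l) (pE : p = expR l).
Let x := Num.sqrt (4 * l - ln l + y).

Let lge w : w <= log_threshold -> w <= l.
Proof. by move=> h; exact: le_trans ll. Qed.

Let l16 : 16 <= l. Proof. by apply: lge; rewrite /log_threshold /= !le_max lexx !orbT. Qed.
Let l0 : 0 < l. Proof. by apply: lt_le_trans l16. Qed.
Let l1 : 1 <= l. Proof. by apply: le_trans l16; rewrite ler1n. Qed.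
Let ly : 2 * `|y| <= l. Proof. by apply: lge; rewrite /log_threshold /= !le_max lexx. Qed.

Let x2_bounds : 3 * l <= 4 * l - ln l + y <= 5 * l.
Proof.
pose s := Num.sqrt l; have s0 : 0 < s by rewrite sqrtr_gt0.
have sE : s ^+ 2 = l by rewrite sqr_sqrtr// ltW.
have s4 : 4 <= s.
  have -> : 4 = Num.sqrt 16 :> R.
    by rewrite (_ : 16 = 4 ^+ 2) ?sqrtr_sqr ?ger0_norm// -natrX.
  by rewrite ler_sqrt// ltW.
have lnl0 : 0 <= ln l by exact: ln_ge0.
have lnl : ln l <= 2 * s.
  by rewrite -sE lnXn// -[ln s *+ 2]mulr_natl ler_pM2l// ltW// ln_sublinear.
have s2 : 4 * s <= l by rewrite -sE expr2 ler_pM2r.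
have := ler_norm y; have := ler_norm (- y); rewrite normrN => *.
by move: ly => ?; apply/andP; split; lra.
Qed.

Lemma threshold_sqr : x ^+ 2 = 4 * l - ln l + y.
Proof.
rewrite sqr_sqrtr//; have /andP[h _] := x2_bounds; apply: le_trans h.
by rewrite mulr_ge0// ltW.
Qed.

Lemma threshold_bounds : [/\ 1 <= l, 0 < x, 3 * l <= x ^+ 2 & x ^+ 2 <= 5 * l].
Proof.
have /andP[h1 h2] := x2_bounds; rewrite threshold_sqr; split => //.
by rewrite sqrtr_gt0; apply: lt_le_trans h1; rewrite mulr_gt0.
Qed.

Lemma threshold_cube : 1 <= 2 * x ^+ 2 * e ^+ 3.
Proof.
have [_ _ h _] := threshold_bounds.
have e3 : 0 < e ^+ 3 by exact: exprn_gt0.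
have : (e ^+ 3)^-1 <= l by apply: lge; rewrite /log_threshold /= !le_max lexx !orbT.
rewrite -(ler_pM2r e3) mulVf ?gt_eqF// => /le_trans; apply.
by rewrite ler_pM2r//; move: l0 h; lra.
Qed.

Lemma threshold_kappa : `|p ^+ 2 * (phi x / x) - 1 / Num.sqrt (8 * pi) * expR (- y / 2)| <= e.
Proof.
have [_ x0 h _] := threshold_bounds.
apply: (le_trans (kappa_close l1 x0 h threshold_sqr pE)); rewrite -/B.
have sl0 : 0 < Num.sqrt l by rewrite sqrtr_gt0.
have B0 : 0 <= B by rewrite mulr_ge0 ?expR_ge0// invr_ge0 sqrtr_ge0.
have C0 : 0 <= B * (2 + `|y|) / e by rewrite divr_ge0 ?(ltW e0)// mulr_ge0// addr_ge0.
have hl : (B * (2 + `|y|) / e) ^+ 2 <= l by apply: lge; rewrite /log_threshold /= !le_max lexx !orbT.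
rewrite ler_pdivrMr// [leRHS]mulrC -ler_pdivrMr//.
by rewrite -[leLHS]ger0_norm// -sqrtr_sqr ler_sqrt// ltW.
Qed.

Lemma threshold_inv : p^-1 <= e.
Proof.
have : e^-1 <= l by apply: lge; rewrite /log_threshold /= !le_max lexx !orbT.
move=> h; rewrite -[leRHS]invrK lef_pV2 ?posrE ?invr_gt0//; last by rewrite pE expR_gt0.
by apply: (le_trans h); rewrite pE (le_trans _ (expR_ge1Dx _))// lerDr.
Qed.

Lemma threshold_tail : 2 * expR (1 - 7 * l) + 2 * expR (1 - 6 * l) <= expR (- (3 * l)) * (e / 2).
Proof.
have h : 8 / e + 1 <= l by apply: lge; rewrite /log_threshold /= !le_max lexx !orbT.
have t1 : expR (1 - 7 * l) <= expR (1 - 6 * l) by rewrite ler_expR; move: l0; lra.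
have t2 : expR (1 - 6 * l) = expR (- (3 * l)) * expR (- (3 * l - 1)).
  by rewrite -expRD; congr expR; ring.
have t3 : expR (- (3 * l - 1)) <= e / 8.
  rewrite expRN -[e / 8]invrK lef_pV2 ?posrE ?expR_gt0 ?invr_gt0 ?divr_gt0// invf_div.
  by apply: le_trans (expR_ge1Dx _); move: l0 h; lra.
have t4 : expR (- (3 * l)) * expR (- (3 * l - 1)) <= expR (- (3 * l)) * (e / 8).
  by rewrite ler_pM2l ?expR_gt0.
by move: t1 t4; rewrite t2; move: (expR (1 - _)) (expR (- (3 * l)) * _) => *; lra.
Qed.

Lemma threshold_triple : p ^+ 3 * expR (6 - x ^+ 2) <= e.
Proof.
have h : 4 * expR (6 - y) / e <= l by apply: lge; rewrite /log_threshold /= !le_max lexx !orbT.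
have -> : p ^+ 3 * expR (6 - x ^+ 2) = expR (6 - y) * (l * expR (- l)).
  by rewrite pE -expRM_natr -[l in X in _ = _ * X]lnK ?posrE// -!expRD threshold_sqr; congr expR; rewrite lnK ?posrE//; ring.
have el : l ^+ 2 / 4 <= expR l.
  have -> : expR l = expR (l / 2) ^+ 2 by rewrite -expRM_natr divfK.
  have -> : l ^+ 2 / 4 = (l / 2) ^+ 2 by field.
  rewrite lerXn2r ?nnegrE ?expR_ge0 ?divr_ge0 ?(ltW l0)//.
  by apply: le_trans (expR_ge1Dx _); rewrite lerDr.
have l4 : l * expR (- l) <= 4 / l.
  rewrite expRN ler_pdivrMr ?expR_gt0// mulrAC ler_pdivlMr//.
  by move: el; rewrite -expr2; lra.
apply: (@le_trans _ _ (expR (6 - y) * (4 / l))); first by rewrite ler_wpM2l ?expR_ge0.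
by move: h; rewrite ler_pdivrMr// mulrA ler_pdivrMr// mulrC [l * e]mulrC.
Qed.

End small_terms.

Theorem theorem3 (d : measure_display) (T : measurableType d) (R : realType)
    (P : probability T R) (X : nat -> nat -> {RV P >-> R})
    (mu sigma alpha t0 : R) (p : nat -> nat) :
  iid (fun ij : nat * nat => X ij.1 ij.2) ->
  ('E_P[X 0%N 0%N] = mu%:E)%E ->
  ('V_P[X 0%N 0%N] = (sigma ^+ 2)%:E)%E ->
  0 < sigma ^+ 2 ->
  0 < alpha <= 2 ->
  0 < t0 ->
  ('E_P[fun w => expR (t0 * `|X 0%N 0%N w| `^ alpha)] < +oo)%E ->
  (forall n, (0 < p n)%N) ->
  p n @[n --> \oo] --> \oo ->
  (fun n => ln (p n)%:R : R) =o_\oo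
    (fun n => n%:R `^ (alpha / (4 + alpha)) : R) ->
  weak_cvg (fun n => coherence_stat X n (p n) : {RV P >-> R}) extreme1_cdf.
Proof.
move=> [Xind Xid] EX VX s20 a02 t00 Eexp p0 p_oo l_small y _.
pose X2 (ij : nat * nat) : {RV P >-> R} := X ij.1 ij.2.
have Xind2 : mutually_independent X2 by [].
have Xid2 : identically_distributed X2 by [].
have sig0 : sigma != 0 by apply: contraTneq s20 => ->; rewrite expr0n ltxx.
pose zf (z : R) := (z - mu) / sigma.
have mzf : measurable_fun setT zf by apply: measurable_funM => //; exact: measurable_funB.
have [s s0 ipsi] := standardized_exp_moment mu a02 t00 s20 Eexp.
have mY : measurable_fun setT (fun w => (X 0%N 0%N w - mu) / sigma).
  by apply: (measurableT_comp mzf).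
have [Ce [K [Ce0 tb]]] := truncation_bounds mY s0 a02 ipsi
  (standardized_mean sigma a02 t00 EX Eexp) (standardized_second_moment a02 t00 s20 EX VX Eexp).
pose A : R := 1 / Num.sqrt (8 * pi) * expR (- y / 2).
have A0 : 0 <= A by rewrite mulr_ge0 ?expR_ge0// divr_ge0 ?sqrtr_ge0.
have EC0 : 0 < error_const A.
  by rewrite /error_const; have := sqr_ge0 (A + 1); have := sqr_ge0 (6 * (A + 1) + 2); lra.
apply: cvg_EFin; first by near=> n; rewrite /cdf fin_num_measure.
apply/cvgrPdist_le => e e0.
pose e1 := Num.min (1 / 10) (e / error_const A).
have e10 : 0 < e1 by rewrite lt_min !divr_gt0.
have e1v : e1 <= 1 / 10 by rewrite ge_min lexx.
have e11 : e1 <= 1 by apply: (le_trans e1v); rewrite ler_pdivrMr// mul1r ler1n.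
have e1e : error_const A * e1 <= e by rewrite mulrC -ler_pdivlMr// ge_min lexx orbT.
pose W := regime_const e1 K.
have W288 : 288 <= W by rewrite /W /regime_const /= !le_max lexx !orbT.
have W0 : 0 < W by rewrite (lt_le_trans _ W288).
pose e2 := Num.min W^-1 (e1 / 2).
have e20 : 0 < e2 by rewrite lt_min invr_gt0 W0 divr_gt0.
near=> n.
have n0 : (0 < n)%N by near: n; exact: nbhs_infty_gt.
have N1 : 1 <= n%:R :> R by rewrite ler1n.
have N0 : 0 < n%:R :> R by rewrite ltr0n.
pose l : R := ln (p n)%:R.
have ll : log_threshold y e1 <= l by rewrite /l; near: n; exact: near_ln_ge.
have pE : (p n)%:R = expR l by rewrite /l lnK// posrE ltr0n.
pose x := Num.sqrt (4 * l - ln l + y).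
have [l1 x0 xl3 xl5] := threshold_bounds ll.
pose tau := trunc_level alpha n; pose c := exp_rate alpha s n; pose eps := trunc_error alpha s Ce n.
have tau0 : 0 < tau by exact: powR_gt0.
have c0 : 0 < c by rewrite divr_gt0 ?divr_gt0// powR_gt0.
have eps0 : 0 <= eps by rewrite mulr_ge0 ?expR_ge0// ltW.
have Neps : n%:R * eps * expR (3 * l) <= e2.
  by rewrite /eps /l; near: n; exact: (near_trunc_error a02 s0 Ce0 l_small e20).
have e3l : 1 <= expR (3 * l) by rewrite -expR0 ler_expR mulr_ge0// (le_trans ler01).
have Ne0 : 0 <= n%:R * eps by rewrite mulr_ge0// ltW.
have Ne : n%:R * eps <= W^-1.
  by apply: le_trans (le_trans Neps _); [rewrite ler_peMr|rewrite ge_min lexx].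
have eps1 : eps <= 1.
  apply: (@le_trans _ _ (n%:R * eps)); first by rewrite ler_peMl.
  by apply: (le_trans Ne); rewrite invf_le1//; apply: le_trans W288; rewrite ler1n.
have ct : c * tau `^ (2 - alpha) <= s / 2.
  by rewrite /c /exp_rate divfK// gt_eqF// powR_gt0.
have [m0 m1 m2 HK] := tb tau c (ltW tau0) (ltW c0) ct.
have reg1 : regime_const e1 K * l ^+ 3 <= n%:R.
  by rewrite /l; near: n; exact: (near_ln_cube a02 p_oo l_small).
have reg2 : regime_const e1 K * l <= n%:R * c ^+ 2.
  by rewrite /l /c; near: n; exact: (near_ln_rate a02 s0 p_oo l_small).
have reg3 : regime_const e1 K * (n%:R * eps) <= 1.
  by rewrite mulrC -ler_pdivlMr// div1r.
have eps01 : 0 <= eps <= 1 by rewrite eps0 eps1.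
have none_bound := @none_close _ _ _ P X2 Xind2 Xid2 zf mzf tau c eps K (ltW tau0) c0 eps01
  m0 m1 m2 HK n (p n) l x e1 n0 l1 x0 xl5 e10 e1v (threshold_cube e10 ll) reg1 reg2 reg3.
have -> : (fine \o (fun n => cdf (coherence_stat X n (p n) : {RV P >-> R}) y)) n =
    fine (P (none (exceed X2 zf n x) (index_pairs (p n)))).
  rewrite /= /cdf /distribution /pushforward; congr (fine (P _)).
  rewrite -(@coherence_stat_le _ _ _ P X mu sigma n (p n) x y)//.
  - exact: ltW.
  - exact: threshold_sqr ll.
rewrite distrC; apply: le_trans e1e.
change (is_true (`|fine (P (none (exceed X2 zf n x) (index_pairs (p n)))) - expR (- A)| <= error_const A * e1)).
have p1 : 1 <= (p n)%:R :> R by rewrite ler1n.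
pose pb := n%:R * eps + (2 * expR (1 - 7 * l) + 2 * expR (1 - 6 * l)).
have p3 : (p n)%:R ^+ 3 = expR (3 * l) by rewrite pE -expRM_natr mulrC.
apply: (@poisson_error _ _ (p n)%:R (phi x / x) pb (expR (6 - x ^+ 2)) e1 A e1 _
  p1 _ _ (expR_ge0 _) (ltW e10) A0 e11 (size_index_pairs R (p n))).
- by rewrite divr_ge0 ?phi_ge0 ?(ltW x0).
- by rewrite addr_ge0// addr_ge0// mulr_ge0 ?expR_ge0.
- by apply: (le_trans none_bound); rewrite natrM.
- exact: threshold_kappa pE.
- exact: lexx.
- rewrite p3 mulrDr; have tl := threshold_tail e10 ll.
  have t1 : expR (3 * l) * (n%:R * eps) <= e1 / 2.
    by rewrite mulrC (le_trans Neps)// ge_min lexx orbT.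
  have t2 : expR (3 * l) * (2 * expR (1 - 7 * l) + 2 * expR (1 - 6 * l)) <= e1 / 2.
    apply: le_trans (ler_wpM2l (expR_ge0 _) tl) _.
    by rewrite expRN mulVKf// gt_eqF// expR_gt0.
  by apply: (le_trans (lerD t1 t2)); rewrite -splitr.
- exact: threshold_triple pE.
- exact: (threshold_inv e10 ll pE).
Unshelve. all: by end_near. Qed.
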